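(* Let $A\in\mathbb{R}^{n\times d}$ with $n\ge d$, let $\lambda_1\in[1/2,1]$ be the largest eigenvalue of $A^\top A$, let $\lambda\in(0,\lambda_1)$ be an eigenvalue threshold and $\gamma\in(0,2/3]$ an eigengap parameter. For any $\epsilon\in(0,1)$ (and any failure probability $\delta\in(0,1)$) there is an $\epsilon$-approximate PCP algorithm for $(A,\lambda,\gamma)$ with running time $$\tilde{O}\left(\mathrm{nnz}(A)+\sqrt{\mathrm{nnz}(A)\cdot d\cdot\mathrm{sr}(A)}\;\frac{\kappa}{\gamma}\right).$$
   Context: Notation: $\mathrm{nnz}(A)$ is the number of nonzero entries of $A$; $\mathrm{sr}(A)=\|A\|_F^2/\|A\|_2^2=\|A\|_F^2/\lambda_1$ is the stable rank; $\kappa=\lambda_1/\lambda$. Norms are $\ell_2$ norms. Let $\lambda_1\ge\dots\ge\lambda_d\ge0$ be the eigenvalues of $A^\top A$ with orthonormal eigenvectors $\nu_1,\dots,\nu_d$. For $t>0$, $P_t$ denotes the orthogonal projection onto the span of those $\nu_i$ with $\lambda_i\ge t$. $\epsilon$-approximate PCP (principal component projection) algorithm: a randomized algorithm which, given any $v\in\mathbb{R}^d$, with probability at least $1-\delta$ returns a vector $w\in\mathbb{R}^d$ satisfying all of: (1) $\|P_{(1+\gamma)\lambda}(w-v)\|\le\epsilon\|v\|$; (2) $\|(I-P_{(1-\gamma)\lambda})w\|\le\epsilon\|v\|$; (3) $\|(P_{(1+\gamma)\lambda}-P_{(1-\gamma)\lambda})(w-v)\|\le\|(P_{(1+\gamma)\lambda}-P_{(1-\gamma)\lambda})v\|+\epsilon\|v\|$.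 $\tilde O$ hides factors polylogarithmic in the input parameters ($\lambda_1,\lambda,\gamma$, the size of $v$), the error rate $\epsilon$ and the failure probability $\delta$. Running time counts arithmetic operations in exact arithmetic (numerical constants depending only on $\lambda,\gamma,\epsilon$ may be precomputed). *)

(* Defs.v *)
From HB Require Import structures.
From mathcomp Require Import all_boot all_order all_algebra.
From mathcomp Require Import all_classical all_reals all_analysis.

Set Implicit Arguments.
Unset Strict Implicit.
Unset Printing Implicit Defensive.

Import Order.TTheory GRing.Theory Num.Theory.
Local Open Scope ring_scope.

(** * A randomized random-access machine over the reals

    A program manipulates finitely many named, infinite, zero-initialised
    arrays of naturals (indices and counters) and of reals (exact arithmetic);
    a scalar variable is an array used at index 0 only.  Programs are finite
    syntax, independent of the input and of the model [R] of the reals.  Reals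
    enter the control flow only through comparisons; there is no rounding, no
    square root and no other transcendental primitive.  The only source of
    randomness is a fair coin. *)

Inductive iexp : Type :=
| INum of nat
| IGet of nat & iexp                 (* IGet a i : cell i of integer array a *)
| IAdd of iexp & iexp
| ISub of iexp & iexp                (* truncated *)
| IHalf of iexp.

Inductive rexp : Type :=
| RNat of iexp
| RGet of nat & iexp
| RAdd of rexp & rexp
| RSub of rexp & rexp
| RMul of rexp & rexp
| RDiv of rexp & rexp.               (* x / 0 = 0 *)

Inductive bexp : Type :=
| BLti of iexp & iexp
| BLtr of rexp & rexp
| BNot of bexp
| BAnd of bexp & bexp.

Inductive cmd : Type :=
| Skip
| ISet of nat & iexp & iexp          (* ISet a i e : cell i of array a := e *)
| RSet of nat & iexp & rexp
| Flip of nat & iexp                 (* integer cell := fair random bit *)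
| Seq of cmd & cmd
| If of bexp & cmd & cmd
| While of bexp & cmd.

Section Semantics.
Variable R : realType.

Record state : Type := State {
  imem : nat -> nat -> nat;
  rmem : nat -> nat -> R }.

Definition upd (T : Type) (m : nat -> nat -> T) (a i : nat) (x : T) :
    nat -> nat -> T :=
  fun b j => if (b == a) && (j == i) then x else m b j.

Fixpoint ieval (s : state) (e : iexp) : nat :=
  match e with
  | INum k => k
  | IGet a i => imem s a (ieval s i)
  | IAdd e1 e2 => (ieval s e1 + ieval s e2)%N
  | ISub e1 e2 => (ieval s e1 - ieval s e2)%N
  | IHalf e1 => (ieval s e1)./2
  end.

Fixpoint reval (s : state) (e : rexp) : R :=
  match e with
  | RNat i => (ieval s i)%:R
  | RGet a i => rmem s a (ieval s i)
  | RAdd e1 e2 => reval s e1 + reval s e2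
  | RSub e1 e2 => reval s e1 - reval s e2
  | RMul e1 e2 => reval s e1 * reval s e2
  | RDiv e1 e2 => reval s e1 / reval s e2
  end.

Fixpoint beval (s : state) (b : bexp) : bool :=
  match b with
  | BLti e1 e2 => (ieval s e1 < ieval s e2)%N
  | BLtr e1 e2 => reval s e1 < reval s e2
  | BNot b1 => ~~ beval s b1
  | BAnd b1 b2 => beval s b1 && beval s b2
  end.

(** Every constant, memory access, arithmetic operation, comparison,
    assignment, coin flip and branching costs one unit. *)

Fixpoint icost (e : iexp) : nat :=
  match e with
  | INum _ => 1
  | IGet _ i => (icost i).+1
  | IAdd e1 e2 | ISub e1 e2 => (icost e1 + icost e2).+1
  | IHalf e1 => (icost e1).+1
  end.

Fixpoint rcost (e : rexp) : nat :=
  match e with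
  | RNat i | RGet _ i => (icost i).+1
  | RAdd e1 e2 | RSub e1 e2 | RMul e1 e2 | RDiv e1 e2 =>
      (rcost e1 + rcost e2).+1
  end.

Fixpoint bcost (b : bexp) : nat :=
  match b with
  | BLti e1 e2 => (icost e1 + icost e2).+1
  | BLtr e1 e2 => (rcost e1 + rcost e2).+1
  | BNot b1 => (bcost b1).+1
  | BAnd b1 b2 => (bcost b1 + bcost b2).+1
  end.

(** [exec c s w s' w' t]: started in [s] with the random bits [w] still to
    come, [c] halts in [s'] after [t] units of time, leaving the bits [w'].
    A flip on an exhausted tape is stuck, hence does not halt. *)

Inductive exec : cmd -> state -> seq bool -> state -> seq bool -> nat -> Prop :=
| ExecSkip s w : exec Skip s w s w 1
| ExecISet a i e s w :
    exec (ISet a i e) s w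
      (State (upd (imem s) a (ieval s i) (ieval s e)) (rmem s)) w
      (icost i + icost e).+1
| ExecRSet a i e s w :
    exec (RSet a i e) s w
      (State (imem s) (upd (rmem s) a (ieval s i) (reval s e))) w
      (icost i + rcost e).+1
| ExecFlip a i s b w :
    exec (Flip a i) s (b :: w)
      (State (upd (imem s) a (ieval s i) (nat_of_bool b)) (rmem s)) w
      (icost i).+1
| ExecSeq c1 c2 s1 w1 s2 w2 s3 w3 t1 t2 :
    exec c1 s1 w1 s2 w2 t1 -> exec c2 s2 w2 s3 w3 t2 ->
    exec (Seq c1 c2) s1 w1 s3 w3 (t1 + t2)%N
| ExecIf b c1 c2 s w s' w' t :
    exec (if beval s b then c1 else c2) s w s' w' t ->
    exec (If b c1 c2) s w s' w' (bcost b + t).+1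
| ExecWhileEnd b c s w :
    ~~ beval s b -> exec (While b c) s w s w (bcost b).+1
| ExecWhileStep b c s1 w1 s2 w2 s3 w3 t1 t2 :
    beval s1 b ->
    exec c s1 w1 s2 w2 t1 -> exec (While b c) s2 w2 s3 w3 t2 ->
    exec (While b c) s1 w1 s3 w3 (bcost b + t1 + t2).+1.

Lemma exec_det c s w s1 w1 t1 s2 w2 t2 :
  exec c s w s1 w1 t1 -> exec c s w s2 w2 t2 ->
  [/\ s1 = s2, w1 = w2 & t1 = t2].
Proof.
move=> H; elim: H s2 w2 t2 => {c s w s1 w1 t1}.
- by move=> s w s2 w2 t2 H; inversion H.
- by move=> a i e s w s2 w2 t2 H; inversion H.
- by move=> a i e s w s2 w2 t2 H; inversion H.
- by move=> a i s b w s2 w2 t2 H; inversion H.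
- move=> c1 c2 s1 w1 s2 w2 s3 w3 t1 t2 _ IH1 _ IH2 s4 w4 t4 H.
  inversion H as [| | | |? ? ? ? s5 w5 ? ? t5 t6 H1 H2| | |]; subst.
  case: (IH1 _ _ _ H1) => ? ? ?; subst.
  by case: (IH2 _ _ _ H2) => ? ? ?; subst.
- move=> b c1 c2 s w s' w' t _ IH s2 w2 t2 H.
  inversion H as [| | | | |? ? ? ? ? ? ? ? H1| |]; subst.
  by case: (IH _ _ _ H1) => ? ? ?; subst.
- move=> b c s w nb s2 w2 t2 H.
  inversion H as [| | | | | | |? ? ? ? ? ? ? ? ? ? yb]; subst => //.
  by rewrite yb in nb.
- move=> b c s1 w1 s2 w2 s3 w3 t1 t2 yb _ IH1 _ IH2 s4 w4 t4 H.
  inversion H as [| | | | | |? ? ? ? nb|? ? ? ? s5 w5 ? ? t5 t6 _ H1 H2]; subst.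
    by rewrite yb in nb.
  case: (IH1 _ _ _ H1) => ? ? ?; subst.
  by case: (IH2 _ _ _ H2) => ? ? ?; subst.
Qed.

(** Probability of an event about [N] independent fair bits. *)
Definition prob (N : nat) (E : pred (N.-tuple bool)) : R :=
  #|E|%:R / (2 ^ N)%:R.

End Semantics.

Section PCP.
Variable R : realType.

Definition l2norm (d : nat) (x : 'cV[R]_d) : R :=
  Num.sqrt (\sum_i x i 0 ^+ 2).

Definition nonzeros (n d : nat) (A : 'M[R]_(n, d)) : seq ('I_n * 'I_d) :=
  enum [pred ij : 'I_n * 'I_d | A ij.1 ij.2 != 0].

Definition nnz (n d : nat) (A : 'M[R]_(n, d)) : nat := size (nonzeros A).

(** [lam] and [nu] are the eigenvalues of [A^T A], in nonincreasing order and
    with multiplicity, and corresponding orthonormal eigenvectors. *)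
Definition eigen_decomposition (n d : nat) (A : 'M[R]_(n, d))
    (lam : 'I_d -> R) (nu : 'I_d -> 'cV[R]_d) : Prop :=
  [/\ forall i, A^T *m A *m nu i = lam i *: nu i,
      forall i j, (nu i)^T *m nu j = (i == j)%:R%:M,
      forall i j : 'I_d, (i <= j)%N -> lam j <= lam i
    & forall i, 0 <= lam i].

(** Orthogonal projection onto the span of the [nu i] with [t <= lam i]; the
    [nu i] are orthonormal. *)
Definition eigproj (d : nat) (lam : 'I_d -> R) (nu : 'I_d -> 'cV[R]_d) (t : R) :
    'M[R]_d :=
  \sum_(i | t <= lam i) nu i *m (nu i)^T.

(** [w] is an [eps]-approximate principal component projection of [v] at
    threshold [lambda] with eigengap [gamma]. *)
Definition approx_pcp (d : nat) (lam : 'I_d -> R) (nu : 'I_d -> 'cV[R]_d)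
    (lambda gamma eps : R) (v w : 'cV[R]_d) : bool :=
  let Phi := eigproj lam nu ((1 + gamma) * lambda) in
  let Plo := eigproj lam nu ((1 - gamma) * lambda) in
  [&& l2norm (Phi *m (w - v)) <= eps * l2norm v,
      l2norm ((1%:M - Plo) *m w) <= eps * l2norm v
    & l2norm ((Phi - Plo) *m (w - v)) <=
        l2norm ((Phi - Plo) *m v) + eps * l2norm v].

(** Stable rank, [l1] being the largest eigenvalue of [A^T A], i.e. the square
    of the spectral norm of [A]. *)
Definition stable_rank (n d : nat) (A : 'M[R]_(n, d)) (l1 : R) : R :=
  (\sum_i \sum_j A i j ^+ 2) / l1.

(** Input layout.  [A] is given by the list of its nonzero entries in row-major
    order.  Integer arrays: 0 holds [n], [d], [nnz A] and the number of
    precomputed constants; 1 and 2 hold the row and column indices of the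
    nonzero entries.  Real arrays: 0 holds the nonzero entries, 1 the vector,
    2 the four scalar parameters, 3 the precomputed constants [cst].
    All other cells are zero. *)
Definition load (T : Type) (x0 : T) (arrays : seq (seq T)) (a i : nat) : T :=
  nth x0 (nth [::] arrays a) i.

Definition input (n d : nat) (A : 'M[R]_(n, d)) (lambda gamma eps delta : R)
    (v : 'cV[R]_d) (cst : seq R) : state R :=
  State
    (load 0%N [:: [:: n; d; nnz A; size cst];
                  [seq nat_of_ord ij.1 | ij <- nonzeros A];
                  [seq nat_of_ord ij.2 | ij <- nonzeros A]])
    (load 0 [:: [seq A ij.1 ij.2 | ij <- nonzeros A];
                [seq v i 0 | i <- enum 'I_d];
                [:: lambda; gamma; eps; delta];
                cst]).

(** The result is read in real array 4. *)
Definition output (d : nat) (s : state R) : 'cV[R]_d := \col_i rmem s 4 i.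

(** On input [v], program [p] halts within time [T] whatever the coin flips,
    and its output is an [eps]-approximate PCP of [v] with probability at
    least [1 - delta].  Each precomputed constant costs one unit of time.  The
    choice of [N] is immaterial: no run exhausts the [N] bits, so the
    distribution of the output does not depend on it. *)
Definition pcp_algorithm (p : cmd) (cst : seq R) (n d : nat) (A : 'M[R]_(n, d))
    (lam : 'I_d -> R) (nu : 'I_d -> 'cV[R]_d)
    (lambda gamma eps delta : R) (T : 'cV[R]_d -> R) : Prop :=
  forall v : 'cV[R]_d,
  exists (N : nat) (out : N.-tuple bool -> state R),
    (forall w : N.-tuple bool, exists (rest : seq bool) (t : nat),
        exec p (input A lambda gamma eps delta v cst) w (out w) rest t
        /\ (t + size cst)%:R <= T v)
    /\ 1 - delta <=
         prob R [pred w : N.-tuple bool |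
                  approx_pcp lam nu lambda gamma eps v (output d (out w))].

(** The logarithm whose powers are hidden by the soft-O notation. *)
Definition log_factor (d : nat) (lambda gamma eps delta : R) (v : 'cV[R]_d) : R :=
  ln (2 + lambda^-1 + gamma^-1 + eps^-1 + delta^-1 + d%:R + l2norm v).

End PCP.

(* Main.v *)
Require Import Defs.
From HB Require Import structures.
From mathcomp Require Import all_boot all_order all_algebra.
From mathcomp Require Import all_classical all_reals all_analysis.
From mathcomp Require Import zify ring lra.

Set Implicit Arguments.
Unset Strict Implicit.
Unset Printing Implicit Defensive.

Import Order.TTheory GRing.Theory Num.Theory.
Local Open Scope ring_scope.

(** Put [M = A^T A], [X = M - lambda], [mu = gamma lambda] and [F = |A|_F^2].
    The projection is [(1 + sgn X) / 2] outside the gap.  For [c_j = mu 2^(K-j)]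
    and [G_j = c_j^2 (X^2 + c_j^2)^-1] one has
    [(X^2 + c_(j+1)^2) / (X^2 + c_j^2) = 1 - 3/4 G_j], and the partial sum [S] of
    the binomial series of [(1 - u)^(-1/2)] satisfies
    [1 - u^(K+1) <= (1 - u) S(u)^2 <= 1].  The products telescope, so that
    [X c_0^-1 S(G_K) S(3/4 G_(K-1)) ... S(3/4 G_0)] has the sign of [X] and,
    where [|X| >= mu], absolute value close to 1.

    [G_c x] is read off the solution of the skew system [c p - X q = c x],
    [X p + c q = 0], whose condition number involves [c] and not [c^2].  It is
    solved by variance-reduced stochastic gradients, the rows being drawn in
    proportion to their squared norms from a table of [2^l] slots; an epoch
    takes [O(1 + F / c^2)] steps.  If [nnz c^2 < d F], the shift is enlarged to
    [rho c] and [G_c] is recovered by [O(rho)] steps of a heavy-ball iteration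
    preconditioned by [G_(rho c)].  The mean square errors are propagated to the
    output, where Markov's inequality applies. *)

(** * Programs and their trees of coin flips *)

(** An epoch at shift [c] makes two passes over [A] and [O(1 + F / c^2)] steps of length at most
    [d]; up to logarithms this is [O(nnz)] once [nnz c^2 >= d F], which fixes the threshold for
    [rho]. At the smallest shift [mu] a solve then costs about [rho nnz], that is
    [nnz + sqrt (nnz d F) / mu], the bound to be proved. In the skew system [A^T A] enters linearly,
    so single rows give unbiased samples; with [X^2] they would not. Halving the shift keeps the
    argument of the series below 3/4 in all rungs but the last, so that [K = O(log)] terms suffice.
    The obstacle is error growth: one term of a series may multiply the mean square error by 8, a
    rung by [8^K], and all rungs by [2^(O(K^2))]. Each epoch halves the error of a solve, hence [Q]
    is of order [K^2], and only logarithms are lost. Two more constraints shape the code. [nnz] may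
    be smaller than [d], so vectors are kept on the nonzero columns only. The hidden logarithm knows
    [d] but not [n], so the bits spent on drawing a row, about [log nnz] of them, have to be charged
    against [nnz] itself. *)

Section Spec.
Variable R : realType.
Implicit Types (s : state R) (c : cmd) (Q : state R -> Prop) (Psi : state R -> R).

(** A halting program with fair coins unfolds into a finite binary tree of outcomes, so expectations
    are nested averages and no probability space is needed before [spec_prob]. *)
Inductive tree := Leaf of state R | Node of tree & tree.

Fixpoint mean (tr : tree) Psi : R :=
  match tr with
  | Leaf s => Psi s
  | Node l r => (mean l Psi + mean r Psi) / 2
  end.

Fixpoint follow (tr : tree) (w : seq bool) : option (state R * seq bool) :=
  match tr, w with
  | Leaf s, _ => Some (s, w)
  | Node l r, b :: w' => follow (if b then r else l) w'
  | Node _ _, [::] => None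
  end.

Fixpoint depth (tr : tree) : nat :=
  match tr with Leaf _ => 0 | Node l r => (maxn (depth l) (depth r)).+1 end.

Fixpoint graft (tr : tree) (f : state R -> tree) : tree :=
  match tr with
  | Leaf s => f s
  | Node l r => Node (graft l f) (graft r f)
  end.

Fixpoint leaves (tr : tree) (P : state R -> Prop) : Prop :=
  match tr with Leaf s => P s | Node l r => leaves l P /\ leaves r P end.

Lemma follow_graft tr f w :
  follow (graft tr f) w = obind (fun sr => follow (f sr.1) sr.2) (follow tr w).
Proof. by elim: tr w => [s|l IHl r IHr] [|[] w] //=. Qed.

Lemma leavesP tr (P : state R -> Prop) :
  (forall w s r, follow tr w = Some (s, r) -> P s) -> leaves tr P.
Proof.
elim: tr => [s|l IHl r IHr] /= H; first exact: (H [::] s [::]).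
split; first by apply: IHl => w s rr E; apply: (H (false :: w) s rr).
by apply: IHr => w s rr E; apply: (H (true :: w) s rr).
Qed.

Lemma mean_le tr Psi1 Psi2 :
  leaves tr (fun s => Psi1 s <= Psi2 s) -> mean tr Psi1 <= mean tr Psi2.
Proof.
elim: tr => [s|l IHl r IHr] //= [Hl Hr].
by rewrite ler_pM2r ?invr_gt0 ?ltr0n// lerD ?IHl ?IHr.
Qed.

Lemma mean_graft_le tr f Psi1 Psi2 :
  leaves tr (fun s => mean (f s) Psi2 <= Psi1 s) ->
  mean (graft tr f) Psi2 <= mean tr Psi1.
Proof.
elim: tr => [s|l IHl r IHr] //= [Hl Hr].
by rewrite ler_pM2r ?invr_gt0 ?ltr0n// lerD ?IHl ?IHr.
Qed.

(** Every run takes time at most [tau] and ends in [Q]; the mean of [Psi] over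
    the final states is at most [phi]. *)
Definition spec c s (tau : nat) Q Psi (phi : R) : Prop :=
  exists tr, mean tr Psi <= phi /\
    forall w s' r, follow tr w = Some (s', r) ->
      Q s' /\ exists2 t, (t <= tau)%N & exec c s w s' r t.

(** The coin-free counterpart of [spec]: the tape is handed back untouched. Programs without
    sampling are specified this way. *)
Definition dspec c s (tau : nat) Q : Prop :=
  exists s' t, [/\ (t <= tau)%N, forall w, exec c s w s' w t & Q s'].

Lemma spec_det c s tau Q Psi phi :
  dspec c s tau (fun s' => Q s' /\ Psi s' <= phi) -> spec c s tau Q Psi phi.
Proof.
move=> [s' [t [tt E [Qs' Ps']]]]; exists (Leaf s'); split=> //.
by move=> w s'' r /= [<- <-]; split=> //; exists t.
Qed.

(** The law of total expectation: the bound for [c2] depends on the state in the middle, and as a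
    function of that state it is the potential that [c1] has to control. Error recurrences are
    chained backwards in this way. *)
Lemma spec_seq c1 c2 s tau1 tau2 Q1 Q2 Psi1 Psi2 phi :
  spec c1 s tau1 Q1 Psi1 phi ->
  (forall s1, Q1 s1 -> spec c2 s1 tau2 Q2 Psi2 (Psi1 s1)) ->
  spec (Defs.Seq c1 c2) s (tau1 + tau2) Q2 Psi2 phi.
Proof.
move=> [tr [mtr H]] H2.
(* The second tree depends on the state reached; states outside [Q1] get a dummy leaf. *)
have /choice[f Hf] : forall s1, exists tr2, Q1 s1 -> mean tr2 Psi2 <= Psi1 s1 /\
    forall w s' r, follow tr2 w = Some (s', r) ->
      Q2 s' /\ exists2 t, (t <= tau2)%N & exec c2 s1 w s' r t.
  move=> s1; have [Q1s|nQ1] := pselect (Q1 s1).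
    by have [tr2 ?] := H2 _ Q1s; exists tr2.
  by exists (Leaf s1).
exists (graft tr f); split.
  apply: le_trans mtr; apply: mean_graft_le; apply: leavesP => w s1 r /H[Q1s _].
  by case: (Hf _ Q1s).
move=> w s' r; rewrite follow_graft.
case E: (follow tr w) => [[s1 r1]|] //= E2.
have [Q1s [t1 tt1 ex1]] := H _ _ _ E.
have [_ /(_ _ _ _ E2)[Q2s [t2 tt2 ex2]]] := Hf _ Q1s.
by split=> //; exists (t1 + t2)%N; [exact: leq_add | exact: ExecSeq ex1 ex2].
Qed.

Lemma spec_weaken c s tau tau' Q Q' Psi Psi' phi phi' :
  spec c s tau Q Psi phi -> (tau <= tau')%N -> (forall s', Q s' -> Q' s') ->
  (forall s', Q s' -> Psi' s' <= Psi s') -> phi <= phi' ->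
  spec c s tau' Q' Psi' phi'.
Proof.
move=> [tr [mtr H]] le_tau QQ' PP le_phi; exists tr; split.
  apply: le_trans le_phi; apply: le_trans mtr; apply: mean_le.
  by apply: leavesP => w s' r /H[/PP].
move=> w s' r /H[Qs [t tt ex]]; split; first exact: QQ'.
by exists t => //; apply: leq_trans tt le_tau.
Qed.

(** Lets a one-step bound be used inside a loop, where the contraction of the later rounds appears
    as the factor [alpha] and the noise still to be added as [beta]. *)
Lemma spec_affine c s tau Q Psi phi alpha beta : 0 <= alpha ->
  spec c s tau Q Psi phi ->
  spec c s tau Q (fun s' => alpha * Psi s' + beta) (alpha * phi + beta).
Proof.
move=> al0 [tr [mtr H]]; exists tr; split=> //.
have -> : mean tr (fun s' => alpha * Psi s' + beta) = alpha * mean tr Psi + beta.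
  elim: tr {mtr H} => //= l -> r ->; by field.
by apply: lerD => //; apply: ler_wpM2l.
Qed.

Lemma dspec_weaken c s tau tau' Q Q' :
  dspec c s tau Q -> (tau <= tau')%N -> (forall s', Q s' -> Q' s') ->
  dspec c s tau' Q'.
Proof.
move=> [s' [t [tt E Qs']]] le_tau QQ'; exists s', t; split=> //.
  exact: leq_trans tt le_tau.
exact: QQ'.
Qed.

Lemma dspec_seq c1 c2 s tau1 tau2 Q1 Q2 :
  dspec c1 s tau1 Q1 -> (forall s1, Q1 s1 -> dspec c2 s1 tau2 Q2) ->
  dspec (Defs.Seq c1 c2) s (tau1 + tau2) Q2.
Proof.
move=> [s1 [t1 [tt1 E1 Q1s]]] /(_ _ Q1s)[s2 [t2 [tt2 E2 Q2s]]].
exists s2, (t1 + t2)%N; split=> //; first exact: leq_add.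
by move=> w; apply: ExecSeq (E1 w) (E2 w).
Qed.

Lemma spec_dseq c1 c2 s tau1 tau2 Q1 Q2 Psi phi :
  dspec c1 s tau1 Q1 ->
  (forall s1, Q1 s1 -> spec c2 s1 tau2 Q2 Psi phi) ->
  spec (Defs.Seq c1 c2) s (tau1 + tau2) Q2 Psi phi.
Proof.
move=> H1 H2; apply: (spec_seq (Q1 := Q1) (Psi1 := fun=> phi)) => //.
by apply: spec_det; apply: dspec_weaken H1 _ _.
Qed.

Lemma dspec_iset a i e s tau Q :
  (icost i + icost e < tau)%N ->
  Q (State (upd (imem s) a (ieval s i) (ieval s e)) (rmem s)) ->
  dspec (ISet a i e) s tau Q.
Proof.
move=> tt Qs; eexists _, _; split; [exact: tt| |exact: Qs].
by move=> w; apply: ExecISet.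
Qed.

Lemma dspec_rset a i e s tau Q :
  (icost i + rcost e < tau)%N ->
  Q (State (imem s) (upd (rmem s) a (ieval s i) (reval s e))) ->
  dspec (RSet a i e) s tau Q.
Proof.
move=> tt Qs; eexists _, _; split; [exact: tt| |exact: Qs].
by move=> w; apply: ExecRSet.
Qed.

Lemma dspec_skip s tau Q : (0 < tau)%N -> Q s -> dspec Skip s tau Q.
Proof.
move=> tt Qs; exists s, 1%N; split=> //.
by move=> w; apply: ExecSkip.
Qed.

Lemma dspec_if b c1 c2 s tau tau' Q :
  dspec (if beval s b then c1 else c2) s tau Q ->
  (bcost b + tau < tau')%N -> dspec (If b c1 c2) s tau' Q.
Proof.
move=> [s' [t [tt E Qs]]] ltt; exists s', (bcost b + t).+1; split=> //.
  by apply: leq_trans ltt; rewrite ltnS leq_add2l.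
by move=> w; apply: ExecIf (E w).
Qed.

(** Amortised cost: the potential pays for the test and the body of each round, so rounds may differ
    widely in cost. The pass over the rows, which fills a varying number of slots per row, gets its
    linear bound from this. *)
Lemma dspec_while b c s (Inv : state R -> Prop) (pot : state R -> nat) :
  (forall s1, Inv s1 -> beval s1 b -> exists tau,
     dspec c s1 tau (fun s2 => Inv s2 /\ (tau + bcost b + pot s2 < pot s1)%N)) ->
  Inv s ->
  dspec (While b c) s (pot s + (bcost b).+1) (fun s2 => Inv s2 /\ ~~ beval s2 b).
Proof.
move=> step; have [n] := ubnP (pot s); elim: n s => // n IH s pn Is.
have [bs|nbs] := boolP (beval s b); last first.
  exists s, (bcost b).+1; split=> //; first by rewrite leq_addl.
  by move=> w; apply: ExecWhileEnd.
have [tau [s2 [t2 [tt2 E2 [Is2 lt2]]]]] := step _ Is bs.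
have [|s3 [t3 [tt3 E3 Q3]]] := IH s2 _ Is2.
  by move: pn; rewrite ltnS => pn; apply: leq_trans pn; apply: leq_ltn_trans lt2; rewrite leq_addl.
exists s3, (bcost b + t2 + t3).+1; split=> //; last first.
  by move=> w; apply: ExecWhileStep (E2 w) (E3 w).
by move: lt2 tt2 tt3; rewrite -!/(is_true _); lia.
Qed.

(** Write sets are syntactic, so that for a concrete program and a concrete array the frame
    condition is settled by computation. *)
Fixpoint iwr c : seq nat :=
  match c with
  | Skip | RSet _ _ _ => [::]
  | ISet a _ _ | Flip a _ => [:: a]
  | Defs.Seq c1 c2 | If _ c1 c2 => iwr c1 ++ iwr c2
  | While _ c1 => iwr c1
  end.

Fixpoint rwr c : seq nat :=
  match c with
  | Skip | ISet _ _ _ | Flip _ _ => [::]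
  | RSet a _ _ => [:: a]
  | Defs.Seq c1 c2 | If _ c1 c2 => rwr c1 ++ rwr c2
  | While _ c1 => rwr c1
  end.

Definition frame c s s' : Prop :=
  (forall a, a \notin iwr c -> imem s' a = imem s a) /\
  (forall a, a \notin rwr c -> rmem s' a = rmem s a).

Lemma upd_ne (T : Type) (m : nat -> nat -> T) a b i x :
  b != a -> upd m a i x b = m b.
Proof. by move=> /negPf ba; apply/funext => j; rewrite /upd ba. Qed.

Lemma exec_frame c s w s' r t : exec c s w s' r t -> frame c s s'.
Proof.
rewrite /frame; elim=> {c s w s' r t} //=.
- move=> a i e s w; split=> // b; rewrite inE => nb.
  by rewrite upd_ne.
- move=> a i e s w; split=> // b; rewrite inE => nb.
  by rewrite upd_ne.
- move=> a i s b w; split=> // b'; rewrite inE => nb.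
  by rewrite upd_ne.
- move=> c1 c2 s1 w1 s2 w2 s3 w3 t1 t2 _ [I1 R1] _ [I2 R2].
  by split=> a; rewrite mem_cat negb_or => /andP[n1 n2];
    [rewrite I2 // I1|rewrite R2 // R1].
- move=> b c1 c2 s w s' w' t _ [].
  by case: beval => I1 R1; split=> a; rewrite mem_cat negb_or => /andP[n1 n2];
    [exact: I1|exact: R1|exact: I1|exact: R1].
- move=> b c s1 w1 s2 w2 s3 w3 t1 t2 _ _ [I1 R1] _ [I2 R2].
  by split=> a na; [rewrite I2 // I1|rewrite R2 // R1].
Qed.

Lemma spec_frame c s tau Q Psi phi :
  spec c s tau Q Psi phi -> spec c s tau (fun s' => Q s' /\ frame c s s') Psi phi.
Proof.
move=> [tr [mtr H]]; exists tr; split=> // w s' r /H[Qs [t tt ex]].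
by split; [split=> //; apply: exec_frame ex|exists t].
Qed.

Lemma dspec_frame c s tau Q :
  dspec c s tau Q -> dspec c s tau (fun s' => Q s' /\ frame c s s').
Proof.
move=> [s' [t [tt E Qs]]]; exists s', t; split=> //; split=> //.
exact: exec_frame (E [::]).
Qed.

Lemma spec_flip a i s tau Q (Psi : state R -> R) (phi : R) :
  let s' (b : nat) := State (upd (imem s) a (ieval s i) b) (rmem s) in
  (icost i < tau)%N -> Q (s' 0%N) -> Q (s' 1%N) ->
  (Psi (s' 0%N) + Psi (s' 1%N)) / 2 <= phi -> spec (Flip a i) s tau Q Psi phi.
Proof.
move=> s' tt Q0 Q1 le_phi; exists (Node (Leaf (s' 0%N)) (Leaf (s' 1%N))).
split=> // w s1 r; case: w => [|b w] //=.
by case: b => /= -[<- <-]; split=> //; exists (icost i).+1 => //;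
  [exact: (@ExecFlip _ a i s true w)|exact: (@ExecFlip _ a i s false w)].
Qed.

Definition iv a := IGet a (INum 0).
Definition rv a := RGet a (INum 0).

Definition For (i : nat) (lo hi : iexp) (c : cmd) : cmd :=
  Defs.Seq (ISet i (INum 0) lo)
    (While (BLti (iv i) hi)
       (Defs.Seq c (ISet i (INum 0) (IAdd (iv i) (INum 1))))).

Definition seti (i x : nat) s := State (upd (imem s) i 0 x) (rmem s).

Lemma imem_seti i x s : imem (seti i x s) i 0 = x.
Proof. by rewrite /= /upd !eqxx. Qed.

Lemma frame_seti i x s : frame (ISet i (INum 0) (INum 0)) s (seti i x s).
Proof. by split=> // a; rewrite inE => na /=; rewrite upd_ne. Qed.

(** The body is asked for the next invariant in the state where the counter has already been
    advanced, so callers never reason about the increment. *)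
Lemma dspec_for i lo hi c (m N tau tau' : nat) (Inv : nat -> state R -> Prop) s :
  i \notin iwr c -> ieval s lo = m -> (m <= N)%N ->
  (forall k s1, (k <= N)%N -> Inv k s1 -> imem s1 i 0 = k -> ieval s1 hi = N) ->
  Inv m (seti i m s) ->
  (forall k s1, (m <= k < N)%N -> Inv k s1 -> imem s1 i 0 = k ->
     dspec c s1 tau (fun s2 => Inv k.+1 (seti i k.+1 s2))) ->
  ((N - m) * (tau + icost hi + 10) + icost lo + icost hi + 6 <= tau')%N ->
  dspec (For i lo hi c) s tau' (fun s' => Inv N s' /\ imem s' i 0 = N).
Proof.
move=> ni Elo mN Ehi Inv0 step tt.
pose J s1 := exists2 k, (m <= k <= N)%N & Inv k s1 /\ imem s1 i 0 = k.
pose pot s1 := ((N - imem s1 i 0) * (tau + icost hi + 10))%N.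
have W s1 : J s1 -> dspec (While (BLti (iv i) hi)
       (Defs.Seq c (ISet i (INum 0) (IAdd (iv i) (INum 1))))) s1
       (pot s1 + (bcost (BLti (iv i) hi)).+1)
       (fun s2 => J s2 /\ ~~ beval s2 (BLti (iv i) hi)).
  apply: dspec_while => s2 [k /andP[mk kN] [Ik ik]] /=.
  rewrite (Ehi k) // ik => ltk; exists (tau + 6)%N.
  have mkN : (m <= k < N)%N by rewrite mk ltk.
  have := dspec_frame (step k s2 mkN Ik ik).
  move/dspec_seq; apply => s3 [I3 [fr _]]; apply: dspec_iset => //=.
  have E3 : imem s3 i 0 = k by rewrite fr.
  rewrite E3 addn1; split; first by exists k.+1; [lia|split=> //; exact: imem_seti].
  rewrite /pot /= /upd !eqxx /= ik; have -> : (N - k = (N - k.+1).+1)%N by lia.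
  by rewrite mulSn; lia.
rewrite /For; apply: (@dspec_weaken _ _
  (icost lo + 2 + ((N - m) * (tau + icost hi + 10) + (bcost (BLti (iv i) hi)).+1))
  _ (fun s2 => J s2 /\ ~~ beval s2 (BLti (iv i) hi))).
- apply: (@dspec_seq _ _ _ _ _ (fun s1 => J s1 /\ imem s1 i 0 = m)).
    apply: dspec_iset => /=; first by lia.
    by rewrite Elo -/(seti i m s); split; [exists m; [lia|split=> //; exact: imem_seti]|rewrite /upd !eqxx].
  by move=> s1 [J1 E1]; move: (W _ J1); rewrite /pot E1.
- by move: tt => /=; lia.
- move=> s' [[k /andP[mk kN] [Ik ik]]] /=; rewrite (Ehi k) // ik => nk.
  by have -> : N = k by lia.
Qed.

(** Induction on the number [j] of rounds left. The potential may depend on the round: callers take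
    the current error discounted by the contraction still to come, which does not grow in mean and
    ends as the plain error. *)
Lemma spec_while_count (i : nat) (hi : iexp) c (N tau m j : nat)
    (Inv : nat -> state R -> Prop) (Psi : nat -> state R -> R) s :
  i \notin iwr c ->
  (forall k s1, (k <= N)%N -> Inv k s1 -> imem s1 i 0 = k -> ieval s1 hi = N) ->
  (forall k s1, (m <= k < N)%N -> Inv k s1 -> imem s1 i 0 = k ->
     spec c s1 tau (fun s2 => Inv k.+1 (seti i k.+1 s2))
       (fun s2 => Psi k.+1 (seti i k.+1 s2)) (Psi k s1)) ->
  (m <= N - j)%N -> (j <= N)%N -> Inv (N - j)%N s -> imem s i 0 = (N - j)%N ->
  spec (While (BLti (iv i) hi)
         (Defs.Seq c (ISet i (INum 0) (IAdd (iv i) (INum 1))))) s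
    (j * (tau + icost hi + 10) + (icost hi + 4))
    (fun s' => Inv N s' /\ imem s' i 0 = N) (Psi N) (Psi (N - j)%N s).
Proof.
move=> ni Ehi step; elim: j s => [|j IH] s.
  rewrite subn0 => _ _ I0 E0; apply: spec_det.
  exists s, (bcost (BLti (iv i) hi)).+1; split=> //=; first by lia.
  move=> w; apply: ExecWhileEnd => /=.
  by rewrite (Ehi N) // E0 ltnn.
move=> mj jN I0 E0.
have ltk : (N - j.+1 < N)%N by lia.
have mk : (m <= N - j.+1 < N)%N by lia.
have [tr [mtr H]] := spec_frame (step _ _ mk I0 E0).
have Sj : (N - j.+1).+1 = (N - j)%N by lia.
have S1 : spec (Defs.Seq c (ISet i (INum 0) (IAdd (iv i) (INum 1)))) s (tau + 6)
   (fun s2 => Inv (N - j)%N s2 /\ imem s2 i 0 = (N - j)%N) (Psi (N - j)%N) (Psi (N - j.+1)%N s).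
  apply: (spec_seq (spec_frame (step _ _ mk I0 E0))) => s2 [I2 [fr _]].
  apply: spec_det; apply: dspec_iset => //=.
  rewrite fr // E0 addn1 -Sj -/(seti i (N - j.+1).+1 s2).
  by split=> //; split=> //; rewrite /upd !eqxx.
have mj' : (m <= N - j)%N by lia.
have [tr2 [mtr2 H2]] := spec_seq S1 (fun s2 I2 =>
  IH s2 mj' (ltnW jN) (proj1 I2) (proj2 I2)).
exists tr2; split=> // w s' r /H2[Q2 [t tt ex]]; split=> //.
(* The tree was built for one body followed by the loop; its execution is split again and refolded
   as one more round of the loop. *)
inversion ex as [| | | |? ? ? ? s5 w5 ? ? t5 t6 ex1 ex2| | |]; subst.
exists (bcost (BLti (iv i) hi) + t5 + t6).+1 => /=; first by lia.
apply: ExecWhileStep ex1 ex2 => /=.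
by rewrite (Ehi (N - j.+1)%N) // ?E0 //; exact: ltnW.
Qed.

Lemma spec_for i lo hi c (m N tau tau' : nat) (Inv : nat -> state R -> Prop)
    (Psi : nat -> state R -> R) phi s :
  i \notin iwr c -> ieval s lo = m -> (m <= N)%N ->
  (forall k s1, (k <= N)%N -> Inv k s1 -> imem s1 i 0 = k -> ieval s1 hi = N) ->
  Inv m (seti i m s) -> Psi m (seti i m s) <= phi ->
  (forall k s1, (m <= k < N)%N -> Inv k s1 -> imem s1 i 0 = k ->
     spec c s1 tau (fun s2 => Inv k.+1 (seti i k.+1 s2))
       (fun s2 => Psi k.+1 (seti i k.+1 s2)) (Psi k s1)) ->
  ((N - m) * (tau + icost hi + 10) + icost lo + icost hi + 6 <= tau')%N ->
  spec (For i lo hi c) s tau' (fun s' => Inv N s' /\ imem s' i 0 = N) (Psi N) phi.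
Proof.
move=> ni Elo mN Ehi Inv0 Psi0 step tt.
apply: (@spec_weaken _ _ (icost lo + 2 + ((N - m) * (tau + icost hi + 10) + (icost hi + 4)))
  _ (fun s' => Inv N s' /\ imem s' i 0 = N) _ (Psi N) _ phi) => //; last by lia.
apply: (@spec_seq _ _ _ _ _ (fun s1 => Inv m s1 /\ imem s1 i 0 = m) _ (Psi m)).
  apply: spec_det; apply: dspec_iset => /=; first by lia.
  by rewrite Elo -/(seti i m s); split=> //; split=> //; rewrite /upd !eqxx.
move=> s1 [I1 E1]; have := @spec_while_count i hi c N tau m (N - m) Inv Psi s1 ni Ehi step.
by rewrite subKn //; apply=> //; lia.
Qed.

End Spec.

(** * From trees of flips to tuples of fair bits, and Markov's inequality *)

Section Prob.
Variable R : realType.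
Implicit Types (s : state R) (Psi : state R -> R).

Lemma follow_some tr (w : seq bool) : (depth tr <= size w)%N ->
  exists sr : state R * seq bool, follow tr w = Some sr.
Proof.
elim: tr w => [s|l IHl r IHr] w /=; first by exists (s, w).
case: w => [|b w] //=; rewrite ltnS geq_max => /andP[dl dr].
by case: b; [exact: IHr|exact: IHl].
Qed.

Lemma sum_tuple_cons (V : nmodType) N (f : seq bool -> V) :
  \sum_(w : N.+1.-tuple bool) f w =
  \sum_(w : N.-tuple bool) f (true :: w) + \sum_(w : N.-tuple bool) f (false :: w).
Proof.
rewrite -(big_bool (@GRing.add V) (fun b => \sum_(w : N.-tuple bool) f (b :: w))).
rewrite pair_big /=.
rewrite (reindex (fun p : bool * N.-tuple bool => [tuple of p.1 :: p.2])) /=.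
  by apply: eq_bigr.
exists (fun w : N.+1.-tuple bool => (thead w, [tuple of behead w])).
  by move=> [b w] _; rewrite /= theadE; congr pair; apply: val_inj.
by move=> w _; rewrite [RHS]tuple_eta; apply: val_inj.
Qed.

(** A leaf at depth [k] is reached by [2^(N - k)] of the tapes of length [N], which is the weight
    [2^-k] that [mean] gives it. *)
Lemma mean_sum_tuple tr (g : seq bool -> state R) Psi N :
  (depth tr <= N)%N ->
  (forall w, size w = N -> exists r, follow tr w = Some (g w, r)) ->
  mean tr Psi * (2 ^ N)%:R = \sum_(w : N.-tuple bool) Psi (g w).
Proof.
elim: tr N g => [s|l IHl r IHr] N g /=.
  move=> _ H; rewrite (eq_bigr (fun=> Psi s)); last first.
    by move=> w _; have [r [<- _]] := H w (size_tuple w).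
  by rewrite sumr_const card_tuple card_bool mulr_natr.
case: N => [|N] //; rewrite ltnS geq_max => /andP[dl dr] H.
rewrite (@sum_tuple_cons _ _ (Psi \o g)) /= -(IHr N (g \o cons true)) //.
  rewrite -(IHl N (g \o cons false)) //.
    by rewrite expnS natrM; field.
  by move=> w sw; apply: (H (false :: w)); rewrite /= sw.
by move=> w sw; apply: (H (true :: w)); rewrite /= sw.
Qed.

(** [N] is the depth of the tree, so no run exhausts a tape of that length. *)
Lemma spec_prob p s tau (bad : pred (state R)) phi :
  spec p s tau (fun=> True) (fun s' => (bad s')%:R) phi ->
  exists (N : nat) (out : N.-tuple bool -> state R),
    (forall w : N.-tuple bool, exists (rest : seq bool) (t : nat),
       exec p s w (out w) rest t /\ (t <= tau)%N) /\
    1 - phi <= prob R [pred w : N.-tuple bool | ~~ bad (out w)].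
Proof.
move=> [tr [mtr H]]; pose N := depth tr.
pose g w := if follow tr w is Some sr then sr.1 else s.
have Hg w : size w = N -> exists r, follow tr w = Some (g w, r).
  move=> sw; have [|[s' r] E] := @follow_some tr w; first by rewrite sw.
  by exists r; rewrite /g E.
exists N, (fun w => g w); split.
  move=> w; have [r E] := Hg w (size_tuple w).
  by have [_ [t tt ex]] := H _ _ _ E; exists r, t.
have P2 : 0 < (2 ^ N)%:R :> R by rewrite ltr0n expn_gt0.
rewrite /prob ler_pdivlMr // mulrBl mul1r.
have /= S := mean_sum_tuple (fun s' => (bad s')%:R) (leqnn N) Hg.
have -> : #|[pred w : N.-tuple bool | ~~ bad (g w)]|%:R =
    (2 ^ N)%:R - \sum_(w : N.-tuple bool) (bad (g w))%:R :> R.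
  rewrite -sum1_card natr_sum big_mkcond /=.
  have -> : (2 ^ N)%:R = \sum_(w : N.-tuple bool) 1 :> R.
    by rewrite sumr_const card_tuple card_bool.
  rewrite -sumrB; apply: eq_bigr => w _; rewrite inE.
  by case: (bad (g w)); rewrite ?subrr ?subr0.
by rewrite lerB // -S ler_pM2r.
Qed.

Lemma mean_markov tr (f : state R -> R) (B phi : R) :
  leaves tr (fun s => 0 <= f s) -> 0 <= B -> 0 <= phi ->
  mean tr f <= phi * B -> mean tr (fun s => (B < f s)%R%:R) <= phi.
Proof.
move=> f0 B0 phi0 H; have [B_gt0|] := ltP 0 B.
  rewrite -(ler_pM2r B_gt0); apply: le_trans H.
  elim: tr f0 => [s|l IHl r IHr] /=.
    move=> fs; case: (ltP B (f s)) => [/ltW Bf|_] /=; first by rewrite mul1r.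
    by rewrite mul0r.
  by case=> /IHl l0 /IHr r0; lra.
(* The quotient of Markov's inequality is meaningless for [B = 0], the case of the zero input
   vector. There a nonnegative function of nonpositive mean vanishes at every leaf. *)
move=> Ble; have {B0 Ble} B0 : B = 0 by apply/eqP; rewrite eq_le Ble.
move: H; rewrite B0 mulr0 => H; apply: le_trans phi0.
elim: tr f0 H => [s|l IHl r IHr] /=.
  by move=> fs0 fs1; rewrite ltNge fs1.
case=> l0 r0 lr.
have m0 t : leaves t (fun s => 0 <= f s) -> 0 <= mean t f.
  elim: t => [//|t1 IH1 t2 IH2] /= [/IH1 ? /IH2 ?]; lra.
have := m0 _ l0; have := m0 _ r0 => r1 l1.
have := IHl l0; have := IHr r0; lra.
Qed.

Lemma spec_markov p s tau Q (f : state R -> R) (B phi : R) :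
  (forall s', Q s' -> 0 <= f s') -> 0 <= B -> 0 <= phi ->
  spec p s tau Q f (phi * B) -> spec p s tau Q (fun s' => (B < f s')%R%:R) phi.
Proof.
move=> f0 B0 phi0 [tr [mtr H]]; exists tr; split=> //.
by apply: (mean_markov _ B0 phi0 mtr); apply: leavesP => w s' r /H[/f0].
Qed.

End Prob.

(** * Vectors in memory *)

Section Loops.
Variable R : realType.
Implicit Types (s : state R).

Definition same_but (i dst : nat) s s1 : Prop :=
  (forall a, a != i -> imem s1 a = imem s a) /\
  (forall a, a != dst -> rmem s1 a = rmem s a).

(** The value is a function of the index [ixv k] alone, so repeated indices (several entries in one
    row) do no harm. The expression may read the target at cells not yet written, which is what
    permits updates in place. *)
Lemma dspec_setloop i lo hi dst ix ex s m N (ixv : nat -> nat) (g : nat -> R) tau :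
  ieval s lo = m -> (m <= N)%N ->
  (forall s1, same_but i dst s s1 -> ieval s1 hi = N) ->
  (forall k s1, (m <= k < N)%N -> imem s1 i 0 = k -> same_but i dst s s1 ->
     (forall j, (forall k', (m <= k' < k)%N -> ixv k' <> j) ->
        rmem s1 dst j = rmem s dst j) ->
     ieval s1 ix = ixv k /\ reval s1 ex = g (ixv k)) ->
  ((N - m) * (icost ix + rcost ex + icost hi + 11) + icost lo + icost hi + 6 <= tau)%N ->
  dspec (For i lo hi (RSet dst ix ex)) s tau (fun s' =>
    same_but i dst s s' /\
    forall j, rmem s' dst j =
      if has (fun k => ixv k == j) (index_iota m N) then g j else rmem s dst j).
Proof.
move=> Elo mN Ehi step tt.
pose Inv k s1 := same_but i dst s s1 /\
  forall j, rmem s1 dst j =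
      if has (fun k => ixv k == j) (index_iota m k) then g j else rmem s dst j.
apply: (@dspec_weaken _ _ _ tau _ (fun s' => Inv N s' /\ imem s' i 0 = N)) => //; last by move=> ? [].
apply: (@dspec_for _ _ _ _ _ m N (icost ix + rcost ex + 1)) => //.
- by move=> k s1 _ [sb _] _; apply: Ehi.
- split; last by move=> j; rewrite /index_iota subnn.
  by split=> a ai //=; rewrite upd_ne.
- move=> k s1 mkN [sb E] ik; have /andP[mk kN] := mkN.
  have [|Eix Eex] := step k s1 mkN ik sb.
    move=> j Hj; rewrite E; case: hasP => // -[k']; rewrite mem_index_iota => /Hj jk /eqP.
    by [].
  apply: dspec_rset; first by lia.
  case: sb => sb1 sb2.
  split; first split=> a ai /=; rewrite ?upd_ne //; [exact: sb1|exact: sb2|].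
  move=> j; rewrite /= /upd eqxx Eix Eex /= E.
  rewrite /index_iota subSn // -addn1 iotaD has_cat /= orbF subnKC // eq_sym.
  by case: eqP => [<-|nj]; rewrite ?orbT ?orbF.
- by move: tt; set X := (N - m)%N; lia.
Qed.

Lemma dspec_addloop i lo hi dst ix ex s m N (ixv : nat -> nat) (g : nat -> R) tau :
  ieval s lo = m -> (m <= N)%N ->
  (forall s1, same_but i dst s s1 -> ieval s1 hi = N) ->
  (forall k s1, (m <= k < N)%N -> imem s1 i 0 = k -> same_but i dst s s1 ->
     ieval s1 ix = ixv k /\ reval s1 ex = g k) ->
  ((N - m) * ((icost ix).*2 + rcost ex + icost hi + 13) + icost lo + icost hi + 6 <= tau)%N ->
  dspec (For i lo hi (RSet dst ix (RAdd (RGet dst ix) ex))) s tau (fun s' =>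
    same_but i dst s s' /\
    forall j, rmem s' dst j = rmem s dst j + \sum_(m <= k < N | ixv k == j) g k).
Proof.
move=> Elo mN Ehi step tt.
pose Inv k s1 := same_but i dst s s1 /\
  forall j, rmem s1 dst j = rmem s dst j + \sum_(m <= k' < k | ixv k' == j) g k'.
apply: (@dspec_weaken _ _ _ tau _ (fun s' => Inv N s' /\ imem s' i 0 = N)) => //; last by move=> ? [].
apply: (@dspec_for _ _ _ _ _ m N ((icost ix).*2 + rcost ex + 3)) => //.
- by move=> k s1 _ [sb _] _; apply: Ehi.
- split; last by move=> j; rewrite big_geq // addr0.
  by split=> a ai //=; rewrite upd_ne.
- move=> k s1 mkN [sb E] ik; have /andP[mk kN] := mkN.
  have [Eix Eex] := step k s1 mkN ik sb.
  apply: dspec_rset; first by rewrite /=; lia.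
  case: sb => sb1 sb2.
  split; first split=> a ai /=; rewrite ?upd_ne //; [exact: sb1|exact: sb2|].
  move=> j; rewrite /= /upd eqxx Eix Eex /= !E eq_sym.
  rewrite [in RHS]big_mkcond /= big_nat_recr //= -big_mkcond /=.
  by case: eqP => [<-|nj]; rewrite ?addr0 // addrA.
- by move: tt; rewrite -addnn; set X := (N - m)%N; lia.
Qed.

End Loops.

Section Vectors.
Variables (R : realType) (d : nat) (cl : seq nat).
Implicit Types (s : state R).

(** Vectors live on the columns listed in [cl]; other cells are ignored. *)
Definition mvec (m : nat -> R) : 'cV[R]_d :=
  \col_(j < d) (if (j : nat) \in cl then m j else 0).

Definition colvec s a := mvec (rmem s a).

Inductive vexp := VV of nat | VAdd of vexp & vexp | VSub of vexp & vexp
  | VMul of nat & vexp.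

Fixpoint vcomp (ii : nat) (e : vexp) : rexp :=
  match e with
  | VV a => RGet a (IGet 4 (iv ii))
  | VAdd e1 e2 => RAdd (vcomp ii e1) (vcomp ii e2)
  | VSub e1 e2 => RSub (vcomp ii e1) (vcomp ii e2)
  | VMul a e1 => RMul (rv a) (vcomp ii e1)
  end.

Fixpoint vscal (e : vexp) : seq nat :=
  match e with
  | VV a => [::]
  | VAdd e1 e2 | VSub e1 e2 => vscal e1 ++ vscal e2
  | VMul a e1 => a :: vscal e1
  end.

Fixpoint vpeval s (e : vexp) (j : nat) : R :=
  match e with
  | VV a => rmem s a j
  | VAdd e1 e2 => vpeval s e1 j + vpeval s e2 j
  | VSub e1 e2 => vpeval s e1 j - vpeval s e2 j
  | VMul a e1 => rmem s a 0 * vpeval s e1 j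
  end.

Fixpoint veval s (e : vexp) : 'cV[R]_d :=
  match e with
  | VV a => colvec s a
  | VAdd e1 e2 => veval s e1 + veval s e2
  | VSub e1 e2 => veval s e1 - veval s e2
  | VMul a e1 => rmem s a 0 *: veval s e1
  end.

Lemma vevalE s e : veval s e = mvec (vpeval s e).
Proof.
by elim: e => //= [e1 -> e2 ->|e1 -> e2 ->|a e1 ->]; apply/colP => j;
  rewrite !mxE; case: ifP => _; rewrite ?addr0 ?subr0 ?mulr0.
Qed.

(** The order of the list is left open. Its length is at most both [d] and [nnz A], and this length,
    not [d], is the price of a vector operation. *)
Definition cols_ok s : Prop :=
  let l := mkseq (imem s 4) (imem s 5 0) in uniq l /\ l =i cl.

Definition vset (ii dst : nat) (e : vexp) : cmd :=
  For ii (INum 0) (iv 5) (RSet dst (IGet 4 (iv ii)) (vcomp ii e)).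

Lemma dspec_vset ii dst e s tau :
  cols_ok s -> ii != 4%N -> ii != 5%N -> dst \notin vscal e ->
  (imem s 5 0 * (rcost (vcomp ii e) + 16) + 9 <= tau)%N ->
  dspec (vset ii dst e) s tau (fun s' =>
    [/\ same_but ii dst s s', colvec s' dst = veval s e &
        forall j, j \notin cl -> rmem s' dst j = rmem s dst j]).
Proof.
move=> [/= Ul El] n4 n5 ndst tt; pose N := imem s 5 0.
pose g := vpeval s e.
apply: (@dspec_weaken _ _ _ tau tau (fun s' => same_but ii dst s s' /\
    forall j, rmem s' dst j =
      if has (fun k => imem s 4 k == j) (index_iota 0 N) then g j else rmem s dst j)) => //.
  apply: dspec_setloop => //.
  - by move=> s1 [sb1 _] /=; rewrite sb1 // eq_sym.
  - move=> k s1 kN ik [sb1 sb2] Hd /=; rewrite ik sb1 1?eq_sym //; split=> //.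
    (* Each column is listed once, so the cell about to be written still holds its old value and
       [dst] may occur as a vector in [e]. *)
    have Hj : rmem s1 dst (imem s 4 k) = rmem s dst (imem s 4 k).
      apply: Hd => k' /andP[_ k'k] E.
      have := Ul; move/(mkseq_uniqP _ _) => /(_ k' k); rewrite !inE => H.
      have kltN : (k < N)%N by case/andP: kN.
      by have EE := H (ltn_trans k'k kltN) kltN E; rewrite EE ltnn in k'k.
    rewrite /g; elim: (e) ndst => //= [a _|e1 IH1 e2 IH2|e1 IH1 e2 IH2|a e1 IH1].
    + rewrite ik sb1 1?eq_sym //; have [->//|na] := eqVneq a dst.
      by rewrite sb2.
    + by rewrite mem_cat negb_or => /andP[/IH1 -> /IH2 ->].
    + by rewrite mem_cat negb_or => /andP[/IH1 -> /IH2 ->].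
    + by rewrite inE negb_or => /andP[na /IH1 ->]; rewrite sb2 1?eq_sym.
  - by move: tt; rewrite -/N subn0 /=; lia.
have hasE j : has (fun k : nat => imem s 4 k == j) (index_iota 0 N) = (j \in cl).
  rewrite -El; apply/hasP/mapP => -[k]; rewrite ?mem_index_iota => kN.
    by move=> /eqP <-; exists k => //; rewrite mem_iota.
  by move=> ->; exists k => //; rewrite mem_index_iota; move: kN; rewrite mem_iota.
move=> s' [sb E]; split=> //; last by move=> j /negPf jcl; rewrite E hasE jcl.
by rewrite vevalE; apply/colP => j; rewrite !mxE E hasE; case: (_ \in _).
Qed.

End Vectors.

(** Memory map.  Integer arrays: 3 marks of the columns met, 4 list of the
    nonzero columns and 5 their number, 6 and 7 ends of the entries of a slot,
    8 [l], 9 [2^l], 14 [K], 15 [Q] (epochs per solve), 16 heavy-ball steps,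
    17 steps per epoch, 23 sampled slot, 26 [L].  Real arrays: 5 [F], 6 weight
    of a slot, 9 and 10 iterate of the skew system, 11 and 12 inner iterate,
    13 and 14 gradient at the anchor, 17 right-hand side, 18 and 19 heavy-ball
    iterates, 20 vector the rungs act on, 21 partial sum of the series, 22 [c],
    23 [rho c], 24 step size, 25 momentum, 26 [rho^-2], 27 factor 3/4 or 1,
    28 series coefficient, 31 [c_0], 32 [rho].  The others are scratch. *)

(** [matvec i src dst]: [dst := A^T A src], through the row products in real
    array 8. *)
Definition matvec (i src dst : nat) : cmd :=
  let k := iv i in
  let N := IGet 0 (INum 2) in
  Defs.Seq (For i (INum 0) N (RSet 8 (IGet 1 k) (RNat (INum 0))))
  (Defs.Seq (For i (INum 0) N (RSet 8 (IGet 1 k) (RAdd (RGet 8 (IGet 1 k))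
      (RMul (RGet 0 k) (RGet src (IGet 2 k))))))
  (Defs.Seq (For i (INum 0) N (RSet dst (IGet 2 k) (RNat (INum 0))))
   (For i (INum 0) N (RSet dst (IGet 2 k) (RAdd (RGet dst (IGet 2 k))
      (RMul (RGet 0 k) (RGet 8 (IGet 1 k)))))))).

(** * Products with the stored sparse matrix *)

Section Problem.
Variables (R : realType) (n d : nat) (A : 'M[R]_(n, d)).
Implicit Types (s : state R).

Definition rown : nat -> nat := nth 0%N [seq nat_of_ord ij.1 | ij <- nonzeros A].
Definition colseq : seq nat := [seq nat_of_ord ij.2 | ij <- nonzeros A].
Definition coln : nat -> nat := nth 0%N colseq.
Definition valr : nat -> R := nth 0 [seq A ij.1 ij.2 | ij <- nonzeros A].

Lemma sum_entries (f : nat -> nat -> R) :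
  \sum_(0 <= k < nnz A) valr k * f (rown k) (coln k) =
  \sum_i \sum_j A i j * f i j.
Proof.
rewrite pair_big /= (bigID (fun p : 'I_n * 'I_d => A p.1 p.2 != 0)) /=.
rewrite [X in _ = _ + X]big1 ?addr0; last first.
  by move=> p; rewrite negbK => /eqP ->; rewrite mul0r.
have -> : \sum_(p | A p.1 p.2 != 0) A p.1 p.2 * f p.1 p.2 =
    \sum_(p <- nonzeros A) A p.1 p.2 * f p.1 p.2.
  by rewrite /nonzeros big_enum.
case E : (nonzeros A) => [|p0 l]; first by rewrite /nnz E !big_nil.
rewrite -E (big_nth p0); apply: eq_big_nat => k /andP[_ kN].
by rewrite /valr /rown /coln /colseq !(nth_map p0).
Qed.

Lemma coln_colseq k : (k < nnz A)%N -> coln k \in colseq.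
Proof. by move=> kN; apply: mem_nth; rewrite size_map. Qed.

Lemma colseqP j :
  reflect (exists2 k, (k < nnz A)%N & coln k = j) (j \in colseq).
Proof.
apply: (iffP idP) => [/(nthP 0%N)[k]|[k kN <-]]; last exact: coln_colseq.
by rewrite size_map => kN <-; exists k.
Qed.

Lemma coln_lt k : (k < nnz A)%N -> (coln k < d)%N.
Proof. by move/coln_colseq => /mapP[p _ ->]. Qed.

Definition data_ok s : Prop :=
  [/\ imem s 0 2 = nnz A, imem s 0 1 = d, imem s 1 = rown, imem s 2 = coln &
      rmem s 0 = valr].

Lemma big_nat_natr (P : nat -> bool) (F : nat -> R) m N :
  \sum_(m <= k < N | P k) F k = \sum_(m <= k < N) F k * (P k)%:R.
Proof. by rewrite big_mkcond; apply: eq_bigr => k _; case: P; rewrite ?mulr1 ?mulr0. Qed.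

Lemma entries_row (x : nat -> R) (i : 'I_n) :
  \sum_(0 <= k < nnz A | rown k == i) valr k * x (coln k) = \sum_j A i j * x j.
Proof.
rewrite big_nat_natr.
under eq_bigr => k _ do rewrite -mulrA.
rewrite (sum_entries (fun r c => x c * (r == i :> nat)%:R)) /=.
rewrite (bigD1 i) //= [X in _ + X]big1 ?addr0.
  by apply: eq_bigr => j _; rewrite eqxx mulr1.
by move=> i' ne; apply: big1 => j _; rewrite (_ : (i' == i :> nat) = false) ?mulr0 //; exact/negbTE.
Qed.

Lemma entries_col (y : nat -> R) (j : 'I_d) :
  \sum_(0 <= k < nnz A | coln k == j) valr k * y (rown k) = \sum_i A i j * y i.
Proof.
rewrite big_nat_natr.
under eq_bigr => k _ do rewrite -mulrA.
rewrite (sum_entries (fun r c => y r * (c == j :> nat)%:R)) /=.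
rewrite exchange_big (bigD1 j) //= [X in _ + X]big1 ?addr0.
  by apply: eq_bigr => i _; rewrite eqxx mulr1.
by move=> j' ne; apply: big1 => i _; rewrite (_ : (j' == j :> nat) = false) ?mulr0 //; exact/negbTE.
Qed.

Lemma zero_col (j : 'I_d) : (j : nat) \notin colseq -> forall i, A i j = 0.
Proof.
move=> jc i; apply/eqP; apply: contraNT jc => nz.
by apply/mapP; exists (i, j) => //; rewrite mem_enum.
Qed.

(** Columns outside [colseq A] are zero, so masking a vector is invisible to [A]; this is what makes
    it safe to ignore the other cells. *)
Lemma mul_mvec (m : nat -> R) (i : 'I_n) :
  (A *m mvec d colseq m) i 0 = \sum_j A i j * m j.
Proof.
rewrite mxE; apply: eq_bigr => j _; rewrite mxE.
by case: ifPn => // /zero_col ->; rewrite !mul0r.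
Qed.

(** Only rows and columns that carry an entry are cleared and filled, which keeps the cost
    proportional to [nnz A]. The result vanishes off the listed columns because [A^T] has zero rows
    there. *)
Lemma dspec_matvec i src dst s tau :
  data_ok s -> (2 < i)%N -> src != 8%N -> dst != 8%N -> src != dst -> dst != 0%N ->
  (200 * nnz A + 100 <= tau)%N ->
  dspec (matvec i src dst) s tau (fun s' =>
    colvec d colseq s' dst = A^T *m A *m colvec d colseq s src).
Proof.
move=> [E0 _ E1 E2 Er] i2 src8 dst8 sd d0 tt.
have i0 : (0 == i)%N = false by lia.
have i1 : (1 == i)%N = false by lia.
have i2' : (2 == i)%N = false by lia.
apply: (@dspec_weaken _ _ _
  ((nnz A * 50 + 25) + ((nnz A * 50 + 25) + ((nnz A * 50 + 25) + (nnz A * 50 + 25)))) _ _ _ _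
  _ (fun s' h => h)); last by lia.
apply: (dspec_seq (Q1 := fun s1 => same_but i 8 s s1 /\
   forall k, (k < nnz A)%N -> rmem s1 8 (rown k) = 0)).
  apply: (dspec_weaken (dspec_setloop (m := 0) (N := nnz A) (ixv := rown) (g := fun=> 0) _ _ _ _ _)
    (leqnn _)) => //=.
  - by move=> s1 [sb _]; rewrite sb ?i0.
  - by move=> k s1 _ ik [sb _] _; rewrite ik sb ?i1 // E1.
  - by rewrite ?subn0; lia.
  - move=> s1 [sb E]; split=> // k kN; rewrite E ifT //.
    by apply/hasP; exists k => //; rewrite mem_index_iota.
move=> s1 [[sb1 sb1'] Z1].
apply: (dspec_seq (Q1 := fun s2 => same_but i 8 s s2 /\
   forall k, (k < nnz A)%N -> rmem s2 8 (rown k) =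
     \sum_(0 <= k' < nnz A | rown k' == rown k) valr k' * rmem s src (coln k'))).
  apply: (dspec_weaken (dspec_addloop (m := 0) (N := nnz A) (ixv := rown)
    (g := fun k => valr k * rmem s src (coln k)) _ _ _ _ _) (leqnn _)) => //=.
  - by move=> s2 [sb _]; rewrite sb ?i0 // sb1 ?i0.
  - move=> k s2 _ ik [sb sb']; rewrite ik sb ?i1 // sb1 ?i1 // E1; split=> //.
    by rewrite !sb' // !sb1' // Er sb ?i2' // sb1 ?i2' // E2.
  - by rewrite ?subn0; lia.
  - move=> s2 [[sb2 sb2'] E]; split.
      by split=> a na; [rewrite sb2 ?sb1|rewrite sb2' ?sb1'].
    by move=> k kN; rewrite E Z1 // add0r.
move=> s2 [[sb2 sb2'] Z2].
apply: (dspec_seq (Q1 := fun s3 => same_but i dst s2 s3 /\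
   forall k, (k < nnz A)%N -> rmem s3 dst (coln k) = 0)).
  apply: (dspec_weaken (dspec_setloop (m := 0) (N := nnz A) (ixv := coln) (g := fun=> 0) _ _ _ _ _)
    (leqnn _)) => //=.
  - by move=> s3 [sb _]; rewrite sb ?i0 // sb2 ?i0.
  - by move=> k s3 _ ik [sb _] _; rewrite ik sb ?i2' // sb2 ?i2' // E2.
  - by rewrite ?subn0; lia.
  - move=> s3 [sb E]; split=> // k kN; rewrite E ifT //.
    by apply/hasP; exists k => //; rewrite mem_index_iota.
move=> s3 [[sb3 sb3'] Z3].
apply: (dspec_weaken (dspec_addloop (m := 0) (N := nnz A) (ixv := coln)
    (g := fun k => valr k * rmem s2 8 (rown k)) _ _ _ _ _) (leqnn _)) => //=.
- by move=> s4 [sb _]; rewrite sb ?i0 // sb3 ?i0 // sb2 ?i0.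
- move=> k s4 _ ik [sb sb']; rewrite ik sb ?i2' // sb3 ?i2' // sb2 ?i2' // E2; split=> //.
  rewrite sb' 1?eq_sym // sb3' 1?eq_sym // sb2' // Er sb' 1?eq_sym // sb3' 1?eq_sym //.
  by rewrite sb ?i1 // sb3 ?i1 // sb2 ?i1 // E1.
- by rewrite ?subn0; lia.
- move=> s4 [_ E]; apply/colP => j.
  rewrite [LHS]mxE E -mulmxA [RHS]mxE.
  under [RHS]eq_bigr => i' _ do rewrite [A^T _ _]mxE mul_mvec.
  case: ifPn => [jc|/zero_col jc]; last by rewrite big1 // => i' _; rewrite jc mul0r.
  have -> : rmem s3 dst j = 0 by have /colseqP[k kN <-] := jc; rewrite Z3.
  rewrite add0r; pose y r := \sum_(0 <= k' < nnz A | rown k' == r) valr k' * rmem s src (coln k').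
  rewrite big_nat_cond (eq_bigr (fun k => valr k * y (rown k))); last first.
    by move=> k /andP[/andP[_ kN] _]; rewrite Z2.
  rewrite -big_nat_cond entries_col; apply: eq_bigr => i' _.
  by rewrite /y entries_row.
Qed.

End Problem.

(** * Eigencoordinates and one stochastic step *)

Section Euclid.
Variables (R : realType) (d : nat).
Implicit Types x y z : 'cV[R]_d.

Definition dot x y : R := \sum_i x i 0 * y i 0.
Definition sqn x : R := dot x x.

Lemma dotC x y : dot x y = dot y x.
Proof. by apply: eq_bigr => i _; rewrite mulrC. Qed.
Lemma dotDl x y z : dot (x + y) z = dot x z + dot y z.
Proof. by rewrite -big_split; apply: eq_bigr => i _; rewrite mxE mulrDl. Qed.
Lemma dotDr x y z : dot z (x + y) = dot z x + dot z y.
Proof. by rewrite dotC dotDl !(dotC z). Qed.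
Lemma dotZl a x y : dot (a *: x) y = a * dot x y.
Proof. by rewrite mulr_sumr; apply: eq_bigr => i _; rewrite mxE mulrA. Qed.
Lemma dotZr a x y : dot x (a *: y) = a * dot x y.
Proof. by rewrite dotC dotZl dotC. Qed.
Lemma dotNl x y : dot (- x) y = - dot x y.
Proof. by rewrite -scaleN1r dotZl mulN1r. Qed.
Lemma dotNr x y : dot x (- y) = - dot x y.
Proof. by rewrite dotC dotNl dotC. Qed.
Lemma dot0l y : dot 0 y = 0.
Proof. by rewrite -(scale0r (0 : 'cV_d)) dotZl mul0r. Qed.
Lemma dot0r y : dot y 0 = 0. Proof. by rewrite dotC dot0l. Qed.
Lemma dot_sumr (I : Type) (r : seq I) (P : pred I) (f : I -> 'cV[R]_d) x :
  dot x (\sum_(i <- r | P i) f i) = \sum_(i <- r | P i) dot x (f i).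
Proof.
elim/big_ind2: _ => [|u u' v v' <- <-|//]; first by rewrite dot0r.
by rewrite dotDr.
Qed.
Lemma sqn_ge0 x : 0 <= sqn x.
Proof. by apply: sumr_ge0 => i _; rewrite -expr2 sqr_ge0. Qed.
Lemma sqn_eq0 x : sqn x <= 0 -> x = 0.
Proof.
move=> x0; apply/colP => i; rewrite mxE; apply/eqP; rewrite -sqrf_eq0.
rewrite eq_le sqr_ge0 andbT; apply: le_trans x0.
rewrite /sqn /dot (bigD1 i) //= -expr2 lerDl.
by apply: sumr_ge0 => j _; rewrite -expr2 sqr_ge0.
Qed.
Lemma sqn0 : sqn 0 = 0. Proof. exact: dot0l. Qed.
Lemma sqnZ a x : sqn (a *: x) = a ^+ 2 * sqn x.
Proof. by rewrite /sqn dotZl dotZr mulrA expr2. Qed.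
Lemma sqnN x : sqn (- x) = sqn x.
Proof. by rewrite /sqn dotNl dotNr opprK. Qed.
Lemma sqnD x y : sqn (x + y) = sqn x + 2 * dot x y + sqn y.
Proof. by rewrite /sqn dotDl !dotDr (dotC y x); ring. Qed.
Lemma sqnD_le x y : sqn (x + y) <= 2 * sqn x + 2 * sqn y.
Proof.
have := sqn_ge0 (x - y); rewrite !sqnD sqnN dotNr; lra.
Qed.
Lemma dot_mx x y : dot x y = (x^T *m y) 0 0.
Proof. by rewrite mxE; apply: eq_bigr => i _; rewrite mxE. Qed.

Lemma mx_dot x y : x^T *m y = (dot x y)%:M.
Proof. by apply/matrixP => i j; rewrite !ord1 !mxE eqxx dot_mx mxE mulr1n. Qed.

Lemma mul_rank1 x y z : (x *m y^T) *m z = dot y z *: x.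
Proof. by rewrite -mulmxA mx_dot mul_mx_scalar. Qed.

End Euclid.

Section Eigen.
Variables (R : realType) (n d : nat) (A : 'M[R]_(n, d.+1)).
Variables (lam : 'I_d.+1 -> R) (nu : 'I_d.+1 -> 'cV[R]_d.+1).
Hypothesis eig : eigen_decomposition A lam nu.
Hypothesis lam_le1 : lam ord0 <= 1.
Hypothesis lam_half : 2^-1 <= lam ord0.
Implicit Types x y : 'cV[R]_d.+1.

Let M := A^T *m A.
Definition frob : R := \sum_i \sum_j A i j ^+ 2.

Lemma lam01 i : 0 <= lam i <= 1.
Proof.
have [_ _ mono ->] := eig; rewrite /=; apply: le_trans lam_le1.
exact: mono.
Qed.

Lemma trM : M^T = M.
Proof. by rewrite /M trmx_mul trmxK. Qed.

Lemma dotM x y : dot (M *m x) y = dot x (M *m y).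
Proof. by rewrite !dot_mx trmx_mul trM mulmxA. Qed.

Definition co i x : R := dot (nu i) x.

Lemma coD i x y : co i (x + y) = co i x + co i y. Proof. exact: dotDr. Qed.
Lemma coN i x : co i (- x) = - co i x. Proof. exact: dotNr. Qed.
Lemma coB i x y : co i (x - y) = co i x - co i y.
Proof. by rewrite coD coN. Qed.
Lemma coZ i a x : co i (a *: x) = a * co i x. Proof. exact: dotZr. Qed.
Lemma co0 i : co i 0 = 0. Proof. exact: dot0r. Qed.
Lemma coM i x : co i (M *m x) = lam i * co i x.
Proof. by have [E _ _ _] := eig; rewrite /co -dotM /M E dotZl. Qed.

Lemma co_nu i j : co i (nu j) = (i == j)%:R.
Proof.
have [_ on _ _] := eig; have /matrixP/(_ 0 0) := on i j.
by rewrite mx_dot !mxE eqxx !mulr1n.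
Qed.

(** As many orthonormal vectors as the dimension form a square matrix with [N^T N = 1], and then
    [N N^T = 1] as well. *)
Lemma nu_complete x : x = \sum_i co i x *: nu i.
Proof.
pose N : 'M[R]_d.+1 := \matrix_(i, j) nu j i 0.
have NN : N^T *m N = 1%:M.
  apply/matrixP => i j; rewrite !mxE -(co_nu i j) /co /dot.
  by apply: eq_bigr => k _; rewrite !mxE.
have NN' : N *m N^T = 1%:M by apply: mulmx1C.
rewrite -[LHS]mul1mx -NN' -mulmxA; apply/colP => k; rewrite !mxE summxE.
apply: eq_bigr => i _; rewrite !mxE mulrC; congr (_ * _).
by rewrite /co /dot; apply: eq_bigr => l _; rewrite !mxE.
Qed.

Lemma sqn_co x : sqn x = \sum_i co i x ^+ 2.
Proof.
rewrite {1}/sqn {2}(nu_complete x) dot_sumr.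
by apply: eq_bigr => i _; rewrite dotZr dotC expr2.
Qed.

Lemma co_inj x y : (forall i, co i x = co i y) -> x = y.
Proof.
by move=> E; rewrite (nu_complete x) (nu_complete y); apply: eq_bigr => i _; rewrite E.
Qed.

(** With [f i = h (lam i) * co i x] this is the functional calculus [h(A^T A) x]. Every exact target
    below is given in this form, and vector identities are checked one coordinate at a time through
    [co_inj]. *)
Definition ofco (f : 'I_d.+1 -> R) : 'cV[R]_d.+1 := \sum_i f i *: nu i.

Lemma co_ofco i f : co i (ofco f) = f i.
Proof.
rewrite /ofco /co dot_sumr (bigD1 i) //= dotZr -/(co i (nu i)) co_nu eqxx mulr1.
rewrite big1 ?addr0 // => j ne.
by rewrite dotZr -/(co i (nu j)) co_nu eq_sym (negPf ne) mulr0.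
Qed.

(** Both sides are the trace of [A^T A], once in the standard basis and once in the eigenbasis. *)
Lemma frob_lam : frob = \sum_i lam i.
Proof.
have -> : frob = \tr M.
  rewrite /frob exchange_big; apply: eq_bigr => j _.
  by rewrite mxE; apply: eq_bigr => i _; rewrite mxE expr2.
have -> : \tr M = \sum_j dot (delta_mx j 0) (M *m delta_mx j 0).
  apply: eq_bigr => j _; rewrite -[M *m _]colE /dot (bigD1 j) //= big1 ?addr0.
    by rewrite !mxE !eqxx mul1r.
  by move=> k ne; rewrite !mxE (negPf ne) mul0r.
pose c i j := co i (delta_mx j 0 : 'cV[R]_d.+1).
have E j : dot (delta_mx j 0) (M *m delta_mx j 0) = \sum_i lam i * c i j ^+ 2.
  rewrite {1}(nu_complete (delta_mx j 0)) dotC dot_sumr; apply: eq_bigr => i _.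
  by rewrite dotZr dotC -/(co i _) coM /c; ring.
under eq_bigr => j _ do rewrite E.
rewrite exchange_big; apply: eq_bigr => i _ /=; rewrite -mulr_sumr.
suff -> : \sum_j c i j ^+ 2 = co i (nu i) by rewrite co_nu eqxx mulr1.
apply: eq_bigr => j _.
have -> : c i j = nu i j 0.
  rewrite /c /co /dot (bigD1 j) //= big1 ?addr0 ?mxE ?eqxx ?mulr1 //.
  by move=> k ne; rewrite mxE (negPf ne) mulr0.
by rewrite expr2.
Qed.

Lemma frob_half : 2^-1 <= frob.
Proof.
rewrite frob_lam (bigD1 ord0) //=; apply: le_trans lam_half _; rewrite lerDl.
by apply: sumr_ge0 => i _; have /andP[] := lam01 i.
Qed.

Lemma frob_le : frob <= d.+1%:R.
Proof.
rewrite frob_lam -[X in _ <= X%:R]card_ord -sum1_card natr_sum.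
by apply: ler_sum => i _; have /andP[] := lam01 i.
Qed.

Lemma dotM_le x : dot x (M *m x) <= sqn x.
Proof.
rewrite {1}(nu_complete x) dotC dot_sumr sqn_co; apply: ler_sum => i _.
rewrite dotZr dotC -/(co i _) coM; have /andP[l0 l1] := lam01 i.
by rewrite mulrCA -expr2 ler_piMl // sqr_ge0.
Qed.

(** On the eigenvector [i] the step multiplies the complex number [u + i v] by
    [(1 - eta c) - i eta (lam - l)], whose squared modulus is [(1 - eta c)^2 + eta^2 (lam - l)^2],
    and [|lam - l| <= 1]. *)
Lemma skew_contract l c eta x y : 0 < l < 1 ->
  sqn (x - eta *: (c *: x - (M *m y - l *: y))) +
  sqn (y - eta *: (c *: y + (M *m x - l *: x))) <=
  ((1 - eta * c) ^+ 2 + eta ^+ 2) * (sqn x + sqn y).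
Proof.
case/andP=> l0 l1; rewrite !sqn_co -!big_split /= mulr_sumr; apply: ler_sum => i _.
rewrite !(coN, coZ, coD) !coM.
have /andP[x0 x1] := lam01 i; move: (co i x) (co i y) => u v.
have -> : (u - eta * (c * u - (lam i * v - l * v))) ^+ 2 +
  (v - eta * (c * v + (lam i * u - l * u))) ^+ 2 =
  ((1 - eta * c) ^+ 2 + eta ^+ 2 * (lam i - l) ^+ 2) * (u ^+ 2 + v ^+ 2) by ring.
rewrite ler_wpM2r ?addr_ge0 ?sqr_ge0 // lerD2l ler_piMr ?sqr_ge0 //; nra.
Qed.

End Eigen.

(** A table of [S] weighted vectors whose rank-one matrices average to
    [A^T A] and have bounded second moment. *)
Section Sampling.
Variables (R : realType) (n d : nat) (A : 'M[R]_(n, d.+1)).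
Variables (lam : 'I_d.+1 -> R) (nu : 'I_d.+1 -> 'cV[R]_d.+1).
Hypothesis eig : eigen_decomposition A lam nu.
Hypothesis lam_le1 : lam ord0 <= 1.
Hypothesis lam_half : 2^-1 <= lam ord0.
Let M := A^T *m A.
Variables (S : nat) (w : nat -> R) (a : nat -> 'cV[R]_d.+1).
Hypothesis S0 : (0 < S)%N.
Hypothesis w0 : forall i, (i < S)%N -> 0 <= w i.
Hypothesis wa : forall i, (i < S)%N -> w i * sqn (a i) <= 2 * frob A.
Hypothesis sum_wa : \sum_(0 <= i < S) w i *: (a i *m (a i)^T) = S%:R *: M.

Definition smp i (y : 'cV[R]_d.+1) : 'cV[R]_d.+1 := (w i * dot (a i) y) *: a i.

Lemma sum_smp y : \sum_(0 <= i < S) smp i y = S%:R *: (M *m y).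
Proof.
rewrite scalemxAl -sum_wa mulmx_suml; apply: eq_bigr => i _.
by rewrite /smp -scalemxAl mul_rank1 scalerA.
Qed.

(** The samples average to [M y], so the cross term with [b] cancels and the variance is at most the
    second moment. The latter averages [(w |a|^2) (w <a, y>^2)], where the first factor is at most
    [2 F] and the second averages to [<y, M y> <= |y|^2]. *)
Lemma smp_var (b y : 'cV[R]_d.+1) (e : R) :
  \sum_(0 <= i < S) sqn (b + e *: (smp i y - M *m y)) <=
  S%:R * (sqn b + 2 * frob A * e ^+ 2 * sqn y).
Proof.
have S_sum (c : R) : \sum_(0 <= i < S) c = S%:R * c.
  by rewrite sumr_const_nat subn0 mulr_natl.
have -> : \sum_(0 <= i < S) sqn (b + e *: (smp i y - M *m y)) =
    S%:R * sqn b - S%:R * (e ^+ 2 * sqn (M *m y)) + e ^+ 2 * \sum_(0 <= i < S) sqn (smp i y).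
  (* The part free of the sample is hidden behind an opaque constant, so that the sum over the slots
     treats it as one term. *)
  have [C0 EC0] : exists C0, C0 =
      sqn b + 2 * e * (- dot b (M *m y)) + e ^+ 2 * sqn (M *m y) by eexists.
  have E i : sqn (b + e *: (smp i y - M *m y)) = C0 +
     ((2 * e) * dot b (smp i y) + (- (2 * e ^+ 2)) * dot (M *m y) (smp i y)) + e ^+ 2 * sqn (smp i y).
    rewrite sqnD sqnZ sqnD sqnN dotZr dotDr !dotNr (dotC (smp i y) (M *m y)) EC0; ring.
  under eq_bigr => i _ do rewrite E.
  rewrite !big_split /= S_sum -!mulr_sumr -!dot_sumr sum_smp !dotZr -/(sqn (M *m y)) EC0.
  ring.
have : \sum_(0 <= i < S) sqn (smp i y) <= S%:R * (2 * frob A * sqn y).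
  apply: (@le_trans _ _ (\sum_(0 <= i < S) 2 * frob A * dot y (smp i y))).
    rewrite big_nat_cond [leRHS]big_nat_cond; apply: ler_sum => i /andP[/andP[_ iS] _].
    rewrite /smp sqnZ dotZr (dotC y).
    have -> : (w i * dot (a i) y) ^+ 2 * sqn (a i) =
      (w i * sqn (a i)) * (w i * dot (a i) y ^+ 2) by ring.
    have -> : w i * dot (a i) y * dot (a i) y = w i * dot (a i) y ^+ 2 by ring.
    by rewrite ler_wpM2r ?wa // mulr_ge0 ?w0 // sqr_ge0.
  rewrite -mulr_sumr -dot_sumr sum_smp dotZr mulrCA ler_wpM2l ?ler0n //.
  rewrite ler_wpM2l //; last exact: (dotM_le eig).
  by have := frob_half eig lam_le1 lam_half; lra.
have S1 : 0 <= S%:R :> R by rewrite ler0n.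
have e2 := sqr_ge0 e.
move/(ler_wpM2l e2); have := mulr_ge0 S1 (mulr_ge0 e2 (sqn_ge0 (M *m y))).
set T := \sum_(0 <= i < S) _; move=> H1 H2.
have -> : S%:R * (sqn b + 2 * frob A * e ^+ 2 * sqn y) =
  S%:R * sqn b + e ^+ 2 * (S%:R * (2 * frob A * sqn y)) by ring.
lra.
Qed.

(** One step of the stochastic iteration for the skew system
    [[c, -X], [X, c]] with [X = A^T A - l]. *)
Section Step.
Variables (l c : R) (hp hq sp sq : 'cV[R]_d.+1).
Hypothesis l01 : 0 < l < 1.
Hypothesis c0 : 0 < c.
Let eta := c / (16 * (frob A + c ^+ 2)).
(** Here [(hp, hq)] is the increment from the anchor and [(sp, sq)] the increment that would reach
    the solution, so [gp] and [gq] are the residual of the system at the anchor. Samples multiply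
    the increment only: this is the variance reduction. *)
Let gp := - (c *: sp - (M *m sq - l *: sq)).
Let gq := - (c *: sq + (M *m sp - l *: sp)).

Definition stepp i := hp - eta *: (c *: hp + l *: hq + gp) + eta *: smp i hq.
Definition stepq i := hq - eta *: (c *: hq - l *: hp + gq) - eta *: smp i hp.

(** Since [eta (F + c^2) = c / 16], all second-order terms are small multiples of [eta c]: with
    [F >= 1/2] they add up to at most [6/16 eta c], which leaves [3/2] of the first-order [2 eta c].
    The additive term comes from [|h|^2 <= 2 |h - s|^2 + 2 |s|^2] in the variance; being
    proportional to the squared distance between anchor and solution, it shrinks from epoch to
    epoch. *)
Lemma step_contract :
  \sum_(0 <= i < S) (sqn (stepp i - sp) + sqn (stepq i - sq)) <=
  S%:R * ((1 - 3/2 * (eta * c)) * (sqn (hp - sp) + sqn (hq - sq)) +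
    1/4 * (eta * c) * (sqn sp + sqn sq)).
Proof.
set ep := hp - sp; set eq := hq - sq.
pose bp := ep - eta *: (c *: ep - (M *m eq - l *: eq)).
pose bq := eq - eta *: (c *: eq + (M *m ep - l *: ep)).
have Ep i : stepp i - sp = bp + eta *: (smp i hq - M *m hq).
  rewrite /stepp /bp /gp /ep /eq; move: (smp i hq) => u.
  rewrite !mulmxBr; apply/colP => j; rewrite !mxE; ring.
have Eq i : stepq i - sq = bq + (- eta) *: (smp i hp - M *m hp).
  rewrite /stepq /bq /gq /ep /eq; move: (smp i hp) => u.
  rewrite !mulmxBr; apply/colP => j; rewrite !mxE; ring.
rewrite big_split /=; under eq_bigr => i _ do rewrite Ep.
under [X in _ + X]eq_bigr => i _ do rewrite Eq.
have F2 := frob_half eig lam_le1 lam_half.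
have Vp := smp_var bp hq eta; have Vq := smp_var bq hp (- eta).
have Fc : 0 < 16 * (frob A + c ^+ 2) by have := sqr_ge0 c; lra.
have eta0 : 0 < eta by rewrite divr_gt0.
have etaF : eta * (frob A + c ^+ 2) = c / 16.
  by rewrite /eta; field; rewrite gt_eqF //; lra.
have bpq : sqn bp + sqn bq <= ((1 - eta * c) ^+ 2 + eta ^+ 2) * (sqn ep + sqn eq).
  exact: (skew_contract eig lam_le1).
have hb : sqn hp + sqn hq <= 2 * (sqn ep + sqn eq) + 2 * (sqn sp + sqn sq).
  have := sqnD_le ep sp; have := sqnD_le eq sq; rewrite !subrK; lra.
apply: (@le_trans _ _ (S%:R * (((1 - eta * c) ^+ 2 + eta ^+ 2) * (sqn ep + sqn eq) +
   2 * frob A * eta ^+ 2 * (2 * (sqn ep + sqn eq) + 2 * (sqn sp + sqn sq))))).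
  apply: le_trans (lerD Vp Vq) _; rewrite -mulrDr ler_wpM2l ?ler0n // sqrrN.
  have : 2 * frob A * eta ^+ 2 * (sqn hp + sqn hq) <=
     2 * frob A * eta ^+ 2 * (2 * (sqn ep + sqn eq) + 2 * (sqn sp + sqn sq)).
    by rewrite ler_wpM2l // mulr_ge0 ?sqr_ge0 //; lra.
  by move: bpq; set Z := 2 * frob A * eta ^+ 2; lra.
rewrite ler_wpM2l ?ler0n //.
set E := sqn ep + sqn eq; set N := sqn sp + sqn sq.
have E0 : 0 <= E by rewrite addr_ge0 ?sqn_ge0.
have N0 : 0 <= N by rewrite addr_ge0 ?sqn_ge0.
have e1 : eta ^+ 2 * frob A <= eta * c / 16.
  have := mulr_ge0 (ltW eta0) (mulr_ge0 (ltW eta0) (sqr_ge0 c)).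
  have : eta * (eta * (frob A + c ^+ 2)) = eta * (c / 16) by rewrite etaF.
  lra.
have e2 : eta ^+ 2 * (c ^+ 2 + frob A * 6) <= 6 * (eta * c / 16).
  have := mulr_ge0 (ltW eta0) (mulr_ge0 (ltW eta0) (sqr_ge0 c)).
  have : eta * (eta * (frob A + c ^+ 2)) = eta * (c / 16) by rewrite etaF.
  lra.
have e3 : eta ^+ 2 <= 2 * (eta ^+ 2 * frob A).
  by have := sqr_ge0 eta => e20; have := ler_wpM2l e20 F2; lra.
have : ((1 - eta * c) ^+ 2 + eta ^+ 2 + 4 * (frob A * eta ^+ 2)) * E <=
   (1 - 3 / 2 * (eta * c)) * E.
  rewrite ler_wpM2r //.
  have ec : 0 < eta * c by rewrite mulr_gt0.
  have -> : (1 - eta * c) ^+ 2 = 1 - 2 * (eta * c) + eta ^+ 2 * c ^+ 2 by ring.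
  lra.
have : 4 * (eta ^+ 2 * frob A) * N <= 4 * (eta * c / 16) * N.
  by rewrite ler_wpM2r // ler_pM2l.
lra.
Qed.

End Step.
End Sampling.

(** * Variance-reduced solution of the skew system *)

Notation "c1 ;; c2" := (Defs.Seq c1 c2) (at level 80, right associativity).

Definition sample : cmd :=
  ISet 23 (INum 0) (INum 0) ;;
  For 25 (INum 0) (iv 8)
    (Flip 24 (INum 0) ;; ISet 23 (INum 0) (IAdd (IAdd (iv 23) (iv 23)) (iv 24))).

Section Sample.
Variable R : realType.
Implicit Types (s : state R).

Lemma sum_pow2S (G : nat -> R) m : \sum_(0 <= i < 2 ^ m.+1) G i =
  \sum_(0 <= i < 2 ^ m) G i + \sum_(0 <= i < 2 ^ m) G (i + 2 ^ m)%N.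
Proof.
rewrite expnS mul2n -addnn (@big_cat_nat _ _ _ (2 ^ m)) ?leq_addr //=; congr (_ + _).
by rewrite -{1}[(2 ^ m)%N]add0n big_addn addnK.
Qed.

(** After [k] flips the potential is the average of [g] over the block of [2^(l - k)] indices that
    share the leading bits drawn so far; one flip halves the block. A table size that is a power of
    two makes the draw exactly uniform in a fixed time, without rejection. *)
Lemma spec_sample s l (g : nat -> R) Psi tau :
  imem s 8 0 = l ->
  (forall s', (imem s' 23 0 < 2 ^ l)%N -> frame sample s s' ->
     Psi s' <= g (imem s' 23 0%N)) ->
  (30 * l + 30 <= tau)%N ->
  spec sample s tau (fun s' => (imem s' 23 0 < 2 ^ l)%N) Psi
    ((\sum_(0 <= i < 2 ^ l) g i) / (2 ^ l)%:R).
Proof.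
move=> E8 HPsi tt.
pose Inv k s1 := imem s1 8 = imem s 8 /\ (imem s1 23 0 < 2 ^ k)%N.
pose P k s1 : R := (\sum_(0 <= i < 2 ^ (l - k))
   g (imem s1 23 0 * 2 ^ (l - k) + i)%N) / (2 ^ (l - k))%:R.
have H : spec sample s tau (fun s' => Inv l s' /\ imem s' 25 0 = l) (P l)
    ((\sum_(0 <= i < 2 ^ l) g i) / (2 ^ l)%:R).
  apply: (@spec_weaken _ _ _ (4 + (30 * l + 20)) tau (fun s' => Inv l s' /\ imem s' 25 0 = l) _
     (P l) (P l) _ _ _ _ _ _ (lexx _)) => //; last by lia.
  apply: (spec_seq (Q1 := fun s1 => Inv 0%N s1 /\ imem s1 23 0 = 0%N) (Psi1 := P 0%N)).
    apply: spec_det; apply: dspec_iset => //=.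
    by rewrite /Inv /P /upd /= subn0; split.
  move=> s1 [I0 z0]; apply: (@spec_for _ _ _ _ _ 0%N l 16) => //.
  - by move=> k s2 _ [E _] _; rewrite /= E.
  - move=> k s2 /andP[_ kl] [E8' lt] ik.
    pose s3 b := State (upd (imem s2) 24 0 b) (rmem s2).
    apply: (@spec_weaken _ _ _ (4 + 12) _ (fun s' => Inv k.+1 (seti 25 k.+1 s')) _
       (fun s' => P k.+1 (seti 25 k.+1 s')) _ _ _ _ _ _ _ (lexx _)) => //.
    apply: (spec_seq (Q1 := fun s' => exists2 b, (b < 2)%N & s' = s3 b)
      (Psi1 := fun s' => P k.+1 (seti 25 k.+1 (State (upd (imem s') 23 0
          (imem s' 23 0 + imem s' 23 0 + imem s' 24 0)%N) (rmem s'))))).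
      apply: spec_flip => //=; first by exists 0%N.
        by exists 1%N.
      rewrite /P /seti /= /upd !eqxx /=.
      have -> : (l - k = (l - k.+1).+1)%N by lia.
      set m := (l - k.+1)%N; set x := imem s2 23 0.
      rewrite sum_pow2S expnS mul2n -addnn natrD.
      rewrite (eq_bigr (fun i => g (x * (2 ^ m + 2 ^ m) + i)%N)); last first.
        by move=> i _; congr g; lia.
      rewrite [X in (_ + X) / 2](_ : _ = (\sum_(0 <= i < 2 ^ m)
         g (x * (2 ^ m + 2 ^ m) + (i + 2 ^ m))%N) / (2 ^ m)%:R); last first.
        by congr (_ / _); apply: eq_bigr => i _; congr g; lia.
      have : (2 ^ m)%:R != 0 :> R by rewrite pnatr_eq0 -lt0n expn_gt0.
      move: (\sum_(0 <= i < _) _) (\sum_(0 <= i < _) _) => X Y m0.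
      move: (2 ^ m)%:R m0 => z zn0.
      suff -> : (Y + X) / (z + z) = (Y / z + X / z) / 2 by [].
      have -> : z + z = 2 * z by ring.
      by field.
    move=> s' [b b2 ->]; apply: spec_det; apply: dspec_iset => //=.
    split; last by [].
    rewrite /Inv /seti /upd /=; split=> //.
    by rewrite /upd /= expnS; lia.
  - by rewrite subn0 /=; lia.
have := spec_frame H; move/spec_weaken; apply=> //.
  by move=> s' [[[_ ?] _] _].
move=> s' [[[_ lt] _] fr]; apply: le_trans (HPsi _ lt fr) _.
by rewrite /P subnn expn0 big_nat1 muln1 addn0 divr1.
Qed.

End Sample.

Definition row_loop (c : cmd) : cmd :=
  For 11 (IGet 6 (iv 23)) (IGet 7 (iv 23)) c.

Definition dot_loop (acc v : nat) : cmd :=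
  row_loop (RSet acc (INum 0) (RAdd (RGet acc (INum 0))
    (RMul (RGet 0 (iv 11)) (RGet v (IGet 2 (iv 11)))))).

Definition axpy_loop (dst k : nat) : cmd :=
  row_loop (RSet dst (IGet 2 (iv 11)) (RAdd (RGet dst (IGet 2 (iv 11)))
    (RMul (rv k) (RGet 0 (iv 11))))).

Definition rset0 a e := RSet a (INum 0) e.

(** Both inner products are taken before the iterate moves, and the new first half waits in array 34
    because the second half still needs the old one. The sampled row enters last, crosswise: the
    product with array 12 updates array 11 and conversely. *)
Definition step_det : cmd :=
  rset0 29 (RNat (INum 0)) ;;
  rset0 30 (RNat (INum 0)) ;;
  dot_loop 29 11 ;;
  dot_loop 30 12 ;;
  rset0 29 (RSub (RNat (INum 0)) (RMul (RMul (rv 24) (RGet 6 (iv 23))) (rv 29))) ;;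
  rset0 30 (RMul (RMul (rv 24) (RGet 6 (iv 23))) (rv 30)) ;;
  vset 11 34 (VSub (VV 11) (VMul 24 (VAdd (VAdd (VMul 23 (VV 11)) (VMul 2 (VV 12))) (VV 13)))) ;;
  vset 11 12 (VSub (VV 12) (VMul 24 (VAdd (VSub (VMul 23 (VV 12)) (VMul 2 (VV 11))) (VV 14)))) ;;
  vset 11 11 (VV 34) ;;
  axpy_loop 11 30 ;;
  axpy_loop 12 29.

Definition svrg_step : cmd := sample ;; step_det.

Section Keep.
Variable R : realType.
Implicit Types (s : state R).

Definition keep (I D : seq nat) s s' : Prop :=
  (forall a, a \notin I -> imem s' a = imem s a) /\
  (forall a, a \notin D -> rmem s' a = rmem s a).

Lemma keep_same I D i dst s s1 s2 :
  same_but i dst s1 s2 -> keep I D s s1 -> keep (i :: I) (dst :: D) s s2.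
Proof.
by move=> [bI bD] [kI kD]; split=> a; rewrite inE negb_or => /andP[na nb];
  [rewrite bI ?kI|rewrite bD ?kD].
Qed.

Lemma keep_upd I D s s1 a i x :
  keep I D s s1 -> keep I (a :: D) s (State (imem s1) (upd (rmem s1) a i x)).
Proof.
move=> [kI kD]; split=> b //=; first exact: kI.
by rewrite inE negb_or => /andP[na nb]; rewrite upd_ne // kD.
Qed.

Lemma keep_refl s : keep [::] [::] s s.
Proof. by []. Qed.

End Keep.

(** * The data that the solver relies on, and one stochastic step in memory *)

Section Env.
Variables (R : realType) (n d : nat) (A : 'M[R]_(n, d.+1)).
Implicit Types (s : state R).

Notation cl := (colseq A).
Notation vec := (colvec d.+1 cl).
Let M := A^T *m A.

Definition segv (a b : nat) : 'cV[R]_d.+1 :=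
  \col_j \sum_(a <= k < b | coln A k == j) valr A k.

Definition slotv s i := segv (imem s 6 i) (imem s 7 i).

(** The last three clauses are what the section on sampling assumes of its table; the bound on the
    segment length makes a step as cheap as a vector operation. *)
Definition slots_ok s : Prop :=
  [/\ imem s 9 0 = (2 ^ imem s 8 0)%N,
      forall i, (i < imem s 9 0)%N ->
        (imem s 6 i <= imem s 7 i <= nnz A)%N /\
        (imem s 7 i - imem s 6 i <= imem s 5 0)%N,
      forall i, (i < imem s 9 0)%N -> 0 <= rmem s 6 i,
      forall i, (i < imem s 9 0)%N -> rmem s 6 i * sqn (slotv s i) <= 2 * frob A &
      \sum_(0 <= i < imem s 9 0) rmem s 6 i *: (slotv s i *m (slotv s i)^T) =
        (imem s 9 0)%:R *: M].

Variable l : R.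

(** Collects what the solver reads and never writes. The arrays involved are listed in [envI] and
    [envR], so that preservation follows from write sets. *)
Definition env s : Prop :=
  [/\ data_ok A s, cols_ok cl s, slots_ok s, rmem s 5 0 = frob A & rmem s 2 0 = l].

Definition envI : seq nat := [:: 0; 1; 2; 4; 5; 6; 7; 8; 9].
Definition envR : seq nat := [:: 0; 2; 5; 6].

Lemma env_same s s' :
  (forall a, a \in envI -> imem s' a = imem s a) ->
  (forall a, a \in envR -> rmem s' a = rmem s a) -> env s -> env s'.
Proof.
move=> HI HR; have I a : a \in envI -> imem s' a = imem s a by exact: HI.
rewrite /env /data_ok /cols_ok /slots_ok /slotv.
by rewrite !(HI 0%N, HI 1%N, HI 2%N, HI 4%N, HI 5%N, HI 6%N, HI 7%N, HI 8%N, HI 9%N) //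
  !(HR 0%N, HR 2%N, HR 5%N, HR 6%N).
Qed.

Lemma env_frame c s s' : frame c s s' ->
  ~~ has (mem (iwr c)) envI -> ~~ has (mem (rwr c)) envR -> env s -> env s'.
Proof.
move=> [fI fR] /hasPn HI /hasPn HR; apply: env_same => a.
  by move=> /HI /fI.
by move=> /HR /fR.
Qed.

Lemma segv_dot a b x : (b <= nnz A)%N ->
  \sum_(a <= k < b) valr A k * x (coln A k) = dot (segv a b) (mvec d.+1 cl x).
Proof.
move=> bN; rewrite /dot.
under [RHS]eq_bigr => j _ do rewrite mxE big_nat_natr mulr_suml.
rewrite exchange_big /= big_nat_cond [RHS]big_nat_cond; apply: eq_bigr => k.
rewrite andbT => /andP[_ kb]; have kN := leq_trans kb bN.
have jlt := coln_lt kN; rewrite (bigD1 (Ordinal jlt)) //= eqxx mulr1 mxE /=.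
rewrite coln_colseq // [X in _ + X]big1 ?addr0 // => j ne.
rewrite (_ : (coln A k == j) = false) ?mulr0 ?mul0r //.
by apply: contra_neqF ne => /eqP E; apply: val_inj; rewrite /= E.
Qed.

Definition row_ok s := exists i, [/\ imem s 23 0 = i, (imem s 6 i <= imem s 7 i <= nnz A)%N &
   (imem s 7 i - imem s 6 i <= imem s 5 0)%N].

Lemma dspec_dot_loop acc v s tau :
  data_ok A s -> row_ok s -> acc != 0%N -> v != acc ->
  (30 * imem s 5 0 + 20 <= tau)%N ->
  dspec (dot_loop acc v) s tau (fun s' => same_but 11 acc s s' /\
    rmem s' acc 0 = rmem s acc 0 + dot (slotv s (imem s 23 0)) (vec s v)).
Proof.
move=> [E0 _ E1 E2 Er] [i [Ei /andP[ab bN] lenc]] a0 va tt; rewrite Ei.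
apply: (dspec_weaken (dspec_addloop (m := imem s 6 i) (N := imem s 7 i) (ixv := fun=> 0%N)
    (g := fun k => valr A k * rmem s v (coln A k)) _ _ _ _ _) (leqnn _)) => //=.
- by rewrite Ei.
- by move=> s1 [sb _]; rewrite !sb // Ei.
- by move=> k s1 _ ik [sb sb']; rewrite ik (sb' 0%N) 1?eq_sym // (sb' v) // Er !sb // E2.
- by lia.
- by move=> s' [sb E]; split=> //; rewrite E eqxx -segv_dot.
Qed.

Lemma dspec_axpy_loop dst k s tau :
  data_ok A s -> row_ok s -> dst != 0%N -> k != dst ->
  (30 * imem s 5 0 + 20 <= tau)%N ->
  dspec (axpy_loop dst k) s tau (fun s' => same_but 11 dst s s' /\
    vec s' dst = vec s dst + rmem s k 0 *: slotv s (imem s 23 0)).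
Proof.
move=> [E0 _ E1 E2 Er] [i [Ei /andP[ab bN] lenc]] a0 va tt; rewrite Ei.
apply: (dspec_weaken (dspec_addloop (m := imem s 6 i) (N := imem s 7 i) (ixv := coln A)
    (g := fun j => rmem s k 0 * valr A j) _ _ _ _ _) (leqnn _)) => //=.
- by rewrite Ei.
- by move=> s1 [sb _]; rewrite !sb // Ei.
- by move=> j s1 _ ik [sb sb']; rewrite ik (sb' 0%N) 1?eq_sym // (sb' k) // Er !sb // E2.
- by lia.
- move=> s' [sb E]; split=> //; apply/colP => j; rewrite !mxE E.
  case: ifPn => [jc|jc].
    by congr (_ + _); rewrite mulr_sumr.
  rewrite [X in _ = _ + _ * X]big_nat_cond big1 ?mulr0 ?addr0 // => q /andP[/andP[_ qb] /eqP qj].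
  by move: jc; rewrite -qj coln_colseq // (leq_trans qb).
Qed.

Definition smps s := smp (rmem s 6) (slotv s).

Lemma dspec_step_det s tau :
  env s -> (imem s 23 0 < imem s 9 0)%N -> (300 * imem s 5 0 + 300 <= tau)%N ->
  let hp := vec s 11 in let hq := vec s 12 in let eta := rmem s 24 0 in
  let c := rmem s 23 0 in let i := imem s 23 0 in
  dspec step_det s tau (fun s' =>
    vec s' 11 = hp - eta *: (c *: hp + l *: hq + vec s 13) + eta *: smps s i hq /\
    vec s' 12 = hq - eta *: (c *: hq - l *: hp + vec s 14) - eta *: smps s i hp).
Proof.
move=> [dok cok [S1 S2 S3 S4 S5] EF El] lti tt hp hq eta c i.
have [si1 si2] := S2 _ lti.
have rok : row_ok s by exists i.
set N := imem s 5 0 in tt.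
have dk I D s1 : keep I D s s1 -> ~~ has (mem I) [:: 0; 1; 2; 4; 5; 6; 7; 23]%N ->
    ~~ has (mem D) [:: 0; 6]%N ->
    [/\ data_ok A s1, cols_ok cl s1, row_ok s1, imem s1 5 0 = N /\ imem s1 23 0 = i &
      slotv s1 i = slotv s i /\ rmem s1 6 = rmem s 6].
  move=> [KI KD] /hasPn HI /hasPn HD.
  have KI' a : a \in [:: 0; 1; 2; 4; 5; 6; 7; 23]%N -> imem s1 a = imem s a by move/HI/KI.
  have KD' a : a \in [:: 0; 6]%N -> rmem s1 a = rmem s a by move/HD/KD.
  rewrite /data_ok /cols_ok /row_ok /slotv.
  by rewrite !(KI' 0%N, KI' 1%N, KI' 2%N, KI' 4%N, KI' 5%N, KI' 6%N, KI' 7%N, KI' 23%N) //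
    !(KD' 0%N, KD' 6%N).
apply: (@dspec_weaken _ _ _ (5 + (5 + ((30 * N + 20) + ((30 * N + 20) + (30 + (30 +
  ((60 * N + 20) + ((60 * N + 20) + ((60 * N + 20) + ((30 * N + 20) + (30 * N + 20)))))))))))
  _ _ _ _ _ (fun s' h => h)); last by lia.
apply: (dspec_seq (Q1 := fun s1 => keep [::] [:: 29%N] s s1 /\ rmem s1 29 0 = 0)).
  by apply: dspec_rset => //=; split=> //; exact: (keep_upd _ _ _ (keep_refl s)).
move=> s1 [K1 Z1].
apply: (dspec_seq (Q1 := fun s2 => keep [::] [:: 30; 29]%N s s2 /\
    (rmem s2 29 0 = 0 /\ rmem s2 30 0 = 0))).
  by apply: dspec_rset => //=; split=> //; exact: (keep_upd _ _ _ K1).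
move=> s2 {s1 K1 Z1} [K2 [Z1 Z2]].
pose a := slotv s i.
apply: (dspec_seq (Q1 := fun s3 => keep [:: 11]%N [:: 29; 30; 29]%N s s3 /\
    (rmem s3 29 0 = dot a hp /\ rmem s3 30 0 = 0))).
  have [dok2 _ rok2 [N2 i2] [a2 _]] := dk _ _ _ K2 isT isT.
  apply: (dspec_weaken (dspec_dot_loop dok2 rok2 _ _ (leqnn _))) => //; first by rewrite N2.
  move=> s3 [sb ->]; split; first exact: (keep_same sb K2).
  by rewrite Z1 add0r i2 a2 /colvec (K2.2 11%N isT) (sb.2 30%N isT).
move=> s3 {s2 K2 Z1 Z2} [K3 [Z1 Z2]].
apply: (dspec_seq (Q1 := fun s4 => keep [:: 11; 11]%N [:: 30; 29; 30; 29]%N s s4 /\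
    (rmem s4 29 0 = dot a hp /\ rmem s4 30 0 = dot a hq))).
  have [dok3 _ rok3 [N3 i3] [a3 _]] := dk _ _ _ K3 isT isT.
  apply: (dspec_weaken (dspec_dot_loop dok3 rok3 _ _ (leqnn _))) => //; first by rewrite N3.
  move=> s4 [sb ->]; split; first exact: (keep_same sb K3).
  by rewrite Z2 add0r i3 a3 /colvec (K3.2 12%N isT) (sb.2 29%N isT).
move=> s4 {s3 K3 Z1 Z2} [K4 [Z1 Z2]].
pose w := rmem s 6 i.
apply: (dspec_seq (Q1 := fun s5 => keep [:: 11; 11]%N [:: 29; 30; 29; 30; 29]%N s s5 /\
    (rmem s5 29 0 = - (eta * w * dot a hp) /\ rmem s5 30 0 = dot a hq))).
  have [_ _ _ [_ i4] [_ w4]] := dk _ _ _ K4 isT isT.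
  apply: dspec_rset => //=; split; first exact: (keep_upd _ _ _ K4).
  by rewrite /upd /= Z1 Z2 i4 w4 sub0r (K4.2 24%N isT).
move=> s5 {s4 K4 Z1 Z2} [K5 [Z1 Z2]].
apply: (dspec_seq (Q1 := fun s6 => keep [:: 11; 11]%N [:: 30; 29; 30; 29; 30; 29]%N s s6 /\
    (rmem s6 29 0 = - (eta * w * dot a hp) /\ rmem s6 30 0 = eta * w * dot a hq))).
  have [_ _ _ [_ i5] [_ w5]] := dk _ _ _ K5 isT isT.
  apply: dspec_rset => //=; split; first exact: (keep_upd _ _ _ K5).
  by rewrite /upd /= Z1 Z2 i5 w5 (K5.2 24%N isT).
move=> s6 {s5 K5 Z1 Z2} [K6 [Z1 Z2]].
apply: (dspec_seq (Q1 := fun s7 => keep [:: 11; 11; 11]%N [:: 34; 30; 29; 30; 29; 30; 29]%N s s7 /\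
    [/\ rmem s7 29 0 = - (eta * w * dot a hp), rmem s7 30 0 = eta * w * dot a hq &
     vec s7 34 = hp - eta *: (c *: hp + l *: hq + vec s 13)])).
  have [_ cok6 _ [N6 _] [_ _]] := dk _ _ _ K6 isT isT.
  apply: (dspec_weaken (dspec_vset d.+1 cok6 _ _ _ _) (leqnn _)) => //=.
    by rewrite N6; lia.
  move=> s7 [sb E _]; split; first exact: (keep_same sb K6).
  rewrite E /colvec !(sb.2) // Z1 Z2 !(K6.2) //.
  by rewrite El.
move=> s7 {s6 K6 Z1 Z2} [K7 [Z1 Z2 Z3]].
apply: (dspec_seq (Q1 := fun s8 => keep [:: 11; 11; 11; 11]%N [:: 12; 34; 30; 29; 30; 29; 30; 29]%N s s8 /\
    [/\ rmem s8 29 0 = - (eta * w * dot a hp), rmem s8 30 0 = eta * w * dot a hq,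
     vec s8 34 = hp - eta *: (c *: hp + l *: hq + vec s 13) &
     vec s8 12 = hq - eta *: (c *: hq - l *: hp + vec s 14)])).
  have [_ cok6 _ [N6 _] [_ _]] := dk _ _ _ K7 isT isT.
  apply: (dspec_weaken (dspec_vset d.+1 cok6 _ _ _ _) (leqnn _)) => //=.
    by rewrite N6; lia.
  move=> s8 [sb E _]; split; first exact: (keep_same sb K7).
  have -> : vec s8 34 = vec s7 34 by rewrite /colvec (sb.2 34%N isT).
  rewrite Z3 E /colvec !(sb.2) // Z1 Z2 !(K7.2) //.
  by rewrite El.
move=> s8 {s7 K7 Z1 Z2 Z3} [K8 [Z1 Z2 Z3 Z4]].
apply: (dspec_seq (Q1 := fun s9 => keep [:: 11; 11; 11; 11; 11]%N [:: 11; 12; 34; 30; 29; 30; 29; 30; 29]%N s s9 /\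
    [/\ rmem s9 29 0 = - (eta * w * dot a hp), rmem s9 30 0 = eta * w * dot a hq,
     vec s9 11 = hp - eta *: (c *: hp + l *: hq + vec s 13) &
     vec s9 12 = hq - eta *: (c *: hq - l *: hp + vec s 14)])).
  have [_ cok6 _ [N6 _] [_ _]] := dk _ _ _ K8 isT isT.
  apply: (dspec_weaken (dspec_vset d.+1 cok6 _ _ _ _) (leqnn _)) => //=.
    by rewrite N6; lia.
  move=> s9 [sb E _]; split; first exact: (keep_same sb K8).
  have -> : vec s9 12 = vec s8 12 by rewrite /colvec (sb.2 12%N isT).
  by rewrite E Z3 Z4 !(sb.2) // Z1 Z2.
move=> s9 {s8 K8 Z1 Z2 Z3 Z4} [K9 [Z1 Z2 Z3 Z4]].
apply: (dspec_seq (Q1 := fun s10 => keep [:: 11; 11; 11; 11; 11; 11]%N [:: 11; 11; 12; 34; 30; 29; 30; 29; 30; 29]%N s s10 /\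
    [/\ rmem s10 29 0 = - (eta * w * dot a hp),
     vec s10 11 = hp - eta *: (c *: hp + l *: hq + vec s 13) + (eta * w * dot a hq) *: a &
     vec s10 12 = hq - eta *: (c *: hq - l *: hp + vec s 14)])).
  have [dok9 _ rok9 [N9 i9] [a9 _]] := dk _ _ _ K9 isT isT.
  apply: (dspec_weaken (dspec_axpy_loop dok9 rok9 _ _ (leqnn _))) => //; first by rewrite N9.
  move=> s10 [sb ->]; split; first exact: (keep_same sb K9).
  have -> : vec s10 12 = vec s9 12 by rewrite /colvec (sb.2 12%N isT).
  by rewrite Z3 Z2 i9 a9 Z4 !(sb.2).
move=> s10 {s9 K9 Z1 Z2 Z3 Z4} [K9 [Z1 Z3 Z4]].
have [dok9 _ rok9 [N9 i9] [a9 _]] := dk _ _ _ K9 isT isT.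
apply: (dspec_weaken (dspec_axpy_loop dok9 rok9 _ _ (leqnn _))) => //; first by rewrite N9.
move=> s11 [sb ->]; rewrite Z4 Z1 i9 a9 /colvec (sb.2 11%N isT).
have -> : mvec d.+1 cl (rmem s10 11) = vec s10 11 by [].
rewrite Z3 /smps /smp scaleNr !scalerA -!mulrA; split=> //.
Qed.

End Env.

(** The anchor stays in arrays 9 and 10 while the increment, started at zero, evolves in 11 and 12
    and is added at the end. The two full products with [A^T A] are paid once per epoch. *)
Definition epoch : cmd :=
  matvec 11 9 15 ;;
  matvec 11 10 16 ;;
  vset 11 13 (VSub (VSub (VMul 23 (VV 9)) (VSub (VV 16) (VMul 2 (VV 10)))) (VMul 23 (VV 17))) ;;
  vset 11 14 (VAdd (VMul 23 (VV 10)) (VSub (VV 15) (VMul 2 (VV 9)))) ;;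
  vset 11 11 (VSub (VV 9) (VV 9)) ;;
  vset 11 12 (VSub (VV 9) (VV 9)) ;;
  For 18 (INum 0) (iv 17) svrg_step ;;
  vset 11 9 (VAdd (VV 9) (VV 11)) ;;
  vset 11 10 (VAdd (VV 10) (VV 12)).

(** Real array 9 approximates [c^2 (X^2 + c^2)^-1 x] for [x] in array 17 and
    [c] in cell 23. *)
Definition svrg : cmd :=
  vset 11 9 (VSub (VV 17) (VV 17)) ;;
  vset 11 10 (VSub (VV 17) (VV 17)) ;;
  For 19 (INum 0) (iv 15) epoch.

(** Follows from [(1 - a) (1 + a (T + 1)) <= 1 + a T]. It turns a number of steps of order [1 / a]
    into a constant factor without logarithms or exponentials. *)
Lemma geom_le (R : realType) (a : R) T : 0 <= a <= 1 -> (1 - a) ^+ T * (1 + a * T%:R) <= 1.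
Proof.
case/andP=> a0 a1; elim: T => [|T IH]; first by rewrite expr0 mulr0 addr0 mulr1.
apply: le_trans IH; rewrite exprSr -mulrA ler_wpM2l ?exprn_ge0 ?subr_ge0 //.
have T0 : 0 <= T%:R :> R by rewrite ler0n.
rewrite -natr1; nra.
Qed.

Lemma has_consE (T : Type) (p : pred T) x (r : seq T) : has p (x :: r) = p x || has p r.
Proof. by []. Qed.

(** * Contraction over an epoch *)

Section Svrg.
Variables (R : realType) (n d : nat) (A : 'M[R]_(n, d.+1)).
Variables (lam : 'I_d.+1 -> R) (nu : 'I_d.+1 -> 'cV[R]_d.+1).
Hypothesis eig : eigen_decomposition A lam nu.
Hypothesis lam_le1 : lam ord0 <= 1.
Hypothesis lam_half : 2^-1 <= lam ord0.
Variable l : R.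
Hypothesis l01 : 0 < l < 1.
Implicit Types (s : state R).
Notation cl := (colseq A).
Notation vec := (colvec d.+1 cl).
Notation env := (env A l).
Let M := A^T *m A.

Variables (c : R) (T : nat).
Hypothesis c0 : 0 < c.
Hypothesis TE : 24 * (frob A + c ^+ 2) <= T%:R * c ^+ 2.
Let eta := c / (16 * (frob A + c ^+ 2)).

Let F2 : 2^-1 <= frob A. Proof. exact: frob_half eig lam_le1 lam_half. Qed.
Let c2 : 0 < c ^+ 2. Proof. by rewrite exprn_gt0. Qed.

Definition svrg_pre s : Prop :=
  [/\ env s, rmem s 23 0 = c, rmem s 24 0 = eta & imem s 17 0 = T].

Lemma svrg_pre_frame cc s s' : frame cc s s' ->
  ~~ has (mem (iwr cc)) (17%N :: envI) -> ~~ has (mem (rwr cc)) (23%N :: 24%N :: envR) ->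
  svrg_pre s -> svrg_pre s'.
Proof.
move=> fr; rewrite has_consE negb_or => /andP[i17 HI].
rewrite has_consE negb_or has_consE negb_or => /and3P[r23 r24 HR] [E Ec Ee ET].
by split; [exact: env_frame fr HI HR E|rewrite fr.2|rewrite fr.2|rewrite fr.1].
Qed.

Section Inner.
Variables (sp sq : 'cV[R]_d.+1).
Let gp := - (c *: sp - (M *m sq - l *: sq)).
Let gq := - (c *: sq + (M *m sp - l *: sp)).
Let a := 3 / 2 * (eta * c).
Let N0 := sqn sp + sqn sq.

Definition inner s : Prop := [/\ svrg_pre s, vec s 13 = gp & vec s 14 = gq].
Definition errE s : R := sqn (vec s 11 - sp) + sqn (vec s 12 - sq).

Lemma inner_frame cc s s' : frame cc s s' ->
  ~~ has (mem (iwr cc)) (17%N :: envI) ->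
  ~~ has (mem (rwr cc)) (13%N :: 14%N :: 23%N :: 24%N :: envR) ->
  inner s -> inner s'.
Proof.
move=> fr HI; rewrite has_consE negb_or has_consE negb_or => /and3P[r13 r14 HR] [E Ec Ee].
by split; [exact: svrg_pre_frame fr HI HR E|rewrite /colvec fr.2|rewrite /colvec fr.2].
Qed.

(** [N0 / 6] is the fixed point of the recurrence in [step_contract], the quotient of [1/4] by
    [3/2]; measured from it the error contracts by [1 - a] without an additive term. [alpha] stands
    for the contraction of the steps to come. *)
Lemma spec_step s (alpha : R) tau : inner s -> 0 <= alpha ->
  (400 * (imem s 5 0 + imem s 8 0 + 1) <= tau)%N ->
  spec svrg_step s tau inner (fun s' => alpha * (errE s' - N0 / 6) + N0 / 6)
    (alpha * ((1 - a) * (errE s - N0 / 6)) + N0 / 6).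
Proof.
move=> Is al0 tt.
have tt' : ((30 * imem s 8 0 + 30) + (300 * imem s 5 0 + 300) <= tau)%N by clear -tt; lia.
have [[E Ec Ee ET] E13 E14] := Is.
have [dok cok sok EF El] := E; have [S1 S2 S3 S4 S5] := sok.
set hp := vec s 11; set hq := vec s 12.
pose S := imem s 9 0.
pose P i := stepp A (rmem s 6) (slotv A s) l c hp hq sp sq i.
pose Q i := stepq A (rmem s 6) (slotv A s) l c hp hq sp sq i.
pose g i := alpha * (sqn (P i - sp) + sqn (Q i - sq) - N0 / 6) + N0 / 6.
have S0 : (0 < S)%N by rewrite /S S1 expn_gt0.
have SC := @step_contract _ _ _ A lam nu eig lam_le1 lam_half S (rmem s 6) (slotv A s)
  S3 S4 S5 l c hp hq sp sq l01 c0.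
have H : spec svrg_step s tau (fun=> True) (fun s' => alpha * (errE s' - N0 / 6) + N0 / 6)
    ((\sum_(0 <= i < 2 ^ imem s 8 0) g i) / (2 ^ imem s 8 0)%:R).
  apply: (@spec_weaken _ _ _ ((30 * imem s 8 0 + 30) + (300 * imem s 5 0 + 300)) tau
    (fun=> True) _ (fun s' => alpha * (errE s' - N0 / 6) + N0 / 6) _ _ _ _ _ _ _ (lexx _)).
  2: exact: tt'.
  2: by [].
  2: by move=> *; exact: lexx.
  apply: (spec_seq (Q1 := fun s1 => (imem s1 23 0 < 2 ^ imem s 8 0)%N /\ frame sample s s1)
     (Psi1 := fun s1 => g (imem s1 23 0%N))).
    by apply: spec_frame; apply: spec_sample.
  move=> s1 [lt1 fr].
  have E1 : env s1 by apply: env_frame fr _ _ E.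
  have lt1' : (imem s1 23 0 < imem s1 9 0)%N by rewrite (fr.1 9%N isT) S1.
  have st5 : (300 * imem s1 5 0 + 300 <= 300 * imem s 5 0 + 300)%N.
    by rewrite (fr.1 5%N isT).
  apply: spec_det; apply: (dspec_weaken (dspec_step_det E1 lt1' st5)) => // s2 /= [P2 Q2].
  split=> //; rewrite /errE P2 Q2 /g /P /Q /stepp /stepq /smps.
  rewrite /colvec !fr.2 // Ee Ec.
  have -> : mvec d.+1 cl (rmem s 13) = gp by [].
  have -> : mvec d.+1 cl (rmem s 14) = gq by [].
  by rewrite /slotv (fr.1 6%N isT) (fr.1 7%N isT).
apply: (spec_weaken (spec_frame H)) => //.
  by move=> s' [_ fr]; apply: inner_frame fr _ _ Is.
rewrite -S1 -/S.
have SR : 0 < S%:R :> R by rewrite ltr0n.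
rewrite ler_pdivrMr //.
set X := \sum_(0 <= i < S) (sqn (P i - sp) + sqn (Q i - sq)) in SC *.
have -> : \sum_(0 <= i < S) g i = alpha * (X - N0 / 6 * S%:R) + N0 / 6 * S%:R.
  rewrite /g big_split /= -mulr_sumr big_split /= !sumr_const_nat subn0.
  by rewrite -/X -(mulr_natr (N0 / 6)) -(mulr_natr (- (N0 / 6))) mulNr.
have key : X - N0 / 6 * S%:R <= (1 - a) * (errE s - N0 / 6) * S%:R.
  apply: le_trans (lerB SC (lexx _)) _; rewrite /a /errE -/hp -/hq /N0.
  by rewrite le_eqVlt; apply/orP; left; apply/eqP; rewrite -/eta; field.
have := ler_wpM2l al0 key; lra.
Qed.

End Inner.

Definition solp x := ofco nu (fun i => c ^+ 2 / ((lam i - l) ^+ 2 + c ^+ 2) * co nu i x).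
Definition solq x := ofco nu (fun i => - (lam i - l) * c / ((lam i - l) ^+ 2 + c ^+ 2) * co nu i x).
Definition errZ (x : 'cV[R]_d.+1) s := sqn (vec s 9 - solp x) + sqn (vec s 10 - solq x).

Lemma den_neq0 i : (lam i - l) ^+ 2 + c ^+ 2 != 0.
Proof. by rewrite gt_eqF // ltr_wpDl // sqr_ge0. Qed.

Lemma sol_eq1 x : c *: solp x - (M *m solq x - l *: solq x) = c *: x.
Proof.
apply: (co_inj eig) => i; rewrite !(coN, coZ, coD) !(coM eig) !(co_ofco eig).
by have := den_neq0 i; move: (co nu i x) => u dn; field.
Qed.

Lemma sol_eq2 x : c *: solq x + (M *m solp x - l *: solp x) = 0.
Proof.
apply: (co_inj eig) => i; rewrite !(coN, coZ, coD) !(coM eig) !(co_ofco eig) co0.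
by have := den_neq0 i; move: (co nu i x) => u dn; field.
Qed.

(** Here [a = 3 c^2 / (32 (F + c^2))], so the lower bound on [T] gives [a T >= 9/4], and [geom_le]
    yields [4/13]. *)
Lemma svrg_contract : let a := 3 / 2 * (eta * c) in
  (1 - a) ^+ T <= 1 / 3 /\ 0 <= 1 - a.
Proof.
move=> a.
have [F2' c2'] : 2^-1 <= frob A /\ 0 < c ^+ 2 by [].
have Fc : 0 < frob A + c ^+ 2 by lra.
have T0 : 0 < 32 * (frob A + c ^+ 2) by lra.
have series_part : a * (32 * (frob A + c ^+ 2)) = 3 * c ^+ 2.
  by rewrite /a /eta; field; rewrite gt_eqF.
have a0 : 0 <= a by rewrite -(ler_pM2r T0) series_part mul0r; lra.
have a1 : a <= 1 by rewrite -(ler_pM2r T0) series_part; lra.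
split; last by lra.
have aT : 9 / 4 <= a * T%:R.
  by rewrite -(ler_pM2r T0) [leRHS]mulrAC series_part; move: TE; set Fq := frob A; move: (c ^+ 2) (T%:R : R) => z t; lra.
have a01 : 0 <= a <= 1 by rewrite a0.
have := @geom_le _ a T a01; set g := (1 - a) ^+ T.
have : 0 <= g by rewrite exprn_ge0 // subr_ge0.
nra.
Qed.

(** The increment starts at zero, hence with error [N0], the squared distance from the anchor to the
    solution. After [T] steps the bound is [1/3 (N0 - N0/6) + N0/6 = 4/9 N0]. *)
Lemma spec_epoch s x tau : svrg_pre s -> vec s 17 = x ->
  (400 * nnz A + 400 * imem s 5 0 + T * (420 * (imem s 5 0 + imem s 8 0 + 1)) + 400 <= tau)%N ->
  spec epoch s tau svrg_pre (errZ x) (errZ x s / 2).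
Proof.
move=> Is Ex tt; set N := imem s 5 0; set ell := imem s 8 0.
apply: (@spec_weaken _ _ _ ((200 * nnz A + 100) + ((200 * nnz A + 100) + ((60 * N + 20) +
  ((60 * N + 20) + ((60 * N + 20) + ((60 * N + 20) + (T * (420 * (N + ell + 1)) + 20 +
  ((60 * N + 20) + (60 * N + 20))))))))) _ svrg_pre _ (errZ x) _ _ _ _ _ _ _ (lexx _)).
2: by rewrite -/N -/ell in tt; clear -tt; lia.
2: by [].
2: by move=> *; exact: lexx.
have [E Ec Ee ET] := Is.
pose sp := solp x - vec s 9; pose sq := solq x - vec s 10.
have dokE s1 : svrg_pre s1 -> data_ok A s1 /\ cols_ok cl s1 by case=> -[].
pose K s1 := svrg_pre s1 /\ (imem s1 5 0 = N /\ imem s1 8 0 = ell).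
have KF cc s1 s' : frame cc s1 s' ->
    ~~ has (mem (iwr cc)) (17%N :: envI) -> ~~ has (mem (rwr cc)) (23%N :: 24%N :: envR) ->
    K s1 -> K s'.
  move=> f HI HR [J NN]; split; first exact: svrg_pre_frame f HI HR J.
  by move: HI; rewrite has_consE negb_or => /andP[_ /hasPn HI]; rewrite !f.1 // HI.
pose V s1 := [/\ vec s1 9 = vec s 9, vec s1 10 = vec s 10 & vec s1 17 = x].
have VF cc s1 s' : frame cc s1 s' -> ~~ has (mem (rwr cc)) [:: 9; 10; 17]%N -> V s1 -> V s'.
  by move=> f /= /norP[n9 /norP[n10 /norP[n17 _]]] [v9 v10 v17]; split; rewrite /colvec f.2.
have vs dst e s1 (Q : state R -> Prop) : K s1 -> dst \notin vscal e ->
    (rcost (vcomp 11 e) <= 44)%N ->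
    (forall s', frame (vset 11 dst e) s1 s' ->
       vec s' dst = veval d.+1 cl s1 e -> Q s') ->
    dspec (vset 11 dst e) s1 (60 * N + 20) Q.
  move=> [J [NN _]] nd re HQ; have [_ cok] := dokE _ J.
  have tt' : (imem s1 5 0 * (rcost (vcomp 11 e) + 16) + 9 <= 60 * N + 20)%N.
    by rewrite NN; clear -re; nia.
  apply: (dspec_weaken (dspec_frame (dspec_vset d.+1 (ii := 11) cok isT isT nd tt')) (leqnn _)).
  by move=> s' [[sb E' _] f]; apply: HQ.
apply: (spec_dseq (Q1 := fun s1 => [/\ K s1, V s1 & vec s1 15 = M *m vec s 9])).
  have [dok _] := dokE _ Is.
  apply: (dspec_weaken (dspec_frame (dspec_matvec (src := 9) (dst := 15) (i := 11)
    dok isT isT isT isT isT (leqnn _))) (leqnn _)).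
  move=> s1 [Es f]; split=> //; first by apply: KF f _ _ _.
  by apply: VF f _ _.
move=> s1 [K1 V1 E15].
apply: (spec_dseq (Q1 := fun s2 => [/\ K s2, V s2, vec s2 15 = M *m vec s 9 &
    vec s2 16 = M *m vec s 10])).
  have [dok _] := dokE _ K1.1.
  apply: (dspec_weaken (dspec_frame (dspec_matvec (src := 10) (dst := 16) (i := 11)
    dok isT isT isT isT isT (leqnn _))) (leqnn _)).
  move=> s2 [Es f]; split; first by apply: KF f _ _ K1.
  - by apply: VF f _ V1.
  - by rewrite -E15 /colvec f.2.
  - by rewrite Es; case: V1 => _ ->.
move=> s2 {s1 K1 V1 E15} [K2 V2 E15 E16].
have r2 s1 : K s1 -> rmem s1 23 0 = c /\ rmem s1 2 0 = l by case=> -[[]].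
pose gp := - (c *: sp - (M *m sq - l *: sq)); pose gq := - (c *: sq + (M *m sp - l *: sp)).
apply: (spec_dseq (Q1 := fun s1 => [/\ K s1, V s1, vec s1 15 = M *m vec s 9 &
    vec s1 13 = gp])).
  apply: vs => // s3 f E13; split; first by apply: KF f _ _ K2.
  - by apply: VF f _ V2.
  - by rewrite -E15 /colvec f.2.
  - have [Ec2 El2] := r2 _ K2; have [v9 v10 v17] := V2.
    rewrite E13 /= v9 v10 v17 E16 Ec2 El2 -(sol_eq1 x) /gp /sp /sq mulmxBr.
    move: (M *m solq x) (M *m vec s 10) => u w; apply/colP => j; rewrite !mxE; ring.
move=> s3 {s2 K2 V2 E15 E16} [K2 V2 E15 E13].
apply: (spec_dseq (Q1 := fun s1 => [/\ K s1, V s1, vec s1 14 = gq & vec s1 13 = gp])).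
  apply: vs => // s4 f E14; split; first by apply: KF f _ _ K2.
  - by apply: VF f _ V2.
  - have [Ec2 El2] := r2 _ K2; have [v9 v10 v17] := V2.
    rewrite E14 /= v9 v10 E15 Ec2 El2.
    rewrite -[LHS]subr0 -(sol_eq2 x) /gq /sp /sq mulmxBr.
    move: (M *m solp x) (M *m vec s 9) => u w; apply/colP => j; rewrite !mxE; ring.
  - by rewrite -E13 /colvec f.2.
move=> s4 {s3 K2 V2 E15 E13} [K2 V2 E14 E13].
apply: (spec_dseq (Q1 := fun s1 => [/\ K s1, V s1, vec s1 14 = gq, vec s1 13 = gp &
    vec s1 11 = 0])).
  apply: vs => // s5 f Eh; split; first by apply: KF f _ _ K2.
  - by apply: VF f _ V2.
  - by rewrite -E14 /colvec f.2.
  - by rewrite -E13 /colvec f.2.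
  - by rewrite Eh /= subrr.
move=> s5 {s4 K2 V2 E14 E13} [K2 V2 E14 E13 E11].
apply: (spec_dseq (Q1 := fun s1 => [/\ K s1, V s1, inner sp sq s1, vec s1 12 = 0 &
    vec s1 11 = 0])).
  apply: vs => // s6 f Eh; have K6 : K s6 by apply: KF f _ _ K2.
  split=> //.
  - by apply: VF f _ V2.
  - split; first exact: K6.1.
      by rewrite -/gp -E13 /colvec f.2.
    by rewrite -/gq -E14 /colvec f.2.
  - by rewrite Eh /= subrr.
  - by rewrite -E11 /colvec f.2.
move=> s6 {s5 K2 V2 E14 E13 E11} [K2 V2 I2 E12 E11].
pose a := 3 / 2 * (eta * c); pose N0 := sqn sp + sqn sq.
have [aT a1] := svrg_contract; rewrite -/a in aT a1.
apply: (spec_seq (Q1 := fun s1 => K s1 /\ V s1) (Psi1 := errE sp sq)).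
  pose Inv (k : nat) s1 := [/\ K s1, V s1 & inner sp sq s1].
  pose Psi k s1 := (1 - a) ^+ (T - k) * (errE sp sq s1 - N0 / 6) + N0 / 6.
  have InvF k k' cc s1 s' : frame cc s1 s' ->
    ~~ has (mem (iwr cc)) (17%N :: envI) ->
    ~~ has (mem (rwr cc)) (13%N :: 14%N :: 23%N :: 24%N :: envR) ->
    ~~ has (mem (rwr cc)) [:: 9; 10; 17]%N -> Inv k s1 -> Inv k' s'.
    move=> f HI HR HV [J1 J2 J3]; split; last exact: inner_frame f HI HR J3.
      apply: KF f HI _ J1.
      by move: HR; rewrite has_consE negb_or has_consE negb_or => /and3P[].
    exact: VF f HV J2.
  have tti : ((T - 0) * (400 * (N + ell + 1) + icost (iv 17) + 10) + icost (INum 0) +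
     icost (iv 17) + 6 <= T * (420 * (N + ell + 1)) + 20)%N.
    by rewrite subn0 /=; clear; nia.
  apply: (@spec_weaken _ _ _ (T * (420 * (N + ell + 1)) + 20) _
    (fun s' => Inv T s' /\ imem s' 18 0 = T) _ (Psi T) _ (errZ x s / 2) _ _ (leqnn _)).
  - apply: (@spec_for _ _ _ _ _ 0%N T (400 * (N + ell + 1))) => //.
    + by move=> k s1 _ [[[_ _ _ ET1] _] _ _] _; exact: ET1.
    + have EN : errE sp sq (seti 18 0 s6) = N0.
        rewrite /errE; have -> : vec (seti 18 0 s6) 11 = vec s6 11 by [].
        have -> : vec (seti 18 0 s6) 12 = vec s6 12 by [].
        by rewrite E11 E12 !sub0r !sqnN.
      have EZ : errZ x s = N0.
        by rewrite /errZ /N0 -[in RHS](sqnN sp) -[in RHS](sqnN sq) /sp /sq !opprB.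
      rewrite /Psi EN EZ subn0.
      have N00 : 0 <= N0 by rewrite addr_ge0 ?sqn_ge0.
      have := ler_wpM2r N00 aT; set g := (1 - a) ^+ T; lra.
    + move=> k s1 /andP[_ kT] [J1 J2 J3] ik.
      have al0 : 0 <= (1 - a) ^+ (T - k.+1) by rewrite exprn_ge0.
      have tts : (400 * (imem s1 5 0 + imem s1 8 0 + 1) <= 400 * (N + ell + 1))%N.
        by rewrite J1.2.1 J1.2.2.
      apply: (spec_weaken (spec_frame (spec_step J3 al0 tts)) (leqnn _)).
      * move=> s2 [J4 f].
        apply: (InvF k k.+1 _ _ _ (frame_seti 18 k.+1 s2)) => //.
        by apply: (InvF k k _ _ _ f).
      * by move=> s2 _; exact: lexx.
      * rewrite /Psi -/a -/N0.
        have -> : (T - k = (T - k.+1).+1)%N by clear -kT; lia.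
        by rewrite [(1 - a) ^+ (_).+1]exprSr mulrA lexx.
  - by move=> s' [[]].
  - by move=> s' _; rewrite /Psi subnn expr0 mul1r subrK.
  - exact: lexx.
move=> s7 [K7 V7].
have [v9 v10 v17] := V7.
apply: spec_det.
apply: (dspec_seq (Q1 := fun s1 => [/\ K s1, vec s1 9 = vec s 9 + vec s7 11, vec s1 10 = vec s 10,
   vec s1 12 = vec s7 12 & vec s1 17 = x])).
  apply: vs => // s8 f E9; split; first by apply: KF f _ _ K7.
  - by rewrite E9 /= v9.
  - by rewrite -v10 /colvec f.2.
  - by rewrite /colvec f.2.
  - by rewrite -v17 /colvec f.2.
move=> s8 [K8 E9 E10 E12' E17].
apply: vs => // s9 f E10'; split; first by have [] : K s9 by apply: KF f _ _ K8.
rewrite /errE /errZ E10' /= E10 E12'.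
have -> : vec s9 9 = vec s8 9 by rewrite /colvec f.2.
rewrite E9 /sp /sq !opprB !addrA (addrC (vec s 9)) (addrC (vec s 10)).
by rewrite ![_ + vec s _ - _]addrAC.
Qed.

(** In each coordinate the two squares add up to [c^2 / D] times the square of the coordinate of
    [x]. This is the initial error of [svrg], which starts from zero. *)
Lemma sqn_sol x : sqn (solp x) + sqn (solq x) <= sqn x.
Proof.
rewrite !(sqn_co eig) -big_split; apply: ler_sum => i _ /=.
rewrite !(co_ofco eig); have := den_neq0 i.
set D := (lam i - l) ^+ 2 + c ^+ 2 => Dn; move: (co nu i x) => u.
have -> : (c ^+ 2 / D * u) ^+ 2 + (- (lam i - l) * c / D * u) ^+ 2 = c ^+ 2 / D * u ^+ 2.
  have -> : (c ^+ 2 / D * u) ^+ 2 + (- (lam i - l) * c / D * u) ^+ 2 =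
    (c ^+ 2 * u ^+ 2) * (D / D / D) by rewrite /D; field.
  by rewrite divff // div1r mulrAC.
rewrite ler_piMl ?sqr_ge0 // ler_pdivrMr ?mul1r ?lerDr ?sqr_ge0 //.
by rewrite /D ltr_wpDl // sqr_ge0.
Qed.

Definition epoch_time s : nat :=
  400 * nnz A + 400 * imem s 5 0 + T * (420 * (imem s 5 0 + imem s 8 0 + 1)) + 400.

Lemma spec_svrg s tau : svrg_pre s ->
  ((imem s 15 0).+1 * (epoch_time s + 20) <= tau)%N ->
  spec svrg s tau svrg_pre (fun s' => sqn (vec s' 9 - solp (vec s 17)))
    (2^-1 ^+ imem s 15 0 * sqn (vec s 17)).
Proof.
move=> Is; set N := imem s 5 0; set ell := imem s 8 0; set E := imem s 15 0 => tt.
pose x := vec s 17; set W := epoch_time s in tt.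
have W1 : (120 * N + 60 <= W)%N by rewrite /W /epoch_time -/N; clear; lia.
apply: (@spec_weaken _ _ _ ((60 * N + 20) + ((60 * N + 20) + (E * (W + 14) + 20)))
   _ svrg_pre _ (errZ x) _ _ _ _ _ _ _ (lexx _)).
2: by clear -tt W1; nia.
2: by [].
2: by move=> s' _; rewrite /errZ lerDl sqn_ge0.
pose K s1 := [/\ svrg_pre s1, imem s1 15 0 = E, imem s1 5 0 = N, imem s1 8 0 = ell & vec s1 17 = x].
have KF cc s1 s' : frame cc s1 s' ->
    ~~ has (mem (iwr cc)) (15%N :: 17%N :: envI) ->
    ~~ has (mem (rwr cc)) (17%N :: 23%N :: 24%N :: envR) -> K s1 -> K s'.
  move=> f; rewrite has_consE negb_or has_consE negb_or => /andP[n15 /andP[n17 HI]].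
  rewrite has_consE negb_or => /andP[r17 HR] [J1 J2 J3 J4 J5]; split.
  - apply: svrg_pre_frame f _ HR J1; rewrite has_consE negb_or; exact/andP.
  - by rewrite f.1.
  - by move/hasPn: HI => HI; rewrite f.1 // HI.
  - by move/hasPn: HI => HI; rewrite f.1 // HI.
  - by rewrite /colvec f.2.
pose z := VSub (VV 17) (VV 17).
have zt s1 : K s1 -> (imem s1 5 0 * (rcost (vcomp 11 z) + 16) + 9 <= 60 * N + 20)%N.
  by case=> _ _ -> _ _ /=; clear; lia.
apply: (spec_dseq (Q1 := fun s1 => K s1 /\ vec s1 9 = 0)).
  have K0 : K s by [].
  have [[dok cok _ _ _] _ _ _] := Is.
  apply: (dspec_weaken (dspec_frame (dspec_vset d.+1 (ii := 11) (dst := 9) (e := z)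
    cok isT isT isT (zt _ K0))) (leqnn _)).
  move=> s1 [[sb E9 _] f]; split; last by rewrite E9 /= subrr.
  by apply: KF f _ _ _.
move=> s1 [K1 E9].
apply: (spec_dseq (Q1 := fun s1 => [/\ K s1, vec s1 9 = 0 & vec s1 10 = 0])).
  have [[[dok cok _ _ _] _ _ _] _ _ _ _] := K1.
  apply: (dspec_weaken (dspec_frame (dspec_vset d.+1 (ii := 11) (dst := 10) (e := z)
    cok isT isT isT (zt _ K1))) (leqnn _)).
  move=> s2 [[sb E10 _] f]; split; last by rewrite E10 /= subrr.
    by apply: KF f _ _ _.
  by rewrite -E9 /colvec f.2.
move=> s2 {s1 K1 E9} [K2 E9 E10].
have tti : ((E - 0) * (W + icost (iv 15) + 10) + icost (INum 0) +
     icost (iv 15) + 6 <= E * (W + 14) + 20)%N.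
  by rewrite subn0 /=; clear; nia.
pose Psi k s1 := 2^-1 ^+ (E - k) * errZ x s1.
apply: (@spec_weaken _ _ _ (E * (W + 14) + 20) _
    (fun s' => K s' /\ imem s' 19 0 = E) _ (Psi E) _ (2^-1 ^+ E * sqn x) _ _ (leqnn _)).
- apply: (@spec_for _ _ _ _ _ 0%N E W (E * (W + 14) + 20) (fun=> K) Psi) => //.
  + by move=> k s1 _ [_ J2 _ _ _] _; exact: J2.
  + rewrite /Psi subn0; apply: ler_wpM2l; first by rewrite exprn_ge0 // invr_ge0.
    have -> : errZ x (seti 19 0 s2) = sqn (solp x) + sqn (solq x).
      rewrite /errZ; have -> : vec (seti 19 0 s2) 9 = vec s2 9 by [].
      have -> : vec (seti 19 0 s2) 10 = vec s2 10 by [].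
      by rewrite E9 E10 !sub0r !sqnN.
    exact: sqn_sol.
  + move=> k s1 /andP[_ kE] K1 ik.
    have al0 : 0 <= (2^-1 : R) ^+ (E - k.+1) by rewrite exprn_ge0 // invr_ge0.
    have [J1 J2 J3 J4 J5] := K1.
    have tts : (400 * nnz A + 400 * imem s1 5 0 + T * (420 * (imem s1 5 0 + imem s1 8 0 + 1)) + 400 <= W)%N.
      by rewrite J3 J4.
    have H := spec_affine 0 al0 (spec_epoch J1 J5 tts).
    apply: (spec_weaken (spec_frame H) (leqnn _)).
    * move=> s3 [J6 f]; apply: (KF _ _ _ (frame_seti 19 k.+1 s3)) => //.
      by apply: (KF _ _ _ f).
    * by move=> s3 _; rewrite addr0 lexx.
    * rewrite addr0 /Psi; have -> : (E - k = (E - k.+1).+1)%N by clear -kE; lia.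
      by rewrite exprSr -[leRHS]mulrA [_^-1 * _]mulrC lexx.
- by move=> s' [[]].
- by move=> s' _; rewrite /Psi subnn expr0 mul1r.
- exact: lexx.
Qed.

End Svrg.

(** * Heavy-ball iteration *)

(** With right-hand side [rho^-2 b + (1 - rho^-2) u], one call of [svrg] at shift [rho c] performs
    the preconditioned step [u - z (u - u0)], where [u0] is the exact solution and
    [z = (X^2 + c^2) / (X^2 + (rho c)^2)] lies in [[rho^-2, 1]]. The momentum term reduces the
    [rho^2] steps that this range would require to [O(rho)]. *)
Definition heavy_step : cmd :=
  vset 11 17 (VAdd (VMul 26 (VV 20)) (VMul 33 (VV 18))) ;;
  svrg ;;
  vset 11 34 (VAdd (VV 9) (VMul 25 (VSub (VV 18) (VV 19)))) ;;
  vset 11 19 (VV 18) ;;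
  vset 11 18 (VV 34).

(** Real array 18 approximates [c^2 (X^2 + c^2)^-1 b] for [b] in array 20, by a
    heavy-ball iteration preconditioned with [rho c] in place of [c]. *)
Definition solve : cmd :=
  vset 11 18 (VSub (VV 20) (VV 20)) ;;
  vset 11 19 (VSub (VV 20) (VV 20)) ;;
  For 20 (INum 0) (iv 16) heavy_step.

(** Invariant quadratic form of the recurrence [e'' = a e - th e']: each step
    multiplies it by [th]. *)
Definition lyap (R : realType) (a th e e' : R) : R := e ^+ 2 - a * e * e' + th * e' ^+ 2.

Lemma heavy_facts (R : realType) (z rho sg : R) : 1 <= rho ->
  rho * sg = 1 / 2 -> rho ^- 2 <= z <= 1 ->
  [/\ 0 < sg, sg <= 1 / 2, 4 * sg ^+ 2 <= z & z <= 1].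
Proof.
move=> rho1 sgE /andP[z1 z2].
have rp : 0 < rho by lra.
have s0 : 0 < sg by rewrite -(pmulr_rgt0 _ rp) sgE; lra.
split => //; first by nra.
apply: le_trans z1.
have -> : sg = 1 / 2 / rho by rewrite -sgE mulrAC divff ?mul1r ?gt_eqF.
by rewrite le_eqVlt; apply/orP; left; apply/eqP; field; rewrite gt_eqF.
Qed.

(** The recurrence has characteristic polynomial [t^2 - a t + th], with complex roots of modulus
    [1 - sg] as soon as [z > sg^2]. The choice [sg = 1 / (2 rho)] gives [z >= 4 sg^2], hence
    [a <= 2 (1 - sg) - 3 sg^2], and this margin makes the form definite with constant
    [3/2 sg^2 = 3 / (8 rho^2)]. *)
Lemma lyap_ge (R : realType) (z rho sg e e' : R) : 1 <= rho ->
  rho * sg = 1 / 2 -> rho ^- 2 <= z <= 1 ->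
  3 / (8 * rho ^+ 2) * e ^+ 2 <= lyap (1 + (1 - sg) ^+ 2 - z) ((1 - sg) ^+ 2) e e'.
Proof.
move=> rho1 sgE zrho; have [s0 s1 s2 z1] := heavy_facts rho1 sgE zrho.
have rp : 0 < rho by lra.
have -> : 3 / (8 * rho ^+ 2) = 3 / 2 * sg ^+ 2.
  have -> : sg = 1 / 2 / rho by rewrite -sgE mulrAC divff ?mul1r ?gt_eqF.
  by field; rewrite gt_eqF.
set th := (1 - sg) ^+ 2; set a := 1 + th - z; pose r := 1 - sg.
have a0 : 0 <= a by rewrite /a /th; nra.
have a2 : a <= 2 * r - 3 * sg ^+ 2 by rewrite /a /th /r; nra.
have r0 : 1 / 2 <= r by rewrite /r; lra.
have rp2 : 0 < 2 * r by lra.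
(* [2 r e e' <= e^2 + r^2 e'^2], scaled by [a / 2 r < 1] *)
have k : a * e * e' <= a / (2 * r) * (e ^+ 2 + th * e' ^+ 2).
  have -> : a * e * e' = a / (2 * r) * (2 * r * e * e') by field; rewrite gt_eqF //; lra.
  apply: ler_wpM2l; first by rewrite divr_ge0 // ltW.
  by have := sqr_ge0 (e - r * e'); rewrite /th /r; nra.
have q : a / (2 * r) <= 1 - 3 / 2 * sg ^+ 2.
  rewrite ler_pdivrMr //.
  have : sg ^+ 2 * r <= sg ^+ 2 * 1 by rewrite ler_wpM2l ?sqr_ge0 //; rewrite /r; lra.
  lra.
have th0 : 0 <= th by rewrite /th sqr_ge0.
have Q0 : 0 <= e ^+ 2 + th * e' ^+ 2.
  by apply: addr_ge0; [exact: sqr_ge0|apply: mulr_ge0 => //; exact: sqr_ge0].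
have := ler_wpM2r Q0 q.
have T0 : 0 <= sg ^+ 2 * (th * e' ^+ 2).
  by apply: mulr_ge0; [exact: sqr_ge0|apply: mulr_ge0 => //; exact: sqr_ge0].
rewrite /lyap; move: k; move: (a / (2 * r) * _) => K; lra.
Qed.

(** Without [x] the form is multiplied by [(1 - sg)^2] exactly. The perturbation is separated by
    Young's inequality with weight [sg]: this costs a factor [1 + sg], and
    [(1 + sg) (1 - sg)^2 <= 1 - sg], while [x^2] receives [1 / sg = 2 rho]. *)
Lemma lyap_step (R : realType) (z rho sg e e' x : R) : 1 <= rho ->
  rho * sg = 1 / 2 -> rho ^- 2 <= z <= 1 ->
  let th := (1 - sg) ^+ 2 in let a := 1 + th - z in
  lyap a th (a * e - th * e' + x) e <= (1 - sg) * lyap a th e e' + 3 * rho * x ^+ 2.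
Proof.
move=> rho1 sgE zrho; cbv zeta; set th := (1 - sg) ^+ 2; set a := 1 + th - z.
have [s0 s1 s2 z1] := heavy_facts rho1 sgE zrho.
have rp : 0 < rho by lra.
have V0 : 0 <= lyap a th e e'.
  apply: le_trans (lyap_ge e e' rho1 sgE zrho); apply: mulr_ge0; last exact: sqr_ge0.
  by rewrite divr_ge0 // mulr_ge0 // sqr_ge0.
set y := a * e - th * e'.
have E1 : lyap a th y e = th * lyap a th e e' by rewrite /lyap /y; ring.
have E2 : lyap a th (y + x) e = lyap a th y e + 2 * x * (y - a * e / 2) + x ^+ 2.
  by rewrite /lyap; field.
have a0 : 0 <= a by rewrite /a /th; nra.
have a2 : a <= 2 * (1 - sg) by rewrite /a /th; nra.
have ath : a ^+ 2 <= 4 * th by rewrite /th; clear -a0 a2; nra.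
have L1 : (y - a * e / 2) ^+ 2 <= lyap a th y e.
  have : 0 <= (4 * th - a ^+ 2) * e ^+ 2 by rewrite mulr_ge0 ?sqr_ge0 // subr_ge0.
  by rewrite /lyap; move: (a) (th) (y) => a' th' y'; clear; lra.
have L2 : 2 * x * (y - a * e / 2) <= sg * (y - a * e / 2) ^+ 2 + 2 * rho * x ^+ 2.
  have := mulr_ge0 (ltW s0) (sqr_ge0 (y - a * e / 2 - 2 * rho * x)).
  move: (y - a * e / 2) => q.
  have -> : sg * (q - 2 * rho * x) ^+ 2 =
    sg * q ^+ 2 - 4 * (rho * sg) * x * q + 4 * (rho * sg) * rho * x ^+ 2 by ring.
  by rewrite sgE; clear; lra.
have L3 : (1 + sg) * lyap a th y e <= (1 - sg) * lyap a th e e'.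
  rewrite E1 mulrA; apply: ler_wpM2r => //; rewrite /th; clear -s0 s1; nra.
have L4 := ler_wpM2l (ltW s0) L1.
have x2 : x ^+ 2 <= rho * x ^+ 2 by rewrite ler_peMl ?sqr_ge0.
rewrite E2; move: L2 L3 L4 x2; move: (y - a * e / 2) (lyap a th y e) (lyap a th e e') => q v w.
clear; lra.
Qed.

Lemma env_vset_off (R : realType) (n d : nat) (A : 'M[R]_(n, d.+1)) (l : R)
    (dst : nat) (e : vexp) (s : state R) (N : nat) (Q : state R -> Prop) :
  env A l s -> imem s 5 0 = N -> dst \notin vscal e -> (rcost (vcomp 11 e) <= 44)%N ->
  (forall s', frame (vset 11 dst e) s s' ->
     colvec d.+1 (colseq A) s' dst = veval d.+1 (colseq A) s e ->
     (forall j, j \notin colseq A -> rmem s' dst j = rmem s dst j) -> Q s') ->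
  dspec (vset 11 dst e) s (60 * N + 20) Q.
Proof.
move=> [_ cok _ _ _] NN nd re HQ.
have tt' : (imem s 5 0 * (rcost (vcomp 11 e) + 16) + 9 <= 60 * N + 20)%N.
  by rewrite NN; clear -re; nia.
apply: (dspec_weaken (dspec_frame (dspec_vset d.+1 (ii := 11) cok isT isT nd tt')) (leqnn _)).
by move=> s' [[sb E' E''] f]; apply: HQ.
Qed.

Lemma env_vset (R : realType) (n d : nat) (A : 'M[R]_(n, d.+1)) (l : R)
    (dst : nat) (e : vexp) (s : state R) (N : nat) (Q : state R -> Prop) :
  env A l s -> imem s 5 0 = N -> dst \notin vscal e -> (rcost (vcomp 11 e) <= 44)%N ->
  (forall s', frame (vset 11 dst e) s s' ->
     colvec d.+1 (colseq A) s' dst = veval d.+1 (colseq A) s e -> Q s') ->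
  dspec (vset 11 dst e) s (60 * N + 20) Q.
Proof. by move=> E NN nd re HQ; apply: (env_vset_off E NN nd re) => s' f E' _; apply: HQ. Qed.

Section Heavy.
Variables (R : realType) (n d : nat) (A : 'M[R]_(n, d.+1)).
Variables (lam : 'I_d.+1 -> R) (nu : 'I_d.+1 -> 'cV[R]_d.+1).
Hypothesis eig : eigen_decomposition A lam nu.
Hypothesis lam_le1 : lam ord0 <= 1.
Hypothesis lam_half : 2^-1 <= lam ord0.
Variable l : R.
Hypothesis l01 : 0 < l < 1.
Implicit Types (s : state R).
Notation cl := (colseq A).
Notation vec := (colvec d.+1 cl).
Variables (c : R) (rho : nat) (T : nat).
Hypothesis c0 : 0 < c.
Hypothesis rho0 : (0 < rho)%N.
Let c' := rho%:R * c.
Hypothesis TE : 24 * (frob A + c' ^+ 2) <= T%:R * c' ^+ 2.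
Let sg : R := 1 / (2 * rho%:R).
Let th := (1 - sg) ^+ 2.
Let q : R := 1 / (4 * rho%:R).

Lemma rho_ge1 : 1 <= rho%:R :> R. Proof. by rewrite ler1n. Qed.
Lemma c'_gt0 : 0 < c'.
Proof. by rewrite mulr_gt0 // ltr0n. Qed.
Lemma rho_sg : rho%:R * sg = 1 / 2.
Proof. by rewrite /sg; field; rewrite pnatr_eq0 -lt0n. Qed.

Definition ghat i := c ^+ 2 / ((lam i - l) ^+ 2 + c ^+ 2).
Definition shift_ratio i := ((lam i - l) ^+ 2 + c ^+ 2) / ((lam i - l) ^+ 2 + c' ^+ 2).
Definition solU b := ofco nu (fun i => ghat i * co nu i b).
Definition lyap_total b s := \sum_i lyap (1 + th - shift_ratio i) th
  (co nu i (vec s 18 - solU b)) (co nu i (vec s 19 - solU b)).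

Lemma ghat01 i : 0 <= ghat i <= 1.
Proof.
have D : 0 < (lam i - l) ^+ 2 + c ^+ 2 by rewrite ltr_wpDl ?sqr_ge0 // exprn_gt0.
apply/andP; split; first by apply: divr_ge0; [exact: sqr_ge0|exact: ltW].
by rewrite /ghat ler_pdivrMr // mul1r lerDr sqr_ge0.
Qed.

Lemma zz01 i : rho%:R ^- 2 <= shift_ratio i <= 1.
Proof.
have D : 0 < (lam i - l) ^+ 2 + c' ^+ 2.
  by rewrite ltr_wpDl ?sqr_ge0 // exprn_gt0 // c'_gt0.
have r1 := rho_ge1; have r2 : 0 < rho%:R ^+ 2 :> R by rewrite exprn_gt0 // ltr0n.
have r21 : 1 <= rho%:R ^+ 2 :> R by rewrite exprn_ege1.
have X2 := sqr_ge0 (lam i - l); have C2 := sqr_ge0 c.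
have cE : c' ^+ 2 = rho%:R ^+ 2 * c ^+ 2 by rewrite /c' exprMn.
apply/andP; split; last first.
  by rewrite /shift_ratio ler_pdivrMr // mul1r lerD2l cE ler_peMl.
rewrite /shift_ratio ler_pdivlMr // cE mulrDr mulKf ?gt_eqF // lerD2r.
by rewrite ler_piMl // invf_le1.
Qed.

Lemma lyap_total_ge b s : sqn (vec s 18 - solU b) <= 8 * rho%:R ^+ 2 / 3 * lyap_total b s.
Proof.
rewrite (sqn_co eig) mulr_sumr; apply: ler_sum => i _.
have := lyap_ge (co nu i (vec s 18 - solU b)) (co nu i (vec s 19 - solU b))
  rho_ge1 rho_sg (zz01 i).
have r2 : 0 < 8 * rho%:R ^+ 2 / 3 :> R.
  by rewrite divr_gt0 // mulr_gt0 // exprn_gt0 // ltr0n.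
move/(ler_wpM2l (ltW r2)); apply: le_trans.
rewrite mulrA le_eqVlt; apply/orP; left; apply/eqP; field.
by rewrite pnatr_eq0 -lt0n.
Qed.

Definition solve_pre s : Prop :=
  [/\ svrg_pre A l c' T s, rmem s 25 0 = th, rmem s 26 0 = rho%:R ^- 2 &
      rmem s 33 0 = 1 - rho%:R ^- 2].

Lemma solve_pre_frame cc s s' : frame cc s s' ->
  ~~ has (mem (iwr cc)) (17%N :: envI) ->
  ~~ has (mem (rwr cc)) (25%N :: 26%N :: 33%N :: 23%N :: 24%N :: envR) ->
  solve_pre s -> solve_pre s'.
Proof.
move=> f HI; rewrite 3!(has_consE _ _ _, negb_or).
move=> /andP[r25 /andP[r26 /andP[r33 HR]]] [J E1 E2 E3].
by split; [exact: svrg_pre_frame f HI HR J|rewrite f.2|rewrite f.2|rewrite f.2].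
Qed.

(** The error of [svrg] is relative to its right-hand side. With [e] the error of [u] and
    [m = rho^-2], that side has coordinates [k v + (1 - m) e], where [k = m + (1 - m) g] is a convex
    combination of 1 and [g], hence in [[0, 1]]. *)
Lemma sqn_mix (b u : 'cV[R]_d.+1) :
  sqn (rho%:R ^- 2 *: b + (1 - rho%:R ^- 2) *: u) <= 2 * sqn b + 2 * sqn (u - solU b).
Proof.
rewrite !(sqn_co eig) !mulr_sumr -big_split; apply: ler_sum => i _ /=.
rewrite !(coD, coN, coZ) (co_ofco eig).
have /andP[g0 g1] := ghat01 i.
set v := co nu i b; set y := co nu i u; set g := ghat i in g0 g1 *.
have m0 : 0 <= rho%:R ^- 2 :> R by rewrite invr_ge0 exprn_ge0 // ler0n.
have m1 : rho%:R ^- 2 <= 1 :> R.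
  by rewrite invf_le1 ?exprn_gt0 ?ltr0n // exprn_ege1 // ler1n.
move: (rho%:R ^- 2) m0 m1 => m m0 m1.
set e := y - g * v; pose k := m + (1 - m) * g.
have -> : m * v + (1 - m) * y = k * v + (1 - m) * e by rewrite /k /e; ring.
have k0 : 0 <= k <= 1 by rewrite /k; nra.
have h1 : (k * v + (1 - m) * e) ^+ 2 <= 2 * (k ^+ 2 * v ^+ 2) + 2 * ((1 - m) ^+ 2 * e ^+ 2).
  by have := sqr_ge0 (k * v - (1 - m) * e); nra.
apply: le_trans h1 _; apply: lerD; apply: ler_wpM2l => //.
  by rewrite ler_piMl ?sqr_ge0 // expr_le1 //; case/andP: k0.
by rewrite ler_piMl ?sqr_ge0 // expr_le1 //; lra.
Qed.

Definition svrg_time s : nat := (imem s 15 0).+1 * (epoch_time A T s + 20).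

Lemma epoch_time_frame cc s s' : frame cc s s' -> ~~ has (mem (iwr cc)) envI ->
  epoch_time A T s' = epoch_time A T s.
Proof. by move=> f /hasPn HI; rewrite /epoch_time !f.1 // HI. Qed.

(** The inexact inner solve adds [16 rho^3 2^-E] times the form itself; the condition on [E] makes
    this at most [q = sg / 2]. Half of the contraction [1 - sg] absorbs it and [1 - q] remains. *)
Lemma spec_heavy_step s b E tau : solve_pre s -> vec s 20 = b -> imem s 15 0 = E ->
  64 * rho%:R ^+ 4 * 2^-1 ^+ E <= 1 :> R ->
  ((E + 2) * (epoch_time A T s + 20) <= tau)%N ->
  spec heavy_step s tau solve_pre (lyap_total b)
    ((1 - q) * lyap_total b s + 6 * rho%:R * 2^-1 ^+ E * sqn b).
Proof.
move=> Hs Eb EE small tt; set N := imem s 5 0.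
have NW : (240 * N + 80 <= epoch_time A T s + 20)%N.
  by rewrite /epoch_time -/N; clear; lia.
apply: (@spec_weaken _ _ _ ((60 * N + 20) + (svrg_time s + ((60 * N + 20) + ((60 * N + 20) + (60 * N + 20)))))
   _ solve_pre _ (lyap_total b) _ _ _ _ _ _ _ (lexx _)).
2: by rewrite /svrg_time EE; move: NW tt; set W := (epoch_time A T s + 20)%N; clear; nia.
2: by [].
2: by move=> *; exact: lexx.
have [Is Eth Er1 Er2] := Hs; have [Ev _ _ _] := Is.
set U := vec s 18; set Up := vec s 19.
pose x := rho%:R ^- 2 *: b + (1 - rho%:R ^- 2) *: U.
apply: (spec_dseq (Q1 := fun s1 => [/\ solve_pre s1, vec s1 17 = x, svrg_time s1 = svrg_time s,
   imem s1 5 0 = N & [/\ imem s1 15 0 = E, vec s1 18 = U & vec s1 19 = Up]])).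
  apply: (env_vset Ev) => // s1 f E17; split.
  - by apply: solve_pre_frame f _ _ Hs.
  - by rewrite E17 /= Er1 Er2 Eb.
  - by rewrite /svrg_time (epoch_time_frame f) // f.1.
  - by rewrite f.1.
  - by split; [rewrite f.1|rewrite /colvec f.2|rewrite /colvec f.2].
move=> s1 [Hs1 E17 Es1 EN [EE1 E18 E19]].
apply: (spec_seq (Q1 := fun s2 => [/\ solve_pre s2, imem s2 5 0 = N, vec s2 18 = U & vec s2 19 = Up])
   (Psi1 := fun s2 => 3 * rho%:R * sqn (vec s2 9 - solp lam nu l c' x) + (1 - sg) * lyap_total b s)).
  have [Is1 _ _ _] := Hs1.
  have tts : ((imem s1 15 0).+1 * (epoch_time A T s1 + 20) <= svrg_time s)%N by rewrite -Es1.
  have H := spec_svrg eig lam_le1 lam_half l01 c'_gt0 TE Is1 tts.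
  have al0 : 0 <= 3 * rho%:R :> R by rewrite mulr_ge0 // ler0n.
  have H' := spec_affine ((1 - sg) * lyap_total b s) al0 H.
  apply: (spec_weaken (spec_frame H') (leqnn _)).
  - move=> s2 [_ f]; split; first by apply: solve_pre_frame f _ _ Hs1.
    + by rewrite f.1.
    + by rewrite -E18 /colvec f.2.
    + by rewrite -E19 /colvec f.2.
  - by move=> s2 _; rewrite E17 lexx.
  - rewrite E17 EE1.
    have X1 := sqn_mix b U; rewrite -/x in X1.
    have X2 := lyap_total_ge b s; rewrite -/U in X2.
    have V0 : 0 <= lyap_total b s.
      have r2 : 0 < 8 * rho%:R ^+ 2 / 3 :> R.
        by rewrite divr_gt0 // mulr_gt0 // exprn_gt0 // ltr0n.
      by rewrite -(pmulr_rge0 _ r2); apply: le_trans X2; exact: sqn_ge0.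
    have t0 : 0 <= 2^-1 ^+ E :> R by rewrite exprn_ge0 // invr_ge0.
    have rp : 0 < rho%:R :> R by rewrite ltr0n.
    have Y1 : 3 * rho%:R * (2^-1 ^+ E * sqn x) <=
       3 * rho%:R * (2^-1 ^+ E * (2 * sqn b + 2 * (8 * rho%:R ^+ 2 / 3 * lyap_total b s))).
      rewrite ler_wpM2l // ler_wpM2l //; lra.
    have sgE : sg = 2 * q by rewrite /sg /q; field; rewrite gt_eqF.
    have qE : 4 * rho%:R * q = 1 by rewrite /q; field; rewrite gt_eqF.
    have Y2 : 16 * rho%:R ^+ 3 * 2^-1 ^+ E <= q.
      rewrite -(@ler_pM2l _ (4 * rho%:R)) ?mulr_gt0 // qE.
      by apply: le_trans small; rewrite le_eqVlt; apply/orP; left; apply/eqP; ring.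
    have Y3 := ler_wpM2r V0 Y2.
    apply: le_trans (lerD Y1 (lexx _)) _; rewrite sgE.
    move: Y3; move: (2^-1 ^+ E) (rho%:R : R) (lyap_total b s) (sqn b) => t r v w; lra.
move=> s2 [Hs2 EN2 E18' E19'].
have [Is2 Eth2 _ _] := Hs2; have [Ev2 _ _ _] := Is2.
apply: spec_det.
apply: (dspec_seq (Q1 := fun s3 => [/\ solve_pre s3, imem s3 5 0 = N, vec s3 18 = U, vec s3 19 = Up &
   vec s3 34 = vec s2 9 + th *: (U - Up)])).
  apply: (env_vset Ev2) => // s3 f E34; split.
  - by apply: solve_pre_frame f _ _ Hs2.
  - by rewrite f.1.
  - by rewrite -E18' /colvec f.2.
  - by rewrite -E19' /colvec f.2.
  - by rewrite E34 /= Eth2 E18' E19'.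
move=> s3 [Hs3 EN3 E18'' E19'' E34].
have [[Ev3 _ _ _] _ _ _] := Hs3.
apply: (dspec_seq (Q1 := fun s4 => [/\ solve_pre s4, imem s4 5 0 = N, vec s4 19 = U &
   vec s4 34 = vec s2 9 + th *: (U - Up)])).
  apply: (env_vset Ev3) => // s4 f E19n; split.
  - by apply: solve_pre_frame f _ _ Hs3.
  - by rewrite f.1.
  - by rewrite E19n.
  - by rewrite -E34 /colvec f.2.
move=> s4 [Hs4 EN4 E19n E34'].
have [[Ev4 _ _ _] _ _ _] := Hs4.
apply: (env_vset Ev4) => // s5 f E18n; split; first by apply: solve_pre_frame f _ _ Hs4.
have {}E19n : vec s5 19 = U by rewrite -E19n /colvec f.2.
rewrite {1}/lyap_total E18n /= E34' E19n (sqn_co eig) /lyap_total !mulr_sumr -big_split.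
apply: ler_sum => i _ /=; rewrite -/U -/Up.
set xi := co nu i (vec s2 9 - solp lam nu l c' x).
have -> : co nu i (vec s2 9 + th *: (U - Up) - solU b) =
    (1 + th - shift_ratio i) * co nu i (U - solU b) - th * co nu i (Up - solU b) + xi.
  rewrite /xi /x !(coD, coN, coZ) !(co_ofco eig) !(coD, coN, coZ) /shift_ratio /ghat.
  have D1 : (lam i - l) ^+ 2 + c ^+ 2 != 0.
    by rewrite gt_eqF // ltr_wpDl ?sqr_ge0 // exprn_gt0.
  have D2 : (lam i - l) ^+ 2 + (rho%:R * c) ^+ 2 != 0.
    by rewrite gt_eqF // ltr_wpDl ?sqr_ge0 // exprn_gt0 // c'_gt0.
  have r0 : rho%:R != 0 :> R by rewrite pnatr_eq0 -lt0n.
  rewrite /c'; move: (co nu i _) (co nu i _) (co nu i _) (co nu i _) => u1 u2 u3 u4.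
  by field; rewrite D1 D2 r0.
rewrite [leRHS]addrC; exact: (lyap_step _ _ _ rho_ge1 rho_sg (zz01 i)).
Qed.


(** As [4 rho q = 1], [geom_le] shows that [4 rho] steps halve the form. *)
Lemma half_pow n0 : (1 - q) ^+ (4 * rho * n0) <= 2^-1 ^+ n0 :> R.
Proof.
have rp : 1 <= rho%:R :> R := rho_ge1.
have qE : 4 * rho%:R * q = 1 by rewrite /q; field; rewrite gt_eqF // ltr0n.
have q0 : 0 <= q by rewrite divr_ge0 // mulr_ge0 // ler0n.
have q1 : q <= 1 by nra.
have q01 : 0 <= q <= 1 by rewrite q0.
rewrite exprM; apply: lerXn2r; rewrite ?nnegrE ?exprn_ge0 ?subr_ge0 ?invr_ge0 //.
have := @geom_le _ q (4 * rho) q01; rewrite natrM mulrC [q * _]mulrC qE.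
by move: (_ ^+ _) => g; lra.
Qed.

Lemma spec_solve s b E n0 tau : solve_pre s -> vec s 20 = b -> imem s 15 0 = E ->
  imem s 16 0 = (4 * rho * n0)%N -> 64 * rho%:R ^+ 4 * 2^-1 ^+ E <= 1 :> R ->
  ((4 * rho * n0).+1 * ((E + 3) * (epoch_time A T s + 20)) <= tau)%N ->
  spec solve s tau solve_pre (fun s' => sqn (vec s' 18 - solU b))
    (8 * rho%:R ^+ 2 / 3 * (2^-1 ^+ n0 + 24 * rho%:R ^+ 2 * 2^-1 ^+ E) * sqn b).
Proof.
move=> Hs Eb EE; set H := (4 * rho * n0)%N => EH small tt; set N := imem s 5 0.
set W := epoch_time A T s in tt.
have NW : (240 * N + 80 <= W + 20)%N by rewrite /W /epoch_time -/N; clear; lia.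
have r2 : 0 < 8 * rho%:R ^+ 2 / 3 :> R.
  by rewrite divr_gt0 // mulr_gt0 // exprn_gt0 // ltr0n.
pose t : R := 2^-1 ^+ E.
have t0 : 0 <= t by rewrite exprn_ge0 // invr_ge0.
(* The fixed point of the recurrence of [spec_heavy_step]: its additive term [6 rho t |b|^2] divided
   by [q = 1 / (4 rho)]. *)
pose B := 24 * rho%:R ^+ 2 * t * sqn b.
have B0 : 0 <= B by rewrite !mulr_ge0 ?sqn_ge0 ?exprn_ge0 ?ler0n.
have qE : 4 * rho%:R * q = 1 by rewrite /q; field; rewrite pnatr_eq0 -lt0n.
have q0 : 0 <= q by rewrite divr_ge0 // mulr_ge0 // ler0n.
have q1 : 0 <= 1 - q by have := rho_ge1; nra.
suff HV : spec solve s tau solve_pre (fun s' => lyap_total b s') ((2^-1 ^+ n0 + 24 * rho%:R ^+ 2 * t) * sqn b).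
  apply: (spec_weaken (spec_affine 0 (ltW r2) HV) (leqnn _)) => //.
    by move=> s' _; rewrite addr0; exact: lyap_total_ge.
  by rewrite addr0 mulrA lexx.
apply: (@spec_weaken _ _ _ ((60 * N + 20) + ((60 * N + 20) + (H * ((E + 2) * (W + 20) + 12) + 20)))
   _ solve_pre _ (lyap_total b) _ _ _ _ _ _ _ (lexx _)).
2: by clearbody W; clear -NW tt; clearbody H; nia.
2: by [].
2: by move=> *; exact: lexx.
pose K s1 := [/\ solve_pre s1, vec s1 20 = b, imem s1 15 0 = E, imem s1 16 0 = H &
  imem s1 5 0 = N /\ epoch_time A T s1 = W].
have KF cc s1 s' : frame cc s1 s' ->
    ~~ has (mem (iwr cc)) (15%N :: 16%N :: 17%N :: envI) ->
    ~~ has (mem (rwr cc)) (20%N :: 25%N :: 26%N :: 33%N :: 23%N :: 24%N :: envR) -> K s1 -> K s'.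
  move=> f; rewrite 2!(has_consE _ _ _, negb_or) => /andP[n15 /andP[n16 HI17]].
  rewrite has_consE negb_or => /andP[r20 HR] [J1 J2 J3 J4 [J5 J6]].
  have HI : ~~ has (mem (iwr cc)) envI by move: HI17; rewrite has_consE negb_or => /andP[].
  split.
  - exact: solve_pre_frame f HI17 HR J1.
  - by rewrite /colvec f.2.
  - by rewrite f.1.
  - by rewrite f.1.
  - by rewrite (epoch_time_frame f) //; move/hasPn: HI => HI; rewrite f.1 // HI.
have K0 : K s by [].
have KE s1 : K s1 -> env A l s1 by case=> -[[]].
have KN s1 : K s1 -> imem s1 5 0 = N by case=> _ _ _ _ [].
apply: (spec_dseq (Q1 := fun s1 => K s1 /\ vec s1 18 = 0)).
  apply: (env_vset (KE _ K0) (KN _ K0)) => // s1 f E18; split; last by rewrite E18 /= subrr.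
  by apply: (KF _ _ _ f).
move=> s1 [K1 E18].
apply: (spec_dseq (Q1 := fun s1 => [/\ K s1, vec s1 18 = 0 & vec s1 19 = 0])).
  apply: (env_vset (KE _ K1) (KN _ K1)) => // s2 f E19; split; last by rewrite E19 /= subrr.
    by apply: (KF _ _ _ f).
  by rewrite -E18 /colvec f.2.
move=> s2 {s1 K1 E18} [K2 E18 E19].
have tti : ((H - 0) * ((E + 2) * (W + 20) + icost (iv 16) + 10) + icost (INum 0) +
     icost (iv 16) + 6 <= H * ((E + 2) * (W + 20) + 12) + 20)%N.
  by rewrite subn0 /=; clear; nia.
pose Psi k s1 := (1 - q) ^+ (H - k) * (lyap_total b s1 - B) + B.
apply: (@spec_weaken _ _ _ (H * ((E + 2) * (W + 20) + 12) + 20) _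
    (fun s' => K s' /\ imem s' 20 0 = H) _ (Psi H) _ ((2^-1 ^+ n0 + 24 * rho%:R ^+ 2 * t) * sqn b)
   _ _ (leqnn _)).
- apply: (@spec_for _ _ _ _ _ 0%N H ((E + 2) * (W + 20)) (H * ((E + 2) * (W + 20) + 12) + 20) (fun=> K) Psi) => //.
  + by move=> k s1 _ [_ _ _ J _] _; exact: J.
  + rewrite /Psi subn0; set g := (1 - q) ^+ H.
    have g0 : 0 <= g by rewrite exprn_ge0.
    have gh : g <= 2^-1 ^+ n0 by exact: half_pow.
    have V2 : lyap_total b (seti 20 0 s2) <= sqn b.
      have -> : lyap_total b (seti 20 0 s2) = lyap_total b s2 by [].
      rewrite /lyap_total E18 E19 (sqn_co eig); apply: ler_sum => i _.
      rewrite !sub0r !coN (co_ofco eig); have /andP[h0 h1] := ghat01 i.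
      have /andP[_ z1] := zz01 i.
      have z0 : 0 <= shift_ratio i.
        have /andP[z0 _] := zz01 i; apply: le_trans z0.
        by rewrite invr_ge0 exprn_ge0 // ler0n.
      (* Both iterates start at zero, so the two errors coincide and the form reduces to [z e^2]. *)
      move: (co nu i b) => v; rewrite /lyap.
      have -> : (- (ghat i * v)) ^+ 2 - (1 + th - shift_ratio i) * - (ghat i * v) * - (ghat i * v) +
         th * (- (ghat i * v)) ^+ 2 = shift_ratio i * (ghat i * ghat i) * v ^+ 2 by ring.
      rewrite ler_piMl ?sqr_ge0 //; apply: mulr_ile1 => //; first exact: mulr_ge0.
      exact: mulr_ile1.
    have X1 := ler_wpM2l g0 V2; have X2 := ler_wpM2r (sqn_ge0 b) gh.
    have X3 := mulr_ge0 g0 B0.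
    rewrite mulrDl -/B; lra.
  + move=> k s1 /andP[_ kH] K1 ik.
    have al0 : 0 <= (1 - q) ^+ (H - k.+1) by rewrite exprn_ge0.
    have [J1 J2 J3 J4 [J5 J6]] := K1.
    have tts : ((E + 2) * (epoch_time A T s1 + 20) <= (E + 2) * (W + 20))%N by rewrite J6.
    have HH := spec_affine (B - (1 - q) ^+ (H - k.+1) * B) al0 (spec_heavy_step J1 J2 J3 small tts).
    apply: (spec_weaken (spec_frame HH) (leqnn _)).
    * move=> s3 [J7 f]; apply: (KF _ _ _ (frame_seti 20 k.+1 s3)) => //.
      by apply: (KF _ _ _ f).
    * move=> s3 _; rewrite /Psi; have -> : lyap_total b (seti 20 k.+1 s3) = lyap_total b s3 by [].
      by rewrite mulrBr addrA (addrAC (_ * _)) lexx.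
    * rewrite /Psi; have -> : (H - k = (H - k.+1).+1)%N by rewrite subnSK.
      rewrite exprSr; set g := (1 - q) ^+ _.
      have -> : 6 * rho%:R * 2^-1 ^+ E * sqn b = q * B.
        rewrite /B -/t; have -> : q * (24 * rho%:R ^+ 2 * t * sqn b) =
          (4 * rho%:R * q) * (6 * rho%:R * t * sqn b) by ring.
        by rewrite qE mul1r.
      by rewrite le_eqVlt; apply/orP; left; apply/eqP; ring.
- by move=> s' [[]].
- by move=> s' _; rewrite /Psi subnn expr0 mul1r subrK.
- exact: lexx.
Qed.

End Heavy.

(** * The inverse square root series *)

Section Series.
Variable R : realType.

(** Taylor coefficients of [(1 - u)^(-1/2)]. *)
Fixpoint binc (k : nat) : R :=
  if k is k'.+1 then binc k' * ((k' + k' + 1)%:R / (k' + k' + 2)%:R) else 1.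

Definition bser (K : nat) (u : R) : R := \sum_(0 <= k < K.+1) binc k * u ^+ k.

Lemma binc01 k : 0 < binc k <= 1.
Proof.
elim: k => [|k /andP[IH0 IH1]] /=; first by rewrite ltr01 lexx.
have h : 0 < (k + k + 1)%:R / (k + k + 2)%:R :> R by rewrite divr_gt0 // ltr0n; lia.
rewrite mulr_gt0 //=; apply: (mulr_ile1 (ltW IH0) (ltW h) IH1).
by rewrite ler_pdivrMr ?mul1r ?ler_nat ?ltr0n; lia.
Qed.

Lemma bincS k : (k.+1)%:R * binc k.+1 = (k%:R + 2^-1) * binc k.
Proof.
rewrite /= -[(k.+1)%:R]natr1 !natrD; field.
by rewrite gt_eqF // -natr1; have : 0 <= k%:R :> R by rewrite ler0n.
Qed.

Let P K : {poly R} := \poly_(k < K.+1) binc k.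

Lemma bserE K u : bser K u = (P K).[u].
Proof. by rewrite /bser big_mkord horner_poly. Qed.

(** The function [(1 - u)^(-1/2)] satisfies [(1 - u) f' = f / 2]; truncating its series spoils this
    in the top degree only. *)
Lemma bser_ode K : (1 - 'X) * (P K)^`() =
  2^-1 *: P K - ((K%:R + 2^-1) * binc K) *: 'X^K.
Proof.
apply/polyP => k; rewrite mulrBl mul1r coefB coefXM coef_deriv coefB !coefZ coefXn.
have -> : (if k == 0%N then 0 else (P K)^`()`_k.-1) = k%:R * (P K)`_k.
  by case: k => [|k] /=; rewrite ?mul0r // coef_deriv mulr_natl.
rewrite -(mulr_natl (P K)`_k.+1) !coef_poly !ltnS.
case: (ltngtP k K) => [kK|kK|->].
- by rewrite bincS mulr0; field.
- by rewrite !mulr0 subrr.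
- by rewrite mulr1 mulr0 sub0r; ring.
Qed.

(** By [bser_ode] the polynomial [Q = (1 - X) P^2] has derivative [- (2 K + 1) binc K X^K P]. So
    apart from its constant term 1 it starts in degree [K + 1] and has coefficients at most 0. These
    sum to [-1] because [Q] vanishes at 1, and on [[0, 1]] each power is at most [u^(K+1)], so the
    nonconstant part lies between [- u^(K+1)] and 0. *)
Lemma bser_bounds K u : 0 <= u <= 1 -> 1 - u ^+ K.+1 <= (1 - u) * bser K u ^+ 2 <= 1.
Proof.
case/andP=> u0 u1; pose Q := (1 - 'X) * P K ^+ 2.
have QE x : Q.[x] = (1 - x) * bser K x ^+ 2 by rewrite /Q bserE !hornerE.
have dQ : Q^`() = (- ((K + K + 1)%:R * binc K)) *: ('X^K * P K).
  rewrite /Q derivM derivB derivC derivX sub0r expr2 derivM.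
  have -> : - 1 * (P K * P K) + (1 - 'X) * ((P K)^`() * P K + P K * (P K)^`()) =
    - (P K * P K) + (2 *: P K) * ((1 - 'X) * (P K)^`()).
    by rewrite -!mul_polyC; ring.
  rewrite bser_ode -!mul_polyC natrD natrD mulr1n.
  have h : 2 * (2^-1)%:P = 1 :> {poly R} by rewrite mulr_natl -polyCMn -[_ *+ 2]mulr_natl mulfV ?pnatr_eq0.
  rewrite !(polyCN, polyCM, polyCD) polyC1.
  move: (2^-1)%:P h (K%:R)%:P (binc K)%:P 'X^K (P K) => hi h k b x p.
  apply: subr0_eq; transitivity ((2 * hi - 1) * (p * p - b * x * p)); first by ring.
  by rewrite h subrr mul0r.
have Q0 : Q`_0 = 1.
  by rewrite -horner_coef0 QE subr0 mul1r bserE horner_coef0 coef_poly /= expr1n.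
have Qc i : (i.+1)%:R * Q`_i.+1 = - ((K + K + 1)%:R * binc K) * (if (i < K)%N then 0 else (P K)`_(i - K)).
  by rewrite mulr_natl -coef_deriv dQ coefZ coefXnM.
have Qz i : (0 < i <= K)%N -> Q`_i = 0.
  case: i => // i /andP[_ iK]; apply/eqP; move: (Qc i); rewrite iK mulr0 => /eqP.
  by rewrite mulf_eq0 pnatr_eq0.
have Qn i : (0 < i)%N -> Q`_i <= 0.
  case: i => // i _; rewrite -(@pmulr_rle0 _ (i.+1)%:R) ?ltr0n // Qc mulNr oppr_le0.
  have /andP[b0 _] := binc01 K; rewrite mulr_ge0 //; first by rewrite mulr_ge0 ?ler0n // ltW.
  case: ifP => // _; rewrite coef_poly; case: ifP => // _.
  by have /andP[/ltW] := binc01 (i - K).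
pose m := size Q.
have hw x : Q.[x] = 1 + \sum_(1 <= i < m.+1) Q`_i * x ^+ i.
  by rewrite (horner_coef_wide _ (leqnSn m)) -(big_mkord xpredT (fun i => Q`_i * x ^+ i))
     big_nat_recl // -Q0 expr0 mulr1 big_add1.
have S1 : \sum_(1 <= i < m.+1) Q`_i = -1.
  have := hw 1; rewrite QE subrr mul0r; under eq_bigr => i _ do rewrite expr1n mulr1.
  by move=> /esym/eqP; rewrite addrC addr_eq0 => /eqP.
rewrite -QE hw; apply/andP; split.
  rewrite lerD2l; have -> : - u ^+ K.+1 = \sum_(1 <= i < m.+1) Q`_i * u ^+ K.+1.
    by rewrite -mulr_suml S1 mulN1r.
  rewrite big_nat_cond [leRHS]big_nat_cond; apply: ler_sum => i /andP[/andP[i1 _] _].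
  have [iK|Ki] := leqP i K; first by rewrite Qz ?mul0r // i1.
  rewrite -subr_ge0 -mulrBr mulr_le0 ?Qn // subr_le0.
  exact: ler_wiXn2l.
rewrite gerDl big_nat_cond; apply: sumr_le0 => i /andP[/andP[i1 _] _].
by rewrite mulr_le0_ge0 ?Qn // exprn_ge0.
Qed.

Lemma bser_ge1 K u : 0 <= u -> 1 <= bser K u.
Proof.
move=> u0; rewrite /bser big_nat_recl // expr0 mulr1 lerDl.
apply: sumr_ge0 => i _; rewrite mulr_ge0 ?exprn_ge0 //.
by have /andP[/ltW] := binc01 i.+1.
Qed.

Lemma bser_le K u : 0 <= u <= 1 -> bser K u <= K.+1%:R.
Proof.
case/andP=> u0 u1; apply: (@le_trans _ _ (\sum_(0 <= k < K.+1) 1)).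
  apply: ler_sum => k _; have /andP[/ltW b0 b1] := binc01 k.
  by apply: mulr_ile1; rewrite ?exprn_ge0 // exprn_ile1.
by rewrite sumr_const_nat subn0.
Qed.

End Series.

(** * Rungs *)

Definition iset0 a e := ISet a (INum 0) e.
Definition rnum k := RNat (INum k).

Definition set_rho : cmd :=
  rset0 23 (rv 22) ;;
  rset0 32 (rnum 1) ;;
  iset0 16 (IAdd (IAdd (iv 15) (iv 15)) (IAdd (iv 15) (iv 15))) ;;
  While (BLtr (RMul (RNat (IGet 0 (INum 2))) (RMul (rv 23) (rv 23)))
              (RMul (RNat (IGet 0 (INum 1))) (rv 5)))
    (rset0 23 (RAdd (rv 23) (rv 23)) ;;
     rset0 32 (RAdd (rv 32) (rv 32)) ;;
     iset0 16 (IAdd (iv 16) (iv 16))).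

Definition set_par : cmd :=
  rset0 26 (RDiv (rnum 1) (RMul (rv 32) (rv 32))) ;;
  rset0 33 (RSub (rnum 1) (rv 26)) ;;
  rset0 25 (RSub (rnum 1) (RDiv (rnum 1) (RMul (rnum 2) (rv 32)))) ;;
  rset0 25 (RMul (rv 25) (rv 25)) ;;
  rset0 24 (RDiv (rv 23) (RMul (rnum 16) (RAdd (rv 5) (RMul (rv 23) (rv 23))))).

(** The machine cannot round a real to an integer, so [T] is found by counting up; this takes time
    [O(T)], which a single epoch costs anyway. *)
Definition set_T : cmd :=
  iset0 17 (INum 0) ;;
  While (BLtr (RMul (RNat (iv 17)) (RMul (rv 23) (rv 23)))
              (RMul (rnum 24) (RAdd (rv 5) (RMul (rv 23) (rv 23)))))
    (iset0 17 (IAdd (iv 17) (INum 1))).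

Definition series_step : cmd :=
  solve ;;
  vset 11 20 (VMul 27 (VV 18)) ;;
  rset0 28 (RMul (rv 28) (RDiv (RNat (IAdd (IAdd (iv 21) (iv 21)) (INum 1)))
                              (RNat (IAdd (IAdd (iv 21) (iv 21)) (INum 2))))) ;;
  vset 11 21 (VAdd (VV 21) (VMul 28 (VV 20))).

(** Replaces real array 20 by [sum_(k <= K) binc k (phi G)^k] of it, where
    [G = c^2 (X^2 + c^2)^-1]; [c] and [phi] are in cells 22 and 27. *)
Definition rung : cmd :=
  set_rho ;;
  set_par ;;
  set_T ;;
  rset0 28 (rnum 1) ;;
  vset 11 21 (VV 20) ;;
  For 21 (INum 0) (iv 14) series_step ;;
  vset 11 20 (VV 21).

(** * Loops that stop on a comparison *)

Section While.
Variable R : realType.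
Implicit Types (s : state R).

Lemma dspec_while_n b c s (N tau : nat) (Inv : nat -> state R -> Prop) :
  (forall k s1, (k < N)%N -> Inv k s1 -> beval s1 b /\ dspec c s1 tau (Inv k.+1)) ->
  (forall s1, Inv N s1 -> ~~ beval s1 b) -> Inv 0%N s ->
  dspec (While b c) s (N * (tau + bcost b + 1) + bcost b + 1) (Inv N).
Proof.
move=> step stop I0.
suff H k s1 : (k <= N)%N -> Inv k s1 ->
    dspec (While b c) s1 ((N - k) * (tau + bcost b + 1) + bcost b + 1) (Inv N).
  by have := H 0%N s (leq0n N) I0; rewrite subn0.
have [j] := ubnP (N - k); elim: j k s1 => // j IH k {I0}s jk kN Ik.
have [E|ltk] := eqVneq k N.
  exists s, (bcost b).+1; split; first by rewrite E subnn; clear; lia.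
    by move=> w; apply: ExecWhileEnd; apply: stop; rewrite -E.
  by rewrite -E.
have {}ltk : (k < N)%N by rewrite ltn_neqAle ltk.
have [bs [s2 [t2 [tt2 E2 I2]]]] := step _ _ ltk Ik.
have [|s3 [t3 [tt3 E3 Q3]]] := IH k.+1 s2 _ ltk I2; first by clear -jk ltk; lia.
exists s3, (bcost b + t2 + t3).+1; split=> //; last first.
  by move=> w; apply: ExecWhileStep (E2 w) (E3 w).
have -> : (N - k = (N - k.+1).+1)%N by rewrite subnSK.
by rewrite mulSn; clear -tt2 tt3; move: tt2 tt3; move: (_ * _)%N => X; lia.
Qed.

Lemma first_nat (g : nat -> bool) : (exists N, ~~ g N) ->
  exists N, ~~ g N /\ forall k, (k < N)%N -> g k.
Proof.
move=> ex; have [N gN minN] := ex_minnP ex; exists N; split=> // k kN.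
by apply: contraLR kN => /minN; rewrite -leqNgt.
Qed.

Lemma exists_pow2 (x y : R) : 0 < y -> exists m, x <= y * (2 ^ m)%:R.
Proof.
move=> y0; exists (Num.bound `|x / y|).
rewrite -ler_pdivrMl // mulrC; apply: le_trans (ler_norm _) _.
apply: le_trans (ltW (archi_boundP (normr_ge0 _))) _.
by rewrite ler_nat ltnW // ltn_expl.
Qed.

End While.

Section Setup.
Variables (R : realType) (n d : nat) (A : 'M[R]_(n, d.+1)).
Variable l : R.
Implicit Types (s : state R).

(** [rho] is the least power of two with [d F <= nnz (rho c)^2], where
    [F = |A|_F^2]. *)
Lemma dspec_set_rho s c Q rhoM :
  env A l s -> rmem s 22 0 = c -> 0 < c -> imem s 15 0 = Q -> (0 < nnz A)%N ->
  (0 < rhoM)%N ->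
  (forall m, (nnz A)%:R * (c * (2 ^ m)%:R) ^+ 2 < d.+1%:R * frob A ->
     (2 ^ m.+1 <= rhoM)%N) ->
  dspec set_rho s (60 * rhoM + 60) (fun s' => exists rho : nat,
    [/\ (0 < rho <= rhoM)%N, rmem s' 23 0 = rho%:R * c, rmem s' 32 0 = rho%:R,
        imem s' 16 0 = (4 * rho * Q)%N &
        d.+1%:R * frob A <= (nnz A)%:R * (rho%:R * c) ^+ 2]).
Proof.
move=> [[E0 E0' _ _ _] _ _ EF _] Ec c0 EQ nz rM0 cap.
pose g m := (nnz A)%:R * (c * (2 ^ m)%:R) ^+ 2 < d.+1%:R * frob A.
have [m [gm gk]] : exists N, ~~ g N /\ forall k, (k < N)%N -> g k.
  apply: first_nat; have nz0 : 0 < (nnz A)%:R * c ^+ 2 :> R.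
    by rewrite mulr_gt0 ?ltr0n // exprn_gt0.
  have [m Hm] := exists_pow2 (d.+1%:R * frob A) nz0.
  exists m; rewrite /g -leNgt; apply: le_trans Hm _.
  have -> : (nnz A)%:R * (c * (2 ^ m)%:R) ^+ 2 =
    (nnz A)%:R * c ^+ 2 * ((2 ^ m)%:R * (2 ^ m)%:R) :> R by ring.
  by rewrite ler_pM2l // ler_peMl ?ler0n // ler1n expn_gt0.
have mM : (2 ^ m <= rhoM)%N by case: (m) gk => [|m'] gk //; apply: cap; apply: gk.
pose I0 s1 := imem s1 0 = imem s 0 /\ rmem s1 5 = rmem s 5.
pose Inv k s1 := [/\ I0 s1, rmem s1 23 0 = (2 ^ k)%:R * c, rmem s1 32 0 = (2 ^ k)%:R &
   imem s1 16 0 = (4 * 2 ^ k * Q)%N].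
have mlt : (m < 2 ^ m)%N by rewrite ltn_expl.
apply: (@dspec_weaken _ _ _ (4 + (4 + (13 + (m * (21 + 16 + 1) + 16 + 1)))) _ (Inv m)).
- apply: (dspec_seq (Q1 := fun s1 => [/\ I0 s1, imem s1 15 0 = Q & rmem s1 23 0 = c])).
    by apply: dspec_rset => //=; split=> //; rewrite /upd /= Ec.
  move=> s1 [[J1 J2] J3 J4].
  apply: (dspec_seq (Q1 := fun s1 => [/\ I0 s1, imem s1 15 0 = Q, rmem s1 23 0 = c & rmem s1 32 0 = 1])).
    by apply: dspec_rset => //=; split.
  move=> s2 {s1 J1 J2 J3 J4} [[J1 J2] J3 J4 J5].
  apply: (dspec_seq (Q1 := Inv 0%N)).
    apply: dspec_iset => //=; split=> //=; rewrite ?J4 ?mul1r //.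
    by rewrite /upd /= J3; clear; lia.
  move=> s3 I3; apply: (dspec_while_n (tau := 21)) I3; last first.
    move=> s4 [[K1 K2] K3 K4 K5]; rewrite /= K1 K2 K3 E0 E0' EF.
    by rewrite -expr2 [_ * c]mulrC; exact: gm.
  move=> k s4 km [[K1 K2] K3 K4 K5]; split.
    by rewrite /= K1 K2 K3 E0 E0' EF -expr2 [_ * c]mulrC; exact: gk.
  apply: (@dspec_weaken _ _ _ (7 + (7 + 7)) 21 (Inv k.+1)) => //.
  have p2 : (2 ^ k.+1)%:R = (2 ^ k)%:R + (2 ^ k)%:R :> R by rewrite expnS mul2n -addnn natrD.
  apply: (dspec_seq (Q1 := fun s5 => [/\ I0 s5, rmem s5 23 0 = (2 ^ k.+1)%:R * c,
     rmem s5 32 0 = (2 ^ k)%:R & imem s5 16 0 = (4 * 2 ^ k * Q)%N])).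
    by apply: dspec_rset => //=; split=> //; rewrite /upd /= K3 p2 mulrDl.
  move=> s5 {K1 K2 K3 K4 K5} [[K1 K2] K3 K4 K5].
  apply: (dspec_seq (Q1 := fun s5 => [/\ I0 s5, rmem s5 23 0 = (2 ^ k.+1)%:R * c,
     rmem s5 32 0 = (2 ^ k.+1)%:R & imem s5 16 0 = (4 * 2 ^ k * Q)%N])).
    by apply: dspec_rset => //=; split=> //; rewrite /upd /= K4 p2.
  move=> s6 {K1 K2 K3 K4 K5} [[K1 K2] K3 K4 K5].
  apply: dspec_iset => //=; split=> //=.
  by rewrite /upd /= K5 expnS; clear; lia.
- by clear -mM mlt; lia.
- move=> s' [_ K3 K4 K5]; exists (2 ^ m)%N; split=> //; first by rewrite expn_gt0.
  by rewrite [_ * c]mulrC leNgt; exact: gm.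
Qed.

Lemma dspec_set_par s c rho :
  rmem s 5 0 = frob A -> rmem s 23 0 = rho%:R * c -> rmem s 32 0 = rho%:R ->
  dspec set_par s 60 (fun s' =>
    [/\ rmem s' 24 0 = rho%:R * c / (16 * (frob A + (rho%:R * c) ^+ 2)),
        rmem s' 25 0 = (1 - 1 / (2 * rho%:R)) ^+ 2, rmem s' 26 0 = rho%:R ^- 2 &
        rmem s' 33 0 = 1 - rho%:R ^- 2]).
Proof.
move=> EF E23 E32.
apply: (@dspec_weaken _ _ _ (10 + (7 + (13 + (7 + 18)))) _ _ _ _ _ (fun s' h => h)) => //.
pose J s1 := [/\ rmem s1 5 0 = frob A, rmem s1 23 0 = rho%:R * c & rmem s1 32 0 = rho%:R].
apply: (dspec_seq (Q1 := fun s1 => J s1 /\ rmem s1 26 0 = rho%:R ^- 2)).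
  by apply: dspec_rset => //=; split=> //; rewrite /upd /= E32 div1r -expr2.
move=> s1 {EF E23 E32} [[EF E23 E32] E26].
apply: (dspec_seq (Q1 := fun s1 => [/\ J s1, rmem s1 26 0 = rho%:R ^- 2 &
    rmem s1 33 0 = 1 - rho%:R ^- 2])).
  by apply: dspec_rset => //=; split=> //; rewrite /upd /= E26.
move=> s2 {s1 EF E23 E32 E26} [[EF E23 E32] E26 E33].
apply: (dspec_seq (Q1 := fun s1 => [/\ J s1, rmem s1 26 0 = rho%:R ^- 2,
    rmem s1 33 0 = 1 - rho%:R ^- 2 & rmem s1 25 0 = 1 - 1 / (2 * rho%:R)])).
  by apply: dspec_rset => //=; split=> //; rewrite /upd /= E32.
move=> s3 {s2 EF E23 E32 E26 E33} [[EF E23 E32] E26 E33 E25].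
apply: (dspec_seq (Q1 := fun s1 => [/\ J s1, rmem s1 26 0 = rho%:R ^- 2,
    rmem s1 33 0 = 1 - rho%:R ^- 2 & rmem s1 25 0 = (1 - 1 / (2 * rho%:R)) ^+ 2])).
  by apply: dspec_rset => //=; split=> //; rewrite /upd /= E25 expr2.
move=> s4 {s3 EF E23 E32 E26 E33 E25} [[EF E23 E32] E26 E33 E25].
by apply: dspec_rset => //=; split=> //; rewrite /upd /= E23 EF expr2.
Qed.

Lemma dspec_set_T s (c F : R) TM : 0 < c -> rmem s 23 0 = c -> rmem s 5 0 = F ->
  (forall T, (forall k, (k < T)%N -> k%:R * c ^+ 2 < 24 * (F + c ^+ 2)) -> (T <= TM)%N) ->
  dspec set_T s (40 * TM + 40) (fun s' => exists T : nat,
    [/\ imem s' 17 0 = T, 24 * (F + c ^+ 2) <= T%:R * c ^+ 2 &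
     forall k, (k < T)%N -> k%:R * c ^+ 2 < 24 * (F + c ^+ 2)]).
Proof.
move=> c0 Ec EF cap.
pose g k := k%:R * c ^+ 2 < 24 * (F + c ^+ 2).
have c2 : 0 < c ^+ 2 by rewrite exprn_gt0.
have [T [gT gk]] : exists N, ~~ g N /\ forall k, (k < N)%N -> g k.
  apply: first_nat; have [m Hm] := exists_pow2 (24 * (F + c ^+ 2)) c2.
  by exists (2 ^ m)%N; rewrite /g -leNgt [_ * c ^+ 2]mulrC.
have TTM := cap _ gk.
pose Inv k s1 := [/\ rmem s1 23 0 = c, rmem s1 5 0 = F & imem s1 17 0 = k].
apply: (@dspec_weaken _ _ _ (5 + (T * (10 + 21 + 1) + 21 + 1)) _ (Inv T)).
- apply: (dspec_seq (Q1 := Inv 0%N)).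
    by apply: dspec_iset => //=; split.
  move=> s1 I1; apply: (dspec_while_n (tau := 10)) I1; last first.
    by move=> s2 [J1 J2 J3]; rewrite /= J1 J2 J3 -expr2.
  move=> k s2 kT [J1 J2 J3]; split; first by rewrite /= J1 J2 J3 -expr2; exact: gk.
  apply: dspec_iset => //=; split=> //=.
  by rewrite /upd /= J3 addn1.
- by clear -TTM; lia.
- by move=> s' [_ _ E]; exists T; split=> //; rewrite leNgt.
Qed.

End Setup.

(** * Error and time of one rung *)

Section Rung.
Variables (R : realType) (n d : nat) (A : 'M[R]_(n, d.+1)).
Variables (lam : 'I_d.+1 -> R) (nu : 'I_d.+1 -> 'cV[R]_d.+1).
Hypothesis eig : eigen_decomposition A lam nu.
Hypothesis lam_le1 : lam ord0 <= 1.
Hypothesis lam_half : 2^-1 <= lam ord0.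
Variable l : R.
Hypothesis l01 : 0 < l < 1.
Implicit Types (s : state R).
Notation cl := (colseq A).
Notation vec := (colvec d.+1 cl).
Variables (N ell K Q rhoM WM : nat).

Definition base s : Prop :=
  [/\ env A l s, imem s 5 0 = N, imem s 8 0 = ell, imem s 14 0 = K & imem s 15 0 = Q].

Lemma base_frame cc s s' : frame cc s s' ->
  ~~ has (mem (iwr cc)) (14%N :: 15%N :: envI) -> ~~ has (mem (rwr cc)) envR ->
  base s -> base s'.
Proof.
move=> f; rewrite has_consE negb_or has_consE negb_or => /and3P[i14 i15 HI] HR.
have HI' := hasPn HI.
by case=> E EN El EK EQ; split; [exact: env_frame f HI HR E|rewrite f.1 // HI'|rewrite f.1 // HI'|rewrite f.1|rewrite f.1].
Qed.

Lemma base_env s : base s -> env A l s. Proof. by case. Qed.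
Lemma base_N s : base s -> imem s 5 0 = N. Proof. by case. Qed.

(** [rhoM] and [WM] bound the preconditioner ratio and the cost of an epoch. *)
Definition capR (c : R) : Prop :=
  forall m, (nnz A)%:R * (c * (2 ^ m)%:R) ^+ 2 < d.+1%:R * frob A ->
    (2 ^ m.+1 <= rhoM)%N.

Definition capW (c : R) : Prop :=
  forall rho T : nat, (0 < rho)%N -> d.+1%:R * frob A <= (nnz A)%:R * (rho%:R * c) ^+ 2 ->
    (forall k, (k < T)%N -> k%:R * (rho%:R * c) ^+ 2 < 24 * (frob A + (rho%:R * c) ^+ 2)) ->
    (400 * nnz A + 400 * N + T * (420 * (N + ell + 1)) + 420 <= WM)%N.

(** Relative mean square error of a solve, from [spec_solve] with both exponents equal to [Q] and
    [rho] at its upper bound [rhoM]. *)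
Definition tau1 : R := 8 * rhoM%:R ^+ 2 / 3 * (25 * rhoM%:R ^+ 2 * 2^-1 ^+ Q).
Hypothesis small : 64 * rhoM%:R ^+ 4 * 2^-1 ^+ Q <= 1 :> R.
Hypothesis tau1_le : tau1 <= 1 / 6.
Hypothesis nz : (0 < nnz A)%N.
Hypothesis rM0 : (0 < rhoM)%N.

Definition solve_time : nat := ((4 * rhoM * Q).+1 * ((Q + 3) * WM))%N.
Definition rung_time : nat := (60 * rhoM + 50 * WM + K * (solve_time + 2 * WM))%N.

Section OneRung.
Variables (c phi : R).
Hypothesis c0 : 0 < c.
Hypothesis phi01 : 0 <= phi <= 1.
Hypothesis cR : capR c.
Hypothesis cW : capW c.

Let u i := phi * ghat lam l c i.

Lemma u01 i : 0 <= u i <= 1.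
Proof.
have /andP[p0 p1] := phi01; have /andP[g0 g1] := ghat01 lam l c0 i.
by rewrite /u mulr_ge0 // mulr_ile1.
Qed.

Definition rungop (B : 'cV[R]_d.+1) := ofco nu (fun i => bser K (u i) * co nu i B).
Definition damp_pow k (B : 'cV[R]_d.+1) := ofco nu (fun i => u i ^+ k * co nu i B).
Definition series_part k (B : 'cV[R]_d.+1) := ofco nu (fun i => bser k (u i) * co nu i B).

Lemma sqn_ofco_le (f : 'I_d.+1 -> R) (b : R) x : 0 <= b -> (forall i, 0 <= f i <= b) ->
  sqn (ofco nu (fun i => f i * co nu i x)) <= b ^+ 2 * sqn x.
Proof.
move=> b0 fb; rewrite !(sqn_co eig) mulr_sumr; apply: ler_sum => i _.
rewrite (co_ofco eig) exprMn ler_wpM2r ?sqr_ge0 //.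
by have /andP[f0 f1] := fb i; rewrite lerXn2r ?nnegrE.
Qed.

Lemma sqn_pw k B : sqn (damp_pow k B) <= sqn B.
Proof.
have := @sqn_ofco_le (fun i => u i ^+ k) 1 B ler01; rewrite expr1n mul1r; apply=> i.
by have /andP[u0 u1] := u01 i; rewrite exprn_ge0 // exprn_ile1.
Qed.

(** The doubling inequality [sqnD_le] is used twice. The new power has error at most [2 xi + 2 e],
    with [xi] the solver's error and [e] that of the old power; the new partial sum has twice the
    old error plus twice that of the new power. Together the new power is counted three times, which
    gives the 6. *)
Lemma series_det (w e1 e2 w' : 'cV[R]_d.+1) k B (bk : R) : 0 <= bk <= 1 -> bk = binc R k.+1 ->
  let t' := phi *: w in
  sqn (t' - damp_pow k.+1 B) + sqn (e2 + bk *: t' - series_part k.+1 B) <=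
  6 * sqn (w - solU lam nu l c e1) + (2 * sqn (e2 - series_part k B) + 6 * sqn (e1 - damp_pow k B)).
Proof.
move=> bk01 bkE; cbv zeta; set xi := w - solU lam nu l c e1.
have /andP[p0 p1] := phi01; have /andP[b0 b1] := bk01.
set z := phi *: w - damp_pow k.+1 B.
have zE : z = phi *: xi + ofco nu (fun i => u i * co nu i (e1 - damp_pow k B)).
  apply: (co_inj eig) => i; rewrite /z /xi !(coD, coN, coZ) !(co_ofco eig) !(coD, coN, coZ) !(co_ofco eig).
  by rewrite /u exprS; ring.
have z2 : sqn z <= 2 * sqn xi + 2 * sqn (e1 - damp_pow k B).
  rewrite zE; apply: le_trans (sqnD_le _ _) _; apply: lerD; apply: ler_wpM2l => //.
    by rewrite sqnZ ler_piMl ?sqn_ge0 // expr_le1.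
  have := @sqn_ofco_le u 1 (e1 - damp_pow k B) ler01 u01; by rewrite expr1n mul1r.
have aE : e2 + bk *: (phi *: w) - series_part k.+1 B = (e2 - series_part k B) + bk *: z.
  rewrite /z; apply: (co_inj eig) => i; rewrite !(coD, coN, coZ) !(co_ofco eig).
  by rewrite /bser [in LHS]big_nat_recr //= -/(binc R k.+1) -bkE; ring.
have a2 : sqn (e2 + bk *: (phi *: w) - series_part k.+1 B) <= 2 * sqn (e2 - series_part k B) + 2 * sqn z.
  rewrite aE; apply: le_trans (sqnD_le _ _) _; rewrite lerD2l; apply: ler_wpM2l => //.
  by rewrite sqnZ ler_piMl ?sqn_ge0 // expr_le1.
lra.
Qed.

(** A noise floor that is added to the error to make the recurrence homogeneous: the solver's noise
    is at most [6 tau1 (2 e + 2 |B|^2)], where [tau1 <= 1/6] leaves [2 e + 6 delta0], and a single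
    factor 8 then covers all terms. *)
Definition delta0 (B : 'cV[R]_d.+1) : R := 2 * tau1 * sqn B.

Lemma tau1_ge0 : 0 <= tau1.
Proof.
by rewrite /tau1 mulr_ge0 // ?divr_ge0 // ?mulr_ge0 // ?exprn_ge0 // ?ler0n // invr_ge0.
Qed.

Lemma tau1_rho (rho : nat) : (0 < rho <= rhoM)%N ->
  8 * rho%:R ^+ 2 / 3 * (2^-1 ^+ Q + 24 * rho%:R ^+ 2 * 2^-1 ^+ Q) <= tau1.
Proof.
case/andP=> r0 rM.
have r1 : 1 <= rho%:R :> R by rewrite ler1n.
have r2 : rho%:R ^+ 2 <= rhoM%:R ^+ 2 :> R by rewrite lerXn2r ?nnegrE ?ler0n // ler_nat.
have r3 : 1 <= rho%:R ^+ 2 :> R by rewrite exprn_ege1.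
have t0 : 0 <= 2^-1 ^+ Q :> R by rewrite exprn_ge0 // invr_ge0.
rewrite /tau1; move: (2^-1 ^+ Q) t0 (rho%:R ^+ 2 : R) (rhoM%:R ^+ 2 : R) r2 r3 => t t0 x y r2 r3.
apply: ler_pM; [lra| |lra|].
  by apply: addr_ge0 => //; apply: mulr_ge0 => //; lra.
have := ler_wpM2r t0 r2; have := ler_wpM2r t0 r3; lra.
Qed.

Lemma spec_series_step s rho T k B alpha (tau : nat) :
  (0 < rho <= rhoM)%N -> 24 * (frob A + (rho%:R * c) ^+ 2) <= T%:R * (rho%:R * c) ^+ 2 ->
  (epoch_time A T s + 20 <= WM)%N ->
  base s -> solve_pre A l c rho T s -> imem s 16 0 = (4 * rho * Q)%N ->
  rmem s 27 0 = phi -> rmem s 28 0 = binc R k -> imem s 21 0 = k -> 0 <= alpha ->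
  (solve_time + 2 * WM <= tau + 60)%N ->
  let Phi k s1 := sqn (vec s1 20 - damp_pow k B) + sqn (vec s1 21 - series_part k B) in
  spec series_step s tau
    (fun s' => [/\ base s', solve_pre A l c rho T s', imem s' 16 0 = (4 * rho * Q)%N,
        rmem s' 27 0 = phi & rmem s' 28 0 = binc R k.+1])
    (fun s' => alpha * (Phi k.+1 s' + delta0 B)) (alpha * (8 * (Phi k s + delta0 B))).
Proof.
move=> rr TE WE Bs Hs E16 E27 E28 Ek al0 tt Phi.
have /andP[r0 rM] := rr.
have NWM : (400 * N + 420 <= WM)%N.
  move: WE; rewrite /epoch_time (base_N Bs); clear; lia.
have tt' : (solve_time + ((60 * N + 20) + (30 + (60 * N + 20))) <= tau)%N.
  by clear -tt NWM; lia.
set b := vec s 20; set e2 := vec s 21.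
pose C := 2 * sqn (e2 - series_part k B) + 6 * sqn (b - damp_pow k B).
pose J s1 := [/\ base s1, solve_pre A l c rho T s1, imem s1 16 0 = (4 * rho * Q)%N, rmem s1 27 0 = phi &
   imem s1 21 0 = k].
apply: (@spec_weaken _ _ _ _ tau _ _
  (fun s' => alpha * (Phi k.+1 s' + delta0 B)) _ (alpha * (6 * (tau1 * sqn b) + (C + delta0 B))) _ _ tt').
2: by move=> s' H; exact: H.
2: by move=> *; exact: lexx.
2: {
  apply: ler_wpM2l => //.
  have X1 : sqn b <= 2 * sqn (b - damp_pow k B) + 2 * sqn B.
    have := sqnD_le (b - damp_pow k B) (damp_pow k B); rewrite subrK; have := sqn_pw k B; lra.
  have X2 := ler_wpM2l tau1_ge0 X1.
  have X3 := ler_wpM2r (sqn_ge0 (b - damp_pow k B)) tau1_le.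
  have X4 := sqn_ge0 (e2 - series_part k B); have X5 := sqn_ge0 (b - damp_pow k B).
  have X6 := mulr_ge0 tau1_ge0 (sqn_ge0 B).
  rewrite /Phi /C /delta0 -/b -/e2; lra. }
apply: (spec_seq (Q1 := fun s1 => [/\ J s1, rmem s1 28 0 = binc R k & vec s1 21 = e2])
  (Psi1 := fun s1 => alpha * (6 * sqn (vec s1 18 - solU lam nu l c b) + (C + delta0 B)))).
  have [_ _ _ _ EQ] := Bs.
  have sm : 64 * rho%:R ^+ 4 * 2^-1 ^+ Q <= 1 :> R.
    apply: le_trans small; apply: ler_wpM2r; first by rewrite exprn_ge0 // invr_ge0.
    by apply: ler_wpM2l => //; rewrite lerXn2r ?nnegrE ?ler0n // ler_nat.
  have tts : ((4 * rho * Q).+1 * ((Q + 3) * (epoch_time A T s + 20)) <= solve_time)%N.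
    by rewrite /solve_time leq_mul // ?ltnS ?leq_mul.
  have H := spec_solve eig lam_le1 lam_half l01 c0 r0 TE Hs (erefl (vec s 20)) EQ E16 sm tts.
  have H6 : 0 <= 6 :> R by [].
  have H' := spec_affine 0 al0 (spec_affine (C + delta0 B) H6 H).
  apply: (spec_weaken (spec_frame H') (leqnn _)).
  - move=> s1 [Hs1 f]; split.
    + split=> //; first by apply: base_frame f _ _ Bs.
      * by rewrite f.1.
      * by rewrite f.2.
      * by rewrite f.1.
    + by rewrite f.2.
    + by rewrite /colvec f.2.
  - by move=> s1 _; rewrite addr0 lexx.
  - rewrite addr0; apply: ler_wpM2l => //; rewrite lerD2r; apply: ler_wpM2l => //.
    by apply: ler_wpM2r; [exact: sqn_ge0|exact: tau1_rho].
move=> s1 [J1 E28' E21].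
apply: spec_det.
have JF cc s2 s3 : frame cc s2 s3 -> ~~ has (mem (iwr cc)) (14%N :: 15%N :: envI) ->
    ~~ has (mem (iwr cc)) [:: 16; 17; 21]%N ->
    ~~ has (mem (rwr cc)) (25%N :: 26%N :: 33%N :: 23%N :: 24%N :: envR) ->
    27%N \notin rwr cc -> J s2 -> J s3.
  move=> f HI /= /norP[n16 /norP[n17 /norP[n21 _]]] HR n27 [K1 K2 K3 K4 K5]; split.
  - apply: base_frame f HI _ K1.
    move: HR; rewrite 5!(has_consE _ _ _, negb_or).
    by do 5 (move=> /andP[_]).
  - apply: solve_pre_frame f _ HR K2; rewrite has_consE negb_or n17 /=.
    by move: HI; rewrite has_consE negb_or has_consE negb_or => /and3P[].
  - by rewrite f.1.
  - by rewrite f.2.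
  - by rewrite f.1.
have [B1 _ _ E27' _] := J1.
set w := vec s1 18.
apply: (dspec_seq (Q1 := fun s2 => [/\ J s2, rmem s2 28 0 = binc R k, vec s2 21 = e2 &
   vec s2 20 = phi *: w])).
  apply: (env_vset (base_env B1) (base_N B1)) => // s2 f E20; split.
  - by apply: (JF _ _ _ f).
  - by rewrite f.2.
  - by rewrite -E21 /colvec f.2.
  - by rewrite E20 /= E27'.
move=> s2 [J2 E28'' E21' E20].
apply: (dspec_seq (Q1 := fun s3 => [/\ J s3, rmem s3 28 0 = binc R k.+1, vec s3 21 = e2 &
   vec s3 20 = phi *: w])).
  pose e := RMul (rv 28) (RDiv (RNat (IAdd (IAdd (iv 21) (iv 21)) (INum 1)))
                              (RNat (IAdd (IAdd (iv 21) (iv 21)) (INum 2)))).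
  have D : dspec (rset0 28 e) s2 30 (fun s3 => rmem s3 28 0 = binc R k.+1).
    apply: dspec_rset => //=.
    by have [_ _ _ _ Ek2] := J2; rewrite /upd /= E28'' Ek2.
  apply: (dspec_weaken (dspec_frame D) (leqnn _)) => s3 [E28n f]; split=> //.
  - by apply: (JF _ _ _ f).
  - by rewrite -E21' /colvec f.2.
  - by rewrite -E20 /colvec f.2.
move=> s3 {s2 J2 E28'' E21' E20} [J3 E28'' E21' E20].
have [B3 _ _ _ _] := J3.
apply: (env_vset (base_env B3) (base_N B3)) => // s4 f E21n.
have [B4 H4 E164 E274 _] : J s4 by apply: (JF _ _ _ f).
split; first by split=> //; rewrite f.2.
apply: ler_wpM2l => //; rewrite addrA lerD2r.
have -> : Phi k.+1 s4 = sqn (phi *: w - damp_pow k.+1 B) +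
    sqn (e2 + binc R k.+1 *: (phi *: w) - series_part k.+1 B).
  have e20 : vec s4 20 = phi *: w by rewrite -E20 /colvec f.2.
  by rewrite /Phi e20 E21n /= E21' E28'' E20.
apply: series_det => //.
by have /andP[/ltW -> ->] := binc01 R k.+1.
Qed.

(** The power and the partial sum both start as the given vector, hence the factor 2; each of the
    [K] further terms of the series contributes a factor 8. *)
Lemma spec_rung s B tau : base s -> rmem s 22 0 = c -> rmem s 27 0 = phi ->
  (rung_time <= tau)%N ->
  spec rung s tau base (fun s' => sqn (vec s' 20 - rungop B))
    (8 ^+ K * (2 * sqn (vec s 20 - B) + delta0 B)).
Proof.
move=> Bs Ec Ephi tt; have [Ev EN El EK EQ] := Bs.
have EF : rmem s 5 0 = frob A by case: Ev.
have Srho := dspec_set_rho Ev Ec c0 EQ nz rM0 cR.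
have NWM : (400 * nnz A + 400 * N + 420 <= WM)%N.
  have [s' [_ [_ _ [rho [/andP[r0 _] _ _ _ hd]]]]] := Srho.
  (* With [T = 0] the premise on [T] is void, and [capW] gives the part of its bound that is free of
     [T]. *)
  have := @cW rho 0%N r0 hd (fun k (h : (k < 0)%N) => False_ind _ (Bool.diff_false_true h)).
  by clear; lia.
(* The amount taken off leaves room for the loop overhead, so that a round stays within
   [solve_time + 2 * WM]; it does not truncate because [WM >= 420]. *)
pose bt := (solve_time + 2 * WM - 60)%N.
apply: (@spec_weaken _ _ _ ((60 * rhoM + 60) + (60 + ((40 * WM + 40) + (5 + ((60 * N + 20) +
  ((K * (bt + 14) + 20) + (60 * N + 20)))))))  _ base _
  (fun s' => sqn (vec s' 20 - rungop B)) _ _ _ _ _ _ _ (lexx _)).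
2: { apply: leq_trans tt; rewrite /rung_time.
  have h : (K * (bt + 14) <= K * (solve_time + 2 * WM))%N.
    by rewrite leq_mul2l /bt; apply/orP; right; clear -NWM; lia.
  by clear -h NWM; lia. }
2: by [].
2: by move=> *; exact: lexx.
set v := vec s 20.
pose J s1 := [/\ base s1, rmem s1 27 0 = phi & vec s1 20 = v].
have JF cc s2 s3 : frame cc s2 s3 -> ~~ has (mem (iwr cc)) (14%N :: 15%N :: envI) ->
    ~~ has (mem (rwr cc)) (20%N :: 27%N :: envR) -> J s2 -> J s3.
  move=> f HI; rewrite has_consE negb_or has_consE negb_or => /and3P[r20 r27 HR] [K1 K2 K3].
  by split; [exact: base_frame f HI HR K1|rewrite f.2|rewrite /colvec f.2].
have J0 : J s by [].
apply: (spec_dseq (Q1 := fun s1 => J s1 /\ exists rho : nat,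
    [/\ (0 < rho <= rhoM)%N, rmem s1 23 0 = rho%:R * c, rmem s1 32 0 = rho%:R,
        imem s1 16 0 = (4 * rho * Q)%N &
        d.+1%:R * frob A <= (nnz A)%:R * (rho%:R * c) ^+ 2])).
  apply: (dspec_weaken (dspec_frame Srho) (leqnn _)) => s1 [H f]; split=> //.
  by apply: (JF _ _ _ f).
move=> s1 [J1 [rho [rr E23 E32 E16 hd]]].
have [B1 _ _] := J1; have /andP[r0 rM] := rr.
have EF1 : rmem s1 5 0 = frob A by case: (base_env B1).
pose c' := rho%:R * c.
have c'0 : 0 < c' by rewrite mulr_gt0 // ltr0n.
apply: (spec_dseq (Q1 := fun s2 => [/\ J s2, imem s2 16 0 = (4 * rho * Q)%N, rmem s2 23 0 = c' &
   [/\ rmem s2 24 0 = c' / (16 * (frob A + c' ^+ 2)),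
        rmem s2 25 0 = (1 - 1 / (2 * rho%:R)) ^+ 2, rmem s2 26 0 = rho%:R ^- 2 &
        rmem s2 33 0 = 1 - rho%:R ^- 2]])).
  apply: (dspec_weaken (dspec_frame (dspec_set_par EF1 E23 E32)) (leqnn _)) => s2 [H f].
  split=> //; first by apply: (JF _ _ _ f).
    by rewrite f.1.
  by rewrite f.2.
move=> s2 {s1 J1 B1 E23 E32 E16 EF1} [J2 E16 E23 [E24 E25 E26 E33]].
have [B2 _ _] := J2.
have EF2 : rmem s2 5 0 = frob A by case: (base_env B2).
have capT T : (forall k, (k < T)%N -> k%:R * c' ^+ 2 < 24 * (frob A + c' ^+ 2)) -> (T <= WM)%N.
  by move/(cW r0 hd); clear; nia.
apply: (spec_dseq (Q1 := fun s3 => J s3 /\ exists T : nat,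
  [/\ solve_pre A l c rho T s3, imem s3 16 0 = (4 * rho * Q)%N,
    24 * (frob A + c' ^+ 2) <= T%:R * c' ^+ 2 & (epoch_time A T s3 + 20 <= WM)%N])).
  apply: (dspec_weaken (dspec_frame (dspec_set_T c'0 E23 EF2 capT)) (leqnn _)).
  move=> s3 [[T [ET TE TT]] f]; have J3 : J s3 by apply: (JF _ _ _ f).
  split=> //; exists T; split=> //.
  - split; rewrite ?f.2 //; split; rewrite ?f.2 //; first by case: J3 => /base_env.
  - by rewrite f.1.
  - have [[_ EN3 El3 _ _] _ _] := J3.
    by have := cW r0 hd TT; rewrite /epoch_time EN3 El3; clear; lia.
move=> s3 {s2 J2 B2 EF2 E16 E23 E24 E25 E26 E33} [J3 [T [H3 E16 TE WE]]].
have JF2 cc s4 s5 : frame cc s4 s5 -> ~~ has (mem (iwr cc)) (14%N :: 15%N :: envI) ->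
    ~~ has (mem (iwr cc)) [:: 16; 17]%N ->
    ~~ has (mem (rwr cc)) (25%N :: 26%N :: 33%N :: 23%N :: 24%N :: envR) ->
    [/\ base s4, solve_pre A l c rho T s4 & imem s4 16 0 = (4 * rho * Q)%N] ->
    [/\ base s5, solve_pre A l c rho T s5 & imem s5 16 0 = (4 * rho * Q)%N].
  move=> f HI /= /norP[n16 /norP[n17 _]] HR [K1 K2 K3]; split.
  - apply: base_frame f HI _ K1.
    move: HR; rewrite 5!(has_consE _ _ _, negb_or).
    by do 5 (move=> /andP[_]).
  - apply: solve_pre_frame f _ HR K2; rewrite has_consE negb_or n17 /=.
    by move: HI; rewrite has_consE negb_or has_consE negb_or => /and3P[].
  - by rewrite f.1.
pose J' s4 := [/\ base s4, solve_pre A l c rho T s4, imem s4 16 0 = (4 * rho * Q)%N & rmem s4 27 0 = phi].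
have J'F cc s4 s5 : frame cc s4 s5 -> ~~ has (mem (iwr cc)) (14%N :: 15%N :: envI) ->
    ~~ has (mem (iwr cc)) [:: 16; 17]%N ->
    ~~ has (mem (rwr cc)) (25%N :: 26%N :: 33%N :: 23%N :: 24%N :: envR) ->
    27%N \notin rwr cc -> J' s4 -> J' s5.
  move=> f HI HI2 HR n27 [K1 K2 K3 K4].
  have [] := JF2 _ _ _ f HI HI2 HR (And3 K1 K2 K3).
  by split=> //; rewrite f.2.
have J'3 : J' s3 by case: J3.
have ev J4 : J' J4 -> epoch_time A T J4 = epoch_time A T s3.
  by case=> -[_ a1 a2 _ _] _ _ _; have [[_ b1 b2 _ _] _ _] := J3; rewrite /epoch_time a1 a2 b1 b2.
apply: (spec_dseq (Q1 := fun s4 => [/\ J' s4, rmem s4 28 0 = 1 & vec s4 20 = v])).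
  have D : dspec (rset0 28 (rnum 1)) s3 5 (fun s4 => rmem s4 28 0 = 1) by apply: dspec_rset.
  apply: (dspec_weaken (dspec_frame D) (leqnn _)) => s4 [E f]; split=> //.
    by apply: (J'F _ _ _ f).
  by case: J3 => _ _ <-; rewrite /colvec f.2.
move=> s4 [J4 E28 E20].
apply: (spec_dseq (Q1 := fun s5 => [/\ J' s5, rmem s5 28 0 = 1, vec s5 20 = v & vec s5 21 = v])).
  have [B4 _ _ _] := J4.
  apply: (env_vset (base_env B4) (base_N B4)) => // s5 f E21; split.
  - by apply: (J'F _ _ _ f).
  - by rewrite f.2.
  - by rewrite -E20 /colvec f.2.
  - by rewrite E21.
move=> s5 [J5 {}E28 {}E20 E21].
have WT : (400 * nnz A + 400 * N + T * (420 * (N + ell + 1)) + 420 <= WM)%N.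
  by have [[_ b1 b2 _ _] _ _] := J3; move: WE; rewrite /epoch_time b1 b2; clear; lia.
pose Phi k s1 := sqn (vec s1 20 - damp_pow k B) + sqn (vec s1 21 - series_part k B).
pose Psi k s1 := 8 ^+ (K - k) * (Phi k s1 + delta0 B).
pose Inv k s1 := J' s1 /\ rmem s1 28 0 = binc R k.
apply: (spec_seq (Q1 := base) (Psi1 := fun s6 => sqn (vec s6 21 - rungop B))).
  apply: (@spec_weaken _ _ _ (K * (bt + 14) + 20) _ (fun s' => Inv K s' /\ imem s' 21 0 = K) _
     (Psi K) _ (8 ^+ K * (2 * sqn (v - B) + delta0 B)) _ _ (leqnn _)).
  - apply: (@spec_for _ _ _ _ _ 0%N K bt (K * (bt + 14) + 20) Inv Psi) => //.
    + by move=> k s6 _ [[[_ _ _ E _] _ _ _] _] _; exact: E.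
    + rewrite /Psi subn0; apply: ler_wpM2l; first by rewrite exprn_ge0.
      have p0 : damp_pow 0 B = B.
        by apply: (co_inj eig) => i; rewrite (co_ofco eig) expr0 mul1r.
      have a0 : series_part 0 B = B.
        by apply: (co_inj eig) => i; rewrite (co_ofco eig) /bser big_nat1 expr0 !mul1r.
      rewrite /Phi p0 a0.
      have -> : vec (seti 21 0 s5) 20 = v by rewrite -E20.
      have -> : vec (seti 21 0 s5) 21 = v by rewrite -E21.
      by rewrite lerD2r; lra.
    + move=> k s6 /andP[_ kK] [J6 E6] ik; have [B6 H6 E166 E276] := J6.
      have al0 : 0 <= 8 ^+ (K - k.+1) :> R by rewrite exprn_ge0.
      have WE6 : (epoch_time A T s6 + 20 <= WM)%N.
        have [_ a1 a2 _ _] := B6.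
        by rewrite /epoch_time a1 a2; move: WT; clear; lia.
      have bt' : (solve_time + 2 * WM <= bt + 60)%N by rewrite /bt; clear; lia.
      have H := spec_series_step B rr TE WE6 B6 H6 E166 E276 E6 ik al0 bt'.
      apply: (spec_weaken H (leqnn _)).
      * move=> s7 [B7 H7 E167 E277 E287]; split=> //.
      * by move=> s7 _; exact: lexx.
      * rewrite /Psi; have -> : (K - k = (K - k.+1).+1)%N by rewrite subnSK.
        by rewrite exprSr -mulrA lexx.
    + by rewrite subn0 /=; clear; nia.
  - by move=> s' [[[]]].
  - move=> s' _; rewrite /Psi subnn expr0 mul1r /Phi.
    have := sqn_ge0 (vec s' 20 - damp_pow K B).
    have : 0 <= delta0 B by rewrite /delta0 !mulr_ge0 ?tau1_ge0 ?sqn_ge0.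
    by rewrite -/(rungop B); lra.
  - exact: lexx.
move=> s6 B6; apply: spec_det.
apply: (env_vset (base_env B6) (base_N B6)) => // s7 f E; split.
  by apply: (base_frame f).
by rewrite E lexx.
Qed.

End OneRung.
End Rung.

(** * The main loop *)

Definition main_init : cmd :=
  vset 11 20 (VV 1) ;;
  rset0 22 (RMul (RGet 2 (INum 1)) (rv 2)) ;;
  For 22 (INum 0) (iv 14) (rset0 22 (RAdd (rv 22) (rv 22))) ;;
  rset0 31 (rv 22) ;;
  rset0 27 (RDiv (rnum 3) (rnum 4)).

Definition main_out : cmd :=
  matvec 11 20 15 ;;
  rset0 35 (RDiv (rnum 1) (rv 31)) ;;
  rset0 36 (RDiv (rnum 1) (rnum 2)) ;;
  vset 11 4 (VMul 36 (VAdd (VV 1) (VMul 35 (VSub (VV 15) (VMul 2 (VV 20)))))).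

Definition main : cmd :=
  main_init ;;
  For 22 (INum 0) (iv 14) (rung ;; rset0 22 (RDiv (rv 22) (rnum 2))) ;;
  rset0 27 (rnum 1) ;;
  rung ;;
  main_out.

Section Main.
Variables (R : realType) (n d : nat) (A : 'M[R]_(n, d.+1)).
Variables (lam : 'I_d.+1 -> R) (nu : 'I_d.+1 -> 'cV[R]_d.+1).
Hypothesis eig : eigen_decomposition A lam nu.
Hypothesis lam_le1 : lam ord0 <= 1.
Hypothesis lam_half : 2^-1 <= lam ord0.
Variables (l gam : R).
Hypothesis l01 : 0 < l < 1.
Hypothesis gam0 : 0 < gam.
Implicit Types (s : state R).
Notation cl := (colseq A).
Notation vec := (colvec d.+1 cl).
Variables (N ell K Q rhoM WM : nat).
Let M := A^T *m A.
Let mu := gam * l.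
Hypothesis small : 64 * rhoM%:R ^+ 4 * 2^-1 ^+ Q <= 1 :> R.
Hypothesis tau1_le : tau1 R Q rhoM <= 1 / 6.
Hypothesis nz : (0 < nnz A)%N.
Hypothesis rM0 : (0 < rhoM)%N.
Hypothesis capRW : forall c, mu <= c -> capR A rhoM c /\ capW A N ell WM c.
Hypothesis NWM : (400 * nnz A + 400 * N + 420 <= WM)%N.
Let c0 := mu * (2 ^ K)%:R.
Hypothesis c01 : 1 <= c0.

Notation base := (base A l N ell K Q).
Notation rtime := (rung_time K Q rhoM WM).

Lemma mu_gt0 : 0 < mu.
Proof. by rewrite mulr_gt0 //; case/andP: l01. Qed.

Definition rung_shift j := mu * (2 ^ (K - j))%:R.

Lemma rung_shift_ge j : mu <= rung_shift j.
Proof. by rewrite /rung_shift ler_peMr ?(ltW mu_gt0) // ler1n expn_gt0. Qed.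

Fixpoint after_rungs (v : 'cV[R]_d.+1) (j : nat) : 'cV[R]_d.+1 :=
  if j is j'.+1 then rungop lam nu l K (rung_shift j') (3 / 4) (after_rungs v j') else v.

Definition after_all v := rungop lam nu l K mu 1 (after_rungs v K).

Definition exact_out v := 2^-1 *: (v + c0^-1 *: (M *m after_all v - l *: after_all v)).

Definition growth : R := 8 ^+ K * (4 * K.+1%:R ^+ 2).

Lemma growth_ge0 : 0 <= growth.
Proof. by rewrite !mulr_ge0 ?exprn_ge0 ?ler0n. Qed.

Notation dev0 := (delta0 Q rhoM).

(** The noise of a rung is relative to the exact vector it acts on, so that vector's noise floor
    travels with the error. A rung lengthens the exact vector by at most [K + 1], the bound on
    [bser], which is the origin of the square in [growth]. *)
Lemma rung_growth s c phi B tau : base s -> rmem s 22 0 = c -> mu <= c ->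
  0 <= phi <= 1 -> rmem s 27 0 = phi -> (rtime <= tau)%N ->
  spec rung s tau base
    (fun s' => sqn (vec s' 20 - rungop lam nu l K c phi B) + dev0 (rungop lam nu l K c phi B))
    (growth * (sqn (vec s 20 - B) + dev0 B)).
Proof.
move=> Bs Ec cmu phi01 Ephi tt.
have cp : 0 < c := lt_le_trans mu_gt0 cmu.
have [cR cW] := capRW cmu.
have H := spec_rung eig lam_le1 lam_half l01 small tau1_le nz rM0 cp phi01 cR cW B Bs Ec Ephi tt.
have H' := spec_affine (dev0 (rungop lam nu l K c phi B)) ler01 H.
apply: (spec_weaken H') => //; first by move=> s' _; rewrite mul1r lexx.
rewrite mul1r.
have d0 : 0 <= dev0 B by rewrite /delta0 !mulr_ge0 ?sqn_ge0 ?tau1_ge0.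
have dl : dev0 (rungop lam nu l K c phi B) <= K.+1%:R ^+ 2 * dev0 B.
  rewrite /delta0 [leRHS]mulrCA; apply: ler_wpM2l; first by rewrite mulr_ge0 ?tau1_ge0.
  apply: (sqn_ofco_le eig); first by rewrite ler0n.
  move=> i; have ui := u01 lam l cp phi01 i.
  rewrite bser_le // andbT; apply: le_trans (bser_ge1 _ _) => //; by case/andP: ui.
have g1 : 1 <= 8 ^+ K :> R by rewrite exprn_ege1 // ler1n.
have k1 : 1 <= K.+1%:R ^+ 2 :> R by rewrite exprn_ege1 // ler1n.
have q0 := sqn_ge0 (vec s 20 - B).
apply: le_trans (lerD (lexx _) dl) _; rewrite /growth.
move: (8 ^+ K) (K.+1%:R ^+ 2 : R) (sqn _) (dev0 B) g1 k1 q0 d0 => g k x y g1 k1 x0 y0.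
have a1 : g * x <= g * k * x by rewrite ler_wpM2r // ler_peMr //; lra.
have a2 : g * y <= g * k * y by rewrite ler_wpM2r // ler_peMr //; lra.
have a3 : k * y <= g * k * y by rewrite ler_wpM2r // ler_peMl //; lra.
have a4 : 0 <= g * k * x by rewrite !mulr_ge0 //; lra.
have a5 : 0 <= g * k * y by rewrite !mulr_ge0 //; lra.
lra.
Qed.

Lemma dspec_main_init s : base s -> rmem s 2 1 = gam ->
  dspec main_init s (60 * N + 20 * K + 80) (fun s' =>
    [/\ base s', vec s' 20 = vec s 1, rmem s' 22 0 = c0, rmem s' 31 0 = c0 & rmem s' 27 0 = 3 / 4]).
Proof.
move=> Bs Eg.
apply: (@dspec_weaken _ _ _ ((60 * N + 20) + (10 + ((K * 20 + 20) + (10 + 10)))) _ _ _ _ _ (fun s' h => h)); last first.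
  by clear; lia.
apply: (dspec_seq (Q1 := fun s1 => [/\ base s1, vec s1 20 = vec s 1 & rmem s1 2 1 = gam])).
  apply: (env_vset (base_env Bs) (base_N Bs)) => // s1 f E; split.
  - by apply: (base_frame f).
  - by rewrite E.
  - by rewrite f.2.
move=> s1 [B1 E20 {}Eg].
apply: (dspec_seq (Q1 := fun s2 => [/\ base s2, vec s2 20 = vec s 1 & rmem s2 22 0 = mu])).
  pose e := RMul (RGet 2 (INum 1)) (rv 2).
  have D : dspec (rset0 22 e) s1 10 (fun s2 => rmem s2 22 0 = mu).
    apply: dspec_rset => //=; rewrite /upd /= Eg.
    by have [_ _ _ _ ->] := base_env B1.
  apply: (dspec_weaken (dspec_frame D) (leqnn _)) => s2 [E f]; split=> //.
    by apply: (base_frame f).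
  by rewrite -E20 /colvec f.2.
move=> s2 {s1 B1 E20 Eg} [B2 E20 E22].
apply: (dspec_seq (Q1 := fun s3 => [/\ base s3, vec s3 20 = vec s 1 & rmem s3 22 0 = c0])).
  pose Inv k s3 := [/\ base s3, vec s3 20 = vec s 1 & rmem s3 22 0 = mu * (2 ^ k)%:R].
  apply: (@dspec_weaken _ _ _ (K * 20 + 20) _ (fun s' => Inv K s' /\ imem s' 22 0 = K)) => //; last by move=> s' [].
  apply: (@dspec_for _ _ _ _ _ 0%N K 7) => //.
  - by move=> k s3 _ [[_ _ _ E _] _ _] _; exact: E.
  - split=> //; last by rewrite expn0 mulr1.
  - move=> k s3 /andP[_ kK] [B3 E E'] ik.
    have D : dspec (rset0 22 (RAdd (rv 22) (rv 22))) s3 7 (fun s4 => rmem s4 22 0 = mu * (2 ^ k.+1)%:R).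
      apply: dspec_rset => //=; rewrite /upd /= E' expnS natrM; ring.
    apply: (dspec_weaken (dspec_frame D) (leqnn _)) => s4 [E4 f]; split.
    + apply: (base_frame (frame_seti 22 k.+1 s4)) => //.
      by apply: (base_frame f).
    + by rewrite -E /colvec /= f.2.
    + exact: E4.
  - by rewrite subn0 /=; clear; lia.
move=> s3 {s2 B2 E20 E22} [B3 E20 E22].
apply: (dspec_seq (Q1 := fun s4 => [/\ base s4, vec s4 20 = vec s 1, rmem s4 22 0 = c0 & rmem s4 31 0 = c0])).
  have D : dspec (rset0 31 (rv 22)) s3 10 (fun s4 => rmem s4 31 0 = c0) by apply: dspec_rset.
  apply: (dspec_weaken (dspec_frame D) (leqnn _)) => s4 [E f]; split=> //.
  - by apply: (base_frame f).
  - by rewrite -E20 /colvec f.2.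
  - by rewrite f.2.
move=> s4 {s3 B3 E20 E22} [B4 E20 E22 E31].
have D : dspec (rset0 27 (RDiv (rnum 3) (rnum 4))) s4 10 (fun s5 => rmem s5 27 0 = 3 / 4) by apply: dspec_rset.
apply: (dspec_weaken (dspec_frame D) (leqnn _)) => s5 [E f]; split=> //.
- by apply: (base_frame f).
- by rewrite -E20 /colvec f.2.
- by rewrite f.2.
- by rewrite f.2.
Qed.

Lemma dspec_main_out s : base s -> rmem s 31 0 = c0 ->
  dspec main_out s (200 * nnz A + 60 * N + 150) (fun s' =>
    vec s' 4 = 2^-1 *: (vec s 1 + c0^-1 *: (M *m vec s 20 - l *: vec s 20)) /\
    forall j, j \notin cl -> rmem s' 4 j = rmem s 4 j).
Proof.
move=> Bs E31.
apply: (@dspec_weaken _ _ _ ((200 * nnz A + 100) + (10 + (10 + (60 * N + 20)))) _ _ _ _ _ (fun s' h => h)); last first.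
  by clear; lia.
pose J s1 := [/\ base s1, vec s1 1 = vec s 1, vec s1 20 = vec s 20, rmem s1 31 0 = c0 &
  vec s1 15 = M *m vec s 20 /\ rmem s1 4 = rmem s 4].
apply: (dspec_seq (Q1 := J)).
  have [dok _ _ _ _] := base_env Bs.
  apply: (dspec_weaken (dspec_frame (dspec_matvec (src := 20) (dst := 15) (i := 11)
    dok isT isT isT isT isT (leqnn _))) (leqnn _)) => s1 [E f]; split=> //.
  - by apply: (base_frame f).
  - by rewrite /colvec f.2.
  - by rewrite /colvec f.2.
  - by rewrite f.2.
  - by split=> //; rewrite f.2.
move=> s1 [B1 E1 E20 E31' [E15 E4]].
apply: (dspec_seq (Q1 := fun s2 => J s2 /\ rmem s2 35 0 = c0^-1)).
  have D : dspec (rset0 35 (RDiv (rnum 1) (rv 31))) s1 10 (fun s4 => rmem s4 35 0 = c0^-1).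
    by apply: dspec_rset => //=; rewrite /upd /= E31' div1r.
  apply: (dspec_weaken (dspec_frame D) (leqnn _)) => s2 [E f]; split=> //; split.
  - by apply: (base_frame f).
  - by rewrite -E1 /colvec f.2.
  - by rewrite -E20 /colvec f.2.
  - by rewrite f.2.
  - by split; [rewrite -E15 /colvec f.2|rewrite f.2].
move=> s2 {s1 B1 E1 E20 E31' E15 E4} [[B1 E1 E20 E31' [E15 E4]] E35].
apply: (dspec_seq (Q1 := fun s2 => [/\ J s2, rmem s2 35 0 = c0^-1 & rmem s2 36 0 = 2^-1])).
  have D : dspec (rset0 36 (RDiv (rnum 1) (rnum 2))) s2 10 (fun s4 => rmem s4 36 0 = 2^-1).
    by apply: dspec_rset => //=; rewrite /upd /= div1r.
  apply: (dspec_weaken (dspec_frame D) (leqnn _)) => s3 [E f]; split=> //; last by rewrite f.2.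
  split.
  - by apply: (base_frame f).
  - by rewrite -E1 /colvec f.2.
  - by rewrite -E20 /colvec f.2.
  - by rewrite f.2.
  - by split; [rewrite -E15 /colvec f.2|rewrite f.2].
move=> s3 {s2 B1 E1 E20 E31' E15 E4 E35} [[B1 E1 E20 E31' [E15 E4]] E35 E36].
apply: (env_vset_off (base_env B1) (base_N B1)) => // s4 f -> off.
split; last by move=> j jc; rewrite off // E4.
have El : rmem s3 2 0 = l by case: (base_env B1).
by rewrite /= E36 E35 E1 E15 E20 El.
Qed.

Lemma sqn_Xle (x : 'cV[R]_d.+1) : sqn (M *m x - l *: x) <= sqn x.
Proof.
rewrite !(sqn_co eig); apply: ler_sum => i _.
rewrite coD coN coZ (coM eig) -mulrBl exprMn ler_piMl ?sqr_ge0 //.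
have /andP[a0 a1] := lam01 eig lam_le1 i; have /andP[b0 b1] := l01.
by rewrite expr2; nra.
Qed.

(** There are [K] rungs with factor 3/4 and one with factor 1, each multiplying the potential by
    [growth]. The final map [X / c0] does not enlarge errors, as [c0 >= 1] and [|lam - l| <= 1]. The
    clause on the cells off [cl] is kept because the output is read in all coordinates. *)
Lemma spec_main s tau : base s -> rmem s 2 1 = gam ->
  ((K + 2) * (rtime + 60) <= tau)%N ->
  spec main s tau (fun s' => forall j, j \notin cl -> rmem s' 4 j = rmem s 4 j)
    (fun s' => sqn (vec s' 4 - exact_out (vec s 1)))
    (growth ^+ K.+1 * dev0 (vec s 1)).
Proof.
move=> Bs Eg tt; set v := vec s 1.
apply: (@spec_weaken _ _ _ ((60 * N + 20 * K + 80) + ((K * (rtime + 30) + 20) + (10 + (rtime +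
   (200 * nnz A + 60 * N + 150))))) _ (fun s' => forall j, j \notin cl -> rmem s' 4 j = rmem s 4 j) _ (fun s' => sqn (vec s' 4 - exact_out v))
   _ (growth ^+ K.+1 * dev0 v)).
2: { apply: leq_trans tt; have h : (50 * WM <= rtime)%N by rewrite /rung_time; clear; lia.
     move: h; move: rtime => r h; clear -h NWM; nia. }
2: by [].
2: by move=> *; exact: lexx.
2: exact: lexx.
pose V s1 := [/\ base s1, rmem s1 31 0 = c0, vec s1 1 = v & rmem s1 4 = rmem s 4].
have VF cc s1 s2 : frame cc s1 s2 -> ~~ has (mem (iwr cc)) (14%N :: 15%N :: envI) ->
   ~~ has (mem (rwr cc)) (4%N :: 31%N :: 1%N :: envR) -> V s1 -> V s2.
  move=> f HI; rewrite has_consE negb_or has_consE negb_or has_consE negb_or => /and4P[n4 n31 n1 HR] [V1 V2 V3 V4].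
  by split; [exact: base_frame f HI HR V1|rewrite f.2|rewrite /colvec f.2|rewrite f.2].
apply: (spec_dseq (Q1 := fun s1 => [/\ V s1, vec s1 20 = v, rmem s1 22 0 = c0 & rmem s1 27 0 = 3 / 4])).
  apply: (dspec_weaken (dspec_frame (dspec_main_init Bs Eg)) (leqnn _)).
  move=> s1 [[B1 E20 E22 E31 E27] f]; split=> //; split=> //; last by rewrite f.2.
  by rewrite /colvec f.2.
move=> s1 [V1 E20 E22 E27].
pose D j s2 := sqn (vec s2 20 - after_rungs v j) + dev0 (after_rungs v j).
pose Inv j s2 := [/\ V s2, rmem s2 22 0 = rung_shift j & rmem s2 27 0 = 3 / 4].
apply: (spec_seq (Q1 := Inv K) (Psi1 := fun s2 => growth * D K s2)).
  pose Psi j s2 := growth ^+ (K - j).+1 * D j s2.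
  apply: (@spec_weaken _ _ _ (K * (rtime + 30) + 20) _ (fun s' => Inv K s' /\ imem s' 22 0 = K) _
     (Psi K) _ (growth ^+ K.+1 * dev0 v) _ _ (leqnn _)).
  - apply: (@spec_for _ _ _ _ _ 0%N K (rtime + 10) (K * (rtime + 30) + 20) Inv Psi) => //.
    + by move=> k s2 _ [[[_ _ _ E _] _ _ _] _ _] _; exact: E.
    + by split=> //; rewrite /rung_shift subn0.
    + rewrite /Psi subn0 /D; have -> : vec (seti 22 0 s1) 20 = v by rewrite -E20.
      by rewrite subrr sqn0 add0r lexx.
    + move=> j s2 /andP[_ jK] [V2 F22 F27] ij; have [B2 _ _ _] := V2.
      have p34 : 0 <= (3 / 4 : R) <= 1 by apply/andP; split; lra.
      have H := rung_growth (after_rungs v j) B2 F22 (rung_shift_ge j) p34 F27 (leqnn _).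
      have al0 : 0 <= growth ^+ (K - j.+1).+1 by rewrite exprn_ge0 // growth_ge0.
      have H' := spec_affine 0 al0 H.
      apply: (spec_seq (Q1 := Inv j) (Psi1 := fun s3 => growth ^+ (K - j.+1).+1 * D j.+1 s3)).
        apply: (spec_weaken (spec_frame H') (leqnn _)).
        * move=> s3 [B3 f]; split; first by apply: (VF _ _ _ f).
            by rewrite f.2.
          by rewrite f.2.
        * by move=> s3 _; rewrite addr0 lexx.
        * rewrite addr0 /Psi -/(D j s2).
          have -> : (K - j = (K - j.+1).+1)%N by rewrite subnSK.
          by rewrite [growth ^+ (_).+2]exprSr mulrA lexx.
      move=> s3 [V3 G22 G27]; apply: spec_det.
      have DD : dspec (rset0 22 (RDiv (rv 22) (rnum 2))) s3 10 (fun s4 => rmem s4 22 0 = rung_shift j.+1).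
        apply: dspec_rset => //=; rewrite /upd /= G22 /rung_shift.
        have -> : (K - j = (K - j.+1).+1)%N by rewrite subnSK.
        by rewrite expnS natrM; field.
      apply: (dspec_weaken (dspec_frame DD) (leqnn _)) => s4 [E4 f]; split; last first.
        rewrite /Psi /D; have -> : vec (seti 22 j.+1 s4) 20 = vec s3 20 by rewrite /colvec /= f.2.
        exact: lexx.
      split=> //; last by rewrite /= f.2.
      apply: (VF _ _ _ (frame_seti 22 j.+1 s4)) => //.
      by apply: (VF _ _ _ f).
    + by rewrite subn0 /=; move: rtime => r; clear; nia.
  - by move=> s' [].
  - by move=> s' _; rewrite /Psi subnn expr1 lexx.
  - exact: lexx.
move=> s2 {s1 V1 E20 E22 E27} [V2 E22 E27].
have E22' : rmem s2 22 0 = mu by rewrite E22 /rung_shift subnn expn0 mulr1.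
apply: (spec_dseq (Q1 := fun s3 => [/\ V s3, vec s3 20 = vec s2 20, rmem s3 22 0 = mu & rmem s3 27 0 = 1])).
  have DD : dspec (rset0 27 (rnum 1)) s2 10 (fun s3 => rmem s3 27 0 = 1) by apply: dspec_rset.
  apply: (dspec_weaken (dspec_frame DD) (leqnn _)) => s3 [E f]; split=> //.
  - by apply: (VF _ _ _ f).
  - by rewrite /colvec f.2.
  - by rewrite f.2.
move=> s3 [V3 F20 F22 F27].
apply: (spec_seq (Q1 := V) (Psi1 := fun s4 => sqn (vec s4 20 - after_all v))).
  have [B3 _ _ _] := V3.
  have p1 : 0 <= (1 : R) <= 1 by rewrite ler01 lexx.
  have H := rung_growth (after_rungs v K) B3 F22 (lexx _) p1 F27 (leqnn _).
  apply: (spec_weaken (spec_frame H) (leqnn _)).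
  - by move=> s4 [B4 f]; apply: (VF _ _ _ f).
  - move=> s4 _; rewrite lerDl /delta0 !mulr_ge0 ?sqn_ge0 //; exact: tau1_ge0.
  - by rewrite /D F20 lexx.
move=> s4 [B4 G31 G1 G4]; apply: spec_det.
apply: (dspec_weaken (dspec_main_out B4 G31) (leqnn _)) => s5 [-> off]; split.
  by move=> j jc; rewrite off // G4.
rewrite G1 /exact_out -scalerBr sqnZ.
set y := vec s4 20 - after_all v.
have -> : v + c0^-1 *: (M *m vec s4 20 - l *: vec s4 20) -
    (v + c0^-1 *: (M *m after_all v - l *: after_all v)) = c0^-1 *: (M *m y - l *: y).
  rewrite /y mulmxBr; move: (M *m vec s4 20) (M *m after_all v) => a b.
  by apply/colP => i; rewrite !mxE; ring.
rewrite sqnZ.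
have c1 : 0 <= c0^-1 ^+ 2 <= 1.
  have cp : 0 < c0 := lt_le_trans ltr01 c01.
  have ci : 0 <= c0^-1 by rewrite invr_ge0 ltW.
  by rewrite sqr_ge0 expr_le1 // invf_le1.
have X1 := sqn_Xle y; have X2 := sqn_ge0 (M *m y - l *: y).
case/andP: c1 => c1 c2.
have X3 := ler_wpM2r X2 c2.
have X4 : 0 <= c0^-1 ^+ 2 * sqn (M *m y - l *: y) by rewrite mulr_ge0.
lra.
Qed.

End Main.

(** * The table of slots *)

Lemma pairwise_allpairs (n d : nat) (s1 : seq 'I_n) (s2 : seq 'I_d) :
  pairwise (fun i j : 'I_n => (i <= j)%N) s1 ->
  pairwise (fun p q : 'I_n * 'I_d => (p.1 <= q.1)%N) [seq (i, j) | i <- s1, j <- s2].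
Proof.
elim: s1 => //= x s1 IH /andP[/allP ax /IH p1].
rewrite pairwise_cat p1 andbT; apply/andP; split.
  apply/allrelP => p q /mapP[j _ ->] /allpairsP[[i' j'] [/= i1 _ ->]] /=.
  exact: ax.
by rewrite pairwise_map; elim: s2 {IH p1} => //= y s2 ->; rewrite andbT; apply/allP => z _ /=.
Qed.

(** * Row segments and the Gram matrix *)

Section Entries.
Variables (R : realType) (n d : nat) (A : 'M[R]_(n, d.+1)).

(** The finite type of pairs is enumerated lexicographically and filtering keeps the order. Hence
    each row occupies a contiguous segment and one pass suffices to find them. *)
Lemma rown_mono j k : (j <= k)%N -> (k < nnz A)%N -> (rown A j <= rown A k)%N.
Proof.
rewrite leq_eqVlt => /predU1P[-> //|jk] kN.
have : pairwise (fun p q : 'I_n * 'I_d.+1 => (p.1 <= q.1)%N) (nonzeros A).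
  rewrite /nonzeros /enum_mem; apply: pairwise_filter; rewrite unlock.
  apply: pairwise_allpairs.
  rewrite -(pairwise_map (@nat_of_ord n) leq) val_enum_ord.
  by rewrite -sorted_pairwise ?iota_sorted //; exact: leq_trans.
case E : (nonzeros A) => [|p0 r]; first by rewrite /nnz E in kN.
rewrite -E => /(pairwiseP p0)/(_ j k); rewrite !inE => H.
have {H} := H (ltn_trans jk kN) kN jk.
by rewrite /rown !(nth_map p0) //; exact: ltn_trans kN.
Qed.

Lemma entry_inj j k : (j < nnz A)%N -> (k < nnz A)%N ->
  rown A j = rown A k -> coln A j = coln A k -> j = k.
Proof.
move=> jN kN; case E : (nonzeros A) => [|p0 r]; first by rewrite /nnz E in kN.
rewrite /rown /coln /colseq !(nth_map p0) // => Er Ec.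
have U : uniq (nonzeros A) by exact: enum_uniq.
apply/eqP; rewrite -(nth_uniq p0 jN kN U).
by rewrite -pair_eqE /pair_eq /= -!val_eqE /= Er Ec !eqxx.
Qed.

Lemma frob_entries : \sum_(0 <= k < nnz A) valr A k ^+ 2 = frob A.
Proof.
rewrite /frob pair_big /= (bigID (fun p : 'I_n * 'I_d.+1 => A p.1 p.2 != 0)) /=.
rewrite [X in _ = _ + X]big1 ?addr0; last first.
  by move=> p; rewrite negbK => /eqP ->; rewrite expr0n.
have -> : \sum_(p | A p.1 p.2 != 0) A p.1 p.2 ^+ 2 =
    \sum_(p <- nonzeros A) A p.1 p.2 ^+ 2 by rewrite /nonzeros big_enum.
case E : (nonzeros A) => [|p0 r]; first by rewrite /nnz E !big_nil.
rewrite -E (big_nth p0); apply: eq_big_nat => k /andP[_ kN].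
by rewrite /valr !(nth_map p0).
Qed.

Lemma valr_neq0 k : (k < nnz A)%N -> valr A k != 0.
Proof.
move=> kN; case E : (nonzeros A) => [|p0 r]; first by rewrite /nnz E in kN.
rewrite /valr (nth_map p0) //.
by have := mem_nth p0 kN; rewrite mem_enum.
Qed.

Definition one_row (a b : nat) : Prop := (b <= nnz A)%N /\
  forall j k, (a <= j < b)%N -> (a <= k < b)%N -> rown A j = rown A k.

Lemma one_row_inj a b j k : one_row a b -> (a <= j < b)%N -> (a <= k < b)%N ->
  coln A j = coln A k -> j = k.
Proof.
move=> [bN rowE] ja ka; apply: entry_inj; last exact: rowE.
  by case/andP: ja => _ /leq_trans; apply.
by case/andP: ka => _ /leq_trans; apply.
Qed.

(** Within one row the columns of the entries are distinct, so no coordinate of the segment collects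
    two entries. *)
Lemma sqn_segv a b : one_row a b ->
  sqn (segv A a b) = \sum_(a <= k < b) valr A k ^+ 2.
Proof.
move=> ab; have [bN _] := ab.
pose x c := \sum_(a <= k < b | coln A k == c) valr A k.
have E : mvec d.+1 (colseq A) x = segv A a b.
  apply/colP => j; rewrite !mxE; case: ifPn => // jc.
  rewrite big_nat_cond big1 // => k /andP[/andP[_ kb] /eqP kj].
  by move: jc; rewrite -kj coln_colseq // (leq_trans kb).
rewrite /sqn -[X in dot _ X]E -segv_dot //.
rewrite big_nat_cond [RHS]big_nat_cond; apply: eq_bigr => k; rewrite andbT => kab.
rewrite expr2 /x (big_rem k) ?mem_index_iota //= eqxx; congr (_ * _).
rewrite big_seq_cond big1 ?addr0 // => j; rewrite rem_filter ?iota_uniq //.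
rewrite mem_filter mem_index_iota /= => /andP[/andP[/eqP jk jab] /eqP jc].
by case: jk; apply: (one_row_inj ab).
Qed.

Lemma one_row_size a b (cs : seq nat) : one_row a b -> uniq cs -> cs =i colseq A ->
  (b - a <= size cs)%N.
Proof.
move=> ab U E; have [bN _] := ab.
have -> : (b - a = size [seq coln A k | k <- index_iota a b])%N.
  by rewrite size_map size_iota.
apply: uniq_leq_size.
  rewrite map_inj_in_uniq ?iota_uniq // => j k; rewrite !mem_index_iota.
  exact: one_row_inj.
move=> c /mapP[k]; rewrite mem_index_iota => /andP[_ kb] ->.
by rewrite E coln_colseq // (leq_trans kb).
Qed.

(** The Gram matrix of the first [b] entries, written as a sum over pairs of entries in a common
    row. In this form it is defined at every cut and grows by a rank-one matrix when a whole row is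
    appended. *)
Definition gram b : 'M[R]_d.+1 :=
  \matrix_(p, q) \sum_(0 <= j < b) \sum_(0 <= k < b)
    (rown A j == rown A k)%:R * (valr A j * (coln A j == p)%:R) * (valr A k * (coln A k == q)%:R).

Lemma gram0 : gram 0 = 0.
Proof. by apply/matrixP => p q; rewrite !mxE big_geq. Qed.

Lemma gram_full : gram (nnz A) = A^T *m A.
Proof.
apply/matrixP => p q; rewrite !mxE.
pose y r := \sum_(0 <= k < nnz A | rown A k == r) valr A k * (coln A k == q)%:R.
have yE (i : 'I_n) : y i = A i q.
  rewrite /y (entries_row A (fun c => (c == q)%:R)) (bigD1 q) //= eqxx mulr1.
  rewrite big1 ?addr0 // => j ne.
  by rewrite (_ : (j == q :> nat) = false) ?mulr0 //; exact/negbTE.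
transitivity (\sum_(0 <= k < nnz A | coln A k == p) valr A k * y (rown A k)).
  rewrite [RHS]big_nat_natr; apply: eq_bigr => j _.
  rewrite mulrAC /y [X in _ = _ * X]big_nat_natr mulr_sumr; apply: eq_bigr => k _.
  by rewrite eq_sym; ring.
rewrite entries_col; apply: eq_bigr => i _; by rewrite yE mxE.
Qed.

Lemma gramS (a b : nat) : (a <= b)%N -> one_row a b ->
  (forall j k : nat, (j < a)%N -> (a <= k < b)%N -> rown A j <> rown A k) ->
  gram b = gram a + segv A a b *m (segv A a b)^T.
Proof.
move=> ab [bN rowE] sep; apply/matrixP => p q; rewrite !mxE big_ord1 !mxE.
pose f j k : R := (rown A j == rown A k)%:R * (valr A j * (coln A j == p)%:R) *
  (valr A k * (coln A k == q)%:R).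
have z1 j k : (j < a)%N -> (a <= k < b)%N -> f j k = 0.
  by move=> ja kab; rewrite /f (introF eqP (sep _ _ ja kab)) !mul0r.
have z2 j k : (j < a)%N -> (a <= k < b)%N -> f k j = 0.
  by move=> ja kab; rewrite /f eq_sym (introF eqP (sep _ _ ja kab)) !mul0r.
rewrite (@big_cat_nat _ _ _ a) //=; congr (_ + _).
  rewrite big_nat_cond [RHS]big_nat_cond; apply: eq_bigr => j /andP[/andP[_ ja] _].
  rewrite (@big_cat_nat _ _ _ a) //= [X in _ + X]big_nat_cond [X in _ + X]big1 ?addr0 // => k.
  by rewrite andbT => kab; exact: z1.
rewrite [X in _ = X * _]big_nat_natr [X in _ = _ * X]big_nat_natr big_distrl /= big_nat_cond [RHS]big_nat_cond; apply: eq_bigr => j.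
rewrite andbT => jab; rewrite (@big_cat_nat _ _ _ a) //= [X in X + _]big_nat_cond [X in X + _]big1 ?add0r.
  rewrite big_distrr /= big_nat_cond [RHS]big_nat_cond; apply: eq_bigr => k.
  by rewrite andbT => kab; rewrite (rowE j k) // eqxx mul1r.
by move=> k /andP[/andP[_ ka] _]; exact: z2.
Qed.

End Entries.

Definition nnz_cell := IGet 0 (INum 2).

Definition pre_frob : cmd :=
  For 11 (INum 0) nnz_cell (RSet 5 (INum 0) (RAdd (RGet 5 (INum 0))
    (RMul (RGet 0 (iv 11)) (RGet 0 (iv 11))))).

(** Marks in array 3, initially zero, tell in constant time whether a column is new, so the list is
    built in one pass over the entries and without touching [d] cells. *)
Definition pre_cols : cmd :=
  For 11 (INum 0) nnz_cell
    (If (BLti (IGet 3 (IGet 2 (iv 11))) (INum 1))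
      (ISet 4 (iv 5) (IGet 2 (iv 11)) ;;
       iset0 5 (IAdd (iv 5) (INum 1)) ;;
       ISet 3 (IGet 2 (iv 11)) (INum 1))
      Skip).

(** Twice [nnz A] slots: one half for the proportional shares and one half for rounding them up. *)
Definition pre_size : cmd :=
  iset0 9 (INum 1) ;;
  While (BLti (iv 9) (IAdd nnz_cell nnz_cell))
    (iset0 9 (IAdd (iv 9) (iv 9)) ;; iset0 8 (IAdd (iv 8) (INum 1))).

(** Gives the row with entries [iv 12 .. iv 11] and squared norm [rv 7] its
    share of the slots, rounded up. *)
Definition flush : cmd :=
  iset0 13 (INum 0) ;;
  While (BLtr (RMul (RNat (iv 13)) (RMul (rnum 2) (rv 5))) (RMul (rv 7) (RNat (iv 9))))
    (iset0 13 (IAdd (iv 13) (INum 1))) ;;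
  For 27 (INum 0) (iv 13)
    (ISet 6 (iv 10) (iv 12) ;;
     ISet 7 (iv 10) (IAdd (iv 11) (INum 1)) ;;
     RSet 6 (iv 10) (RDiv (RNat (iv 9)) (RNat (iv 13))) ;;
     iset0 10 (IAdd (iv 10) (INum 1))) ;;
  rset0 7 (rnum 0) ;;
  iset0 12 (IAdd (iv 11) (INum 1)).

Definition pre_slots : cmd :=
  iset0 11 (INum 0) ;;
  While (BLti (iv 11) nnz_cell)
    (rset0 7 (RAdd (rv 7) (RMul (RGet 0 (iv 11)) (RGet 0 (iv 11)))) ;;
     If (BAnd (BLti (IAdd (iv 11) (INum 1)) nnz_cell)
              (BLti (IGet 1 (IAdd (iv 11) (INum 1))) (IAdd (IGet 1 (iv 11)) (INum 1))))
       Skip flush ;;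
     iset0 11 (IAdd (iv 11) (INum 1))).

Section Prelude.
Variables (R : realType) (n d : nat) (A : 'M[R]_(n, d.+1)).
Implicit Types (s : state R).

Lemma dspec_pre_frob s : data_ok A s -> rmem s 5 0 = 0 ->
  dspec pre_frob s (30 * nnz A + 20) (fun s' => rmem s' 5 0 = frob A).
Proof.
move=> [E0 _ _ _ Er] E5.
apply: (dspec_weaken (dspec_addloop (m := 0) (N := nnz A) (ixv := fun=> 0%N)
    (g := fun k => valr A k ^+ 2) _ _ _ _ _) (leqnn _)) => //=.
- by move=> s1 [sb _]; rewrite sb.
- by move=> k s1 _ ik [sb sb']; rewrite ik sb' // Er expr2.
- by rewrite subn0; clear; lia.
- by move=> s' [_ E]; rewrite E E5 add0r -frob_entries.
Qed.

Lemma dspec_pre_cols s : data_ok A s -> imem s 3 = (fun=> 0%N) -> imem s 5 0 = 0%N ->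
  dspec pre_cols s (50 * nnz A + 20) (cols_ok (colseq A)).
Proof.
move=> [E0 _ _ E2 _] E3 E5.
pose Inv k s1 := [/\ imem s1 0 = imem s 0, imem s1 2 = imem s 2,
  uniq (mkseq (imem s1 4) (imem s1 5 0)),
  mkseq (imem s1 4) (imem s1 5 0) =i take k (colseq A) &
  forall j, imem s1 3 j = (j \in take k (colseq A))].
apply: (@dspec_weaken _ _ _ (50 * nnz A + 20) _ (fun s' => Inv (nnz A) s' /\ imem s' 11 0 = nnz A)) => //.
- apply: (@dspec_for _ _ _ _ _ 0%N (nnz A) 33) => //.
  + by move=> k s1 _ [J0 _ _ _ _] _; rewrite /= J0.
  + split; rewrite /seti /upd /= ?E5 ?E3 ?take0 //.
  + move=> k s1 /andP[_ kN] [J0 J2 JU JE J3] ik.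
    have tk : take k.+1 (colseq A) = rcons (take k (colseq A)) (coln A k).
      by rewrite (take_nth 0%N) // size_map.
    apply: (@dspec_if _ _ _ _ _ 24); last by rewrite /=.
    rewrite /= ik J2 E2 J3; case: ifPn; rewrite ltnS leqn0 eqb0 => cn.
      apply: (@dspec_weaken _ _ _ (8 + (8 + 8)) _ _ _ _ _ (fun s' h => h)) => //.
      pose c := coln A k; pose N := imem s1 5 0.
      apply: (dspec_seq (Q1 := fun s2 => [/\ imem s2 0 = imem s1 0, imem s2 2 = imem s1 2, imem s2 5 = imem s1 5,
          imem s2 3 = imem s1 3 & imem s2 11 = imem s1 11 /\
          mkseq (imem s2 4) N.+1 = rcons (mkseq (imem s1 4) N) c])).
        apply: dspec_iset => //=; split=> //; split=> //.
        rewrite ik J2 E2 mkseqS; congr rcons; last by rewrite /upd !eqxx.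
        apply/eq_in_map => j; rewrite mem_iota /upd eqxx /= => jN.
        by rewrite ltn_eqF.
      move=> s2 [K0 K2 K5 K3 [K11 K4]].
      apply: (dspec_seq (Q1 := fun s3 => [/\ imem s3 0 = imem s1 0, imem s3 2 = imem s1 2, imem s3 5 0 = N.+1,
          imem s3 3 = imem s1 3 & imem s3 11 = imem s1 11 /\
          mkseq (imem s3 4) N.+1 = rcons (mkseq (imem s1 4) N) c])).
        by apply: dspec_iset => //=; split=> //; rewrite /upd /= K5 addn1.
      move=> s3 [L0 L2 L5 L3 [L11 L4]].
      apply: dspec_iset => //; set s4 := seti _ _ _.
      have F a : a != 3%N -> a != 11%N -> imem s4 a = imem s3 a by move=> a3 a11; rewrite /= !upd_ne.
      have F3 j : imem s4 3 j = (if j == c then 1%N else imem s1 3 j).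
        by rewrite /s4 /seti /= upd_ne // /upd /= L11 ik L2 J2 E2 L3.
      split; [by rewrite F // L0|by rewrite F // L2| | |].
      * by rewrite !F // L5 L4 rcons_uniq JU andbT JE.
      * by move=> j; rewrite !F // L5 L4 tk !mem_rcons !inE JE.
      * by move=> j; rewrite F3 J3 tk mem_rcons inE; case: eqP.
    apply: dspec_skip => //; have ck : coln A k \in take k (colseq A) by move: cn; case: (_ \in _).
    split; rewrite /seti /upd /= //.
    * by move=> j; rewrite JE tk mem_rcons inE; case: eqP => // ->.
    * by move=> j; rewrite J3 tk mem_rcons inE; case: eqP => // ->; rewrite ck.
  + by rewrite subn0 /=; clear; lia.
- by move=> s' [[_ _ U E _] _]; split=> //; move=> j; rewrite E take_oversize // size_map.
Qed.

Lemma dspec_pre_size s : data_ok A s -> (0 < nnz A)%N -> imem s 8 0 = 0%N ->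
  dspec pre_size s (160 * nnz A + 40) (fun s' => exists e,
    [/\ imem s' 8 0 = e, imem s' 9 0 = (2 ^ e)%N, (2 * nnz A <= 2 ^ e)%N & (2 ^ e <= 4 * nnz A)%N]).
Proof.
move=> [E0 _ _ _ _] nz E8.
pose g e := (2 ^ e < 2 * nnz A)%N.
have [e [ge gk]] : exists e, ~~ g e /\ forall k, (k < e)%N -> g k.
  by apply: first_nat; exists (2 * nnz A)%N; rewrite /g -leqNgt ltnW // ltn_expl.
have e4 : (2 ^ e <= 4 * nnz A)%N.
  case: e {ge} gk => [|e] gk; first by clear -nz; lia.
  by have := gk _ (ltnSn e); rewrite /g expnS; clear; lia.
have ee : (e < 2 ^ e)%N by rewrite ltn_expl.
pose Inv k s1 := [/\ imem s1 0 = imem s 0, imem s1 9 0 = (2 ^ k)%N & imem s1 8 0 = k].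
apply: (@dspec_weaken _ _ _ (5 + (e * (16 + 8 + 1) + 8 + 1)) _ (Inv e)).
- apply: (dspec_seq (Q1 := Inv 0%N)); first by apply: dspec_iset => //=; split.
  move=> s1 I1; apply: (dspec_while_n (tau := 16)) I1; last first.
    by move=> s2 [J0 J9 J8]; rewrite /= J0 J9 E0 addnn -mul2n.
  move=> k s2 ke [J0 J9 J8]; split; first by rewrite /= J0 J9 E0 addnn -mul2n; exact: gk.
  apply: (@dspec_weaken _ _ _ (8 + 8) _ _ _ _ _ (fun s' h => h)) => //.
  apply: (dspec_seq (Q1 := fun s3 => [/\ imem s3 0 = imem s 0, imem s3 9 0 = (2 ^ k.+1)%N & imem s3 8 0 = k])).
    by apply: dspec_iset => //=; split=> //; rewrite /upd /= J9 addnn expnS mul2n.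
  by move=> s3 [L0 L9 L8]; apply: dspec_iset => //=; split=> //; rewrite /upd /= L8 addn1.
- by clear -e4 ee nz; lia.
- by move=> s' [_ J9 J8]; exists e; split=> //; rewrite leqNgt.
Qed.

End Prelude.

(** * Filling the table of slots *)

Section Slots.
Variables (R : realType) (n d : nat) (A : 'M[R]_(n, d.+1)).
Implicit Types (s : state R).

(** [m] is [rn S / (2 F)] rounded up. The first inequality bounds [(S / m) rn], the weighted squared
    norm of the row, by [2 F]; the second limits the number of slots spent. With weight [S / m] in
    each of [m] slots the row counts [S] times in total, so the sampling is unbiased despite the
    rounding. *)
Lemma dspec_flush s (F rn : R) (S NS b k : nat) :
  0 < F -> rmem s 5 0 = F -> rmem s 7 0 = rn -> imem s 9 0 = S -> imem s 10 0 = NS ->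
  imem s 12 0 = b -> imem s 11 0 = k ->
  exists m : nat, [/\ rn * S%:R <= m%:R * (2 * F),
    forall i, (i < m)%N -> i%:R * (2 * F) < rn * S%:R &
    dspec flush s (90 * m + 90) (fun s' =>
      [/\ imem s' 10 0 = (NS + m)%N, rmem s' 7 0 = 0, imem s' 12 0 = k.+1 &
      [/\ forall i, imem s' 6 i = (if (NS <= i < NS + m)%N then b else imem s 6 i),
      forall i, imem s' 7 i = (if (NS <= i < NS + m)%N then k.+1 else imem s 7 i) &
      forall i, rmem s' 6 i = (if (NS <= i < NS + m)%N then S%:R / m%:R else rmem s 6 i)]])].
Proof.
move=> F0 EF Ern ES ENS Eb Ek.
pose g i := i%:R * (2 * F) < rn * S%:R.
have [m [gm gk]] : exists e, ~~ g e /\ forall k, (k < e)%N -> g k.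
  apply: first_nat; have F2 : 0 < 2 * F by rewrite mulr_gt0.
  have [e He] := exists_pow2 (rn * S%:R) F2.
  by exists (2 ^ e)%N; rewrite /g -leNgt [_ * (2 * F)]mulrC.
exists m; split=> //; first by rewrite leNgt.
pose J s1 := [/\ imem s1 9 0 = S, imem s1 10 0 = NS, imem s1 12 0 = b, imem s1 11 0 = k &
  [/\ imem s1 6 = imem s 6, imem s1 7 = imem s 7 & rmem s1 = rmem s]].
apply: (@dspec_weaken _ _ _ (5 + ((m * (10 + 16 + 1) + 16 + 1) + ((m * 50 + 20) + (10 + 10)))) _ _ _ _ _
  (fun s' h => h)); last by clear; lia.
apply: (dspec_seq (Q1 := fun s1 => J s1 /\ imem s1 13 0 = 0%N)).
  by apply: dspec_iset => //=; split.
move=> s1 I1; apply: (dspec_seq (Q1 := fun s1 => J s1 /\ imem s1 13 0 = m)).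
  apply: (dspec_while_n (tau := 10) (Inv := fun k s1 => J s1 /\ imem s1 13 0 = k)) I1; last first.
    by move=> s2 [[J9 _ _ _ [_ _ Jr]] J13]; rewrite /= J9 J13 Jr EF Ern.
  move=> i s2 im [[J9 J10 J12 J11 [J6 J7 Jr]] J13]; split.
    by rewrite /= J9 J13 Jr EF Ern; exact: gk.
  by apply: dspec_iset => //=; split; [split|rewrite /upd /= J13 addn1].
move=> {I1} s2 [[J9 J10 J12 J11 [J6 J7 Jr]] J13].
pose Inv i s3 := [/\ imem s3 9 0 = S, imem s3 10 0 = (NS + i)%N, imem s3 12 0 = b,
  imem s3 11 0 = k & imem s3 13 0 = m] /\
  [/\ forall j, imem s3 6 j = (if (NS <= j < NS + i)%N then b else imem s 6 j),
      forall j, imem s3 7 j = (if (NS <= j < NS + i)%N then k.+1 else imem s 7 j) &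
      forall j, rmem s3 6 j = (if (NS <= j < NS + i)%N then S%:R / m%:R else rmem s 6 j)].
apply: (dspec_seq (Q1 := Inv m)).
  apply: (@dspec_weaken _ _ _ (m * 50 + 20) _ (fun s' => Inv m s' /\ imem s' 27 0 = m)) => //; last by move=> s' [].
  apply: (@dspec_for _ _ _ _ _ 0%N m 38) => //.
  - by move=> i s3 _ [[_ _ _ _ E] _] _; exact: E.
  - split; first by split=> //; rewrite addn0.
    by split=> j; rewrite addn0 /seti /= ?upd_ne // ?J6 ?J7 ?Jr; case: ltngtP.
  - move=> i s3 /andP[_ im] [[K9 K10 K12 K11 K13] [K6 K7 Kr]] ii.
    have iN (j : nat) : (NS <= j < NS + i.+1)%N = (j == (NS + i)%N) || (NS <= j < NS + i)%N.
      by apply/idP/idP; clear; lia.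
    apply: (@dspec_weaken _ _ _ (8 + (10 + (12 + 8))) _ _ _ _ _ (fun s' h => h)) => //.
    pose C s4 := [/\ imem s4 9 0 = S, imem s4 10 0 = (NS + i)%N, imem s4 12 0 = b,
      imem s4 11 0 = k & imem s4 13 0 = m].
    apply: (dspec_seq (Q1 := fun s4 => C s4 /\
      [/\ forall j, imem s4 6 j = (if (NS <= j < NS + i.+1)%N then b else imem s 6 j),
       imem s4 7 = imem s3 7 & rmem s4 6 = rmem s3 6])).
      apply: dspec_iset => //=; split=> //; split=> // j.
      by rewrite /upd /= K10 K12 K6 iN; case: eqP.
    move=> s4 [[L9 L10 L12 L11 L13] [L6 L7 Lr]].
    apply: (dspec_seq (Q1 := fun s5 => C s5 /\
      [/\ forall j, imem s5 6 j = (if (NS <= j < NS + i.+1)%N then b else imem s 6 j),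
       forall j, imem s5 7 j = (if (NS <= j < NS + i.+1)%N then k.+1 else imem s 7 j) & rmem s5 6 = rmem s3 6])).
      apply: dspec_iset => //=; split=> //; split=> // j.
      by rewrite /upd /= L10 L11 L7 K7 iN addn1; case: eqP.
    move=> s5 {s4 L9 L10 L12 L11 L13 L6 L7 Lr} [[L9 L10 L12 L11 L13] [L6 L7 Lr]].
    apply: (dspec_seq (Q1 := fun s6 => C s6 /\
      [/\ forall j, imem s6 6 j = (if (NS <= j < NS + i.+1)%N then b else imem s 6 j),
       forall j, imem s6 7 j = (if (NS <= j < NS + i.+1)%N then k.+1 else imem s 7 j) &
       forall j, rmem s6 6 j = (if (NS <= j < NS + i.+1)%N then S%:R / m%:R else rmem s 6 j)])).
      apply: dspec_rset => //=; split=> //; split=> // j.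
      by rewrite /upd /= L10 L9 L13 Lr Kr iN; case: eqP.
    move=> s6 {s5 L9 L10 L12 L11 L13 L6 L7 Lr} [[L9 L10 L12 L11 L13] [L6 L7 Lr]].
    apply: dspec_iset => //; set s7 := seti _ _ _.
    have E10 : imem s7 10 0 = (NS + i.+1)%N by rewrite /s7 /seti /upd /= L10 addn1 addnS.
    have Fr a : a != 10%N -> a != 27%N -> imem s7 a = imem s6 a by move=> a1 a2; rewrite /= !upd_ne.
    split; first by split=> //; rewrite Fr.
    by split=> j; [rewrite Fr|rewrite Fr|exact: Lr].
  - by rewrite subn0 /=; clear; lia.
move=> s3 [[K9 K10 K12 K11 K13] [K6 K7 Kr]].
apply: (dspec_seq (Q1 := fun s4 => [/\ imem s4 = imem s3, rmem s4 7 0 = 0 & rmem s4 6 = rmem s3 6])).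
  by apply: dspec_rset => //=; split.
move=> s4 [L1 L2 L3].
apply: dspec_iset => //; set s5 := State _ _.
have Fr a : a != 12%N -> imem s5 a = imem s3 a by move=> a1; rewrite /= !upd_ne // L1.
split; [by rewrite Fr|exact: L2|by rewrite /s5 /upd /= L1 K11 addn1|].
by split=> j; [rewrite Fr|rewrite Fr|rewrite /= L3].
Qed.

Variable S : nat.
Hypothesis S2 : (2 * nnz A <= S)%N.
Hypothesis F0 : 0 < frob A.
Let F := frob A.
Let sumsq a b : R := \sum_(a <= j < b) valr A j ^+ 2.

Definition slot_good s i : Prop :=
  [/\ (imem s 6 i <= imem s 7 i <= nnz A)%N, (imem s 7 i - imem s 6 i <= imem s 5 0)%N,
      0 <= rmem s 6 i & rmem s 6 i * sqn (slotv A s i) <= 2 * F].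

Definition static_ok s : Prop :=
  [/\ data_ok A s, cols_ok (colseq A) s, rmem s 5 0 = F & imem s 9 0 = S].

(** [b] is where the current row starts and [k] is the cursor. If [b < k], entry [k] exists and
    continues the row, since otherwise the row would have been flushed; the last clause says that
    rows before [b] never return. *)
Definition seg_ok (b k : nat) : Prop :=
  [/\ (b <= k <= nnz A)%N,
      (b < k)%N -> (k < nnz A)%N /\ (forall j, (b <= j < k)%N -> rown A j = rown A k) &
      forall j j', (j < b)%N -> (b <= j' < nnz A)%N -> rown A j <> rown A j'].

(** Slots not yet used have weight zero and an empty segment, so drawing one contributes nothing and
    the table may keep its size. The last clause counts the slots spent: proportional shares plus at
    most one per flushed row, hence per entry, for rounding. *)
Definition table_ok (b : nat) s : Prop :=
  [/\ forall i, (i < imem s 10 0)%N -> slot_good s i,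
      forall i, (imem s 10 0 <= i)%N -> [/\ imem s 6 i = 0%N, imem s 7 i = 0%N & rmem s 6 i = 0],
      \sum_(0 <= i < imem s 10 0) rmem s 6 i *: (slotv A s i *m (slotv A s i)^T) = S%:R *: gram A b &
      (imem s 10 0)%:R * (2 * F) <= S%:R * sumsq 0 b + 2 * F * b%:R].

Definition slots_inv s : Prop := exists k b,
  [/\ static_ok s, imem s 11 0 = k /\ imem s 12 0 = b, seg_ok b k,
      rmem s 7 0 = sumsq b k & table_ok b s].

(** The shares sum to at most [S / 2], since the squared norms sum to at most [F], and the rounding
    costs at most [nnz A <= S / 2]. *)
Lemma table_le b s : (b <= nnz A)%N -> table_ok b s -> (imem s 10 0 <= S)%N.
Proof.
move=> bN [_ _ _ H].
have h1 : sumsq 0 b <= F.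
  rewrite /F -frob_entries (@big_cat_nat _ _ _ b) //= lerDl.
  by apply: sumr_ge0 => j _; exact: sqr_ge0.
have h2 : (2 * nnz A)%:R <= S%:R :> R by rewrite ler_nat.
have h3 : b%:R <= (nnz A)%:R :> R by rewrite ler_nat.
have S0 : 0 <= S%:R :> R by rewrite ler0n.
have h4 := ler_wpM2l S0 h1.
have h5 : 2 * F * b%:R <= S%:R * F.
  rewrite natrM in h2.
  have := ler_wpM2l (ltW F0) (le_trans (ler_wpM2l (ler0n R 2) h3) h2).
  by rewrite -/F; lra.
rewrite -(ler_nat R) -(@ler_pM2r _ (2 * F)) ?mulr_gt0 //.
by apply: le_trans H _; lra.
Qed.

Lemma seg_next b k : seg_ok b k -> (k.+1 < nnz A)%N -> rown A k.+1 = rown A k ->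
  seg_ok b k.+1.
Proof.
move=> [/andP[bk kN] seg sep] k1 E; split=> //; first by rewrite (leqW bk) ltnW.
move=> _; split=> // j /andP[bj]; rewrite ltnS leq_eqVlt => /predU1P[->|jk]; first by rewrite E.
have [|_ ->] := seg; first exact: leq_ltn_trans bj jk.
  by rewrite E.
by rewrite bj.
Qed.

(** As row indices do not decrease, the strict comparison with [rown A k + 1] tests equality of
    rows. When it fails, or the entries are exhausted, the row is complete and all later rows are
    larger. *)
Lemma seg_flush b k : seg_ok b k -> (k < nnz A)%N ->
  ~~ ((k.+1 < nnz A)%N && (rown A k.+1 < rown A k + 1)%N) ->
  one_row A b k.+1 /\ seg_ok k.+1 k.+1.
Proof.
move=> [/andP[bk _] seg sep] kN cond.
have E j : (b <= j < k.+1)%N -> rown A j = rown A k.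
  move=> /andP[bj]; rewrite ltnS leq_eqVlt => /predU1P[-> //|jk].
  have [|_ H] := seg; first exact: leq_ltn_trans bj jk.
  by apply: H; rewrite bj.
split; first by split=> // j j' hj hj'; rewrite !E.
split; [by rewrite leqnn|by rewrite ltnn|].
move=> j j'; rewrite ltnS => jk /andP[kj' j'N].
have h : (rown A k < rown A j')%N.
  move: cond; rewrite (leq_ltn_trans kj' j'N) /= -leqNgt addn1 => h.
  by apply: leq_trans h _; apply: rown_mono.
have [bj|jb] := leqP b j.
  by rewrite E ?bj //; move=> e; move: h; rewrite e ltnn.
by apply: sep => //; rewrite (leq_trans bk (ltnW kj')).
Qed.

Lemma dspec_pre_slots s : static_ok s ->
  (forall i, [/\ imem s 6 i = 0%N, imem s 7 i = 0%N & rmem s 6 i = 0]) ->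
  rmem s 7 0 = 0 -> imem s 10 0 = 0%N -> imem s 12 0 = 0%N ->
  dspec pre_slots s (250 * nnz A + 90 * S + 20) (fun s' =>
    [/\ static_ok s',
      forall i, (i < S)%N -> slot_good s' i &
      \sum_(0 <= i < S) rmem s' 6 i *: (slotv A s' i *m (slotv A s' i)^T) = S%:R *: (A^T *m A)]).
Proof.
move=> st z7 E7 E10 E12.
(* A flush into [m] slots costs about [90 m] and is paid by the slots it uses up, which [table_le]
   keeps below [S]; the other work is paid by the advance of the cursor. *)
pose pot s1 := (250 * (nnz A - imem s1 11 0) + 90 * (S - imem s1 10 0))%N.
apply: (@dspec_weaken _ _ _ (5 + (250 * nnz A + 90 * S + 10)) _
  (fun s' => slots_inv s' /\ ~~ beval s' (BLti (iv 11) nnz_cell))); last first.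
- move=> s' [[k [b [st' [E11 Eb] [/andP[bk kN] seg sep] _ tab]]]] /=.
  have [[E0 _ _ _ _] _ _ _] := st'.
  rewrite E11 E0 -leqNgt => Nk; have {kN Nk} kE : k = nnz A by apply/eqP; rewrite eqn_leq kN.
  (* A row still open would continue at entry [k], which lies beyond the last one. *)
  have bE : b = nnz A.
    apply/eqP; rewrite eqn_leq -{1}kE bk leqNgt; apply/negP => bN.
    by have [] := seg; rewrite kE // ltnn.
  have NSS := table_le (eq_leq bE) tab.
  have [T1 T2 T3 _] := tab.
  split=> // [i iS|].
    have [iN|Ni] := ltnP i (imem s' 10 0); first exact: T1.
    have [a6 a7 ar] := T2 i Ni.
    by split; rewrite ?a6 ?a7 ?ar ?mul0r // mulr_ge0 // ltW.
  rewrite (@big_cat_nat _ _ _ (imem s' 10 0)) //= T3 bE gram_full.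
  rewrite [X in _ + X]big_nat_cond [X in _ + X]big1 ?addr0 // => i /andP[/andP[Ni _] _].
  by have [_ _ ->] := T2 i Ni; rewrite scale0r.
- by clear; lia.
have I0 : slots_inv (seti 11 0 s).
  have [dok cok EF ES] := st.
  exists 0%N, 0%N; split=> //.
  - by rewrite -[LHS]/(rmem s 7 0) E7 /sumsq big_geq.
  - rewrite /table_ok /= !upd_ne // E10; split=> //; first by rewrite !big_geq // gram0 scaler0.
    by rewrite /sumsq big_geq // !mulr0 mul0r addr0.
apply: (dspec_seq (Q1 := fun s1 => slots_inv s1 /\ pot s1 = (250 * nnz A + 90 * S)%N)).
  apply: dspec_iset => //; rewrite -/(seti 11 0 s); split=> //.
  by rewrite /pot /seti /upd /= E10 !subn0.
move=> s1 [I1 p1].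
have W := @dspec_while _ (BLti (iv 11) nnz_cell) _ s1 slots_inv pot _ I1.
apply: (dspec_weaken (W _ _)) => //; last by rewrite p1 /=; clear; lia.
move=> {s1 I1 p1 W I0} s1 [k [b [st1 [E11 Eb] sg Ern tab]]] /= bs.
have [dok cok EF ES] := st1; have [E0 _ E1 E2 Er] := dok.
rewrite E11 E0 in bs.
have [/andP[bk _] _ _] := sg.
pose J s2 := [/\ imem s2 = imem s1, rmem s2 5 = rmem s1 5, rmem s2 0 = rmem s1 0,
  rmem s2 6 = rmem s1 6 & rmem s2 7 0 = sumsq b k.+1].
have st2 s2 : J s2 -> static_ok s2 by move=> [a1 a2 a3 a4 _]; rewrite /static_ok /data_ok /cols_ok a1 a2 a3.
have tab2 s2 : J s2 -> table_ok b s2.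
  by move=> [a1 a2 a3 a4 _]; rewrite /table_ok /slot_good /slotv a1 a4.
pose cond := (k.+1 < nnz A)%N && (rown A k.+1 < rown A k + 1)%N.
pose cb := BAnd (BLti (IAdd (iv 11) (INum 1)) nnz_cell)
              (BLti (IGet 1 (IAdd (iv 11) (INum 1))) (IAdd (IGet 1 (iv 11)) (INum 1))).
have condE s2 : J s2 -> beval s2 cb = cond.
  by move=> [a1 _ _ _ _]; rewrite /= a1 E11 E0 E1 addn1.
have D1 : dspec (rset0 7 (RAdd (rv 7) (RMul (RGet 0 (iv 11)) (RGet 0 (iv 11))))) s1 14 J.
  apply: dspec_rset => //=; split=> //.
  by rewrite /upd /= E11 Er Ern /sumsq big_nat_recr //= expr2.
have [c|nc] := boolP cond.
  exists (14 + (30 + 6))%N; apply: (dspec_seq D1) => s2 J2.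
  apply: (dspec_seq (Q1 := J)).
    by apply: (@dspec_if _ _ _ _ _ 2) => //; rewrite (condE _ J2) c; apply: dspec_skip.
  move=> s3 J3; have [a1 a2 a3 a4 a7] := J3.
  apply: dspec_iset => //=; split; last first.
    by rewrite /pot /upd /= a1 E11; clear -bs; lia.
  have /andP[k1 k2] := c.
  have rE : rown A k.+1 = rown A k.
    apply/eqP; rewrite eqn_leq; apply/andP; split; last exact: rown_mono.
    by move: k2; rewrite addn1 ltnS.
  exists k.+1, b; split.
  - by have [[b0 b0' b1 b2 br] bc bF bS] := st2 _ J3; split.
  - by rewrite /upd /= a1 E11 addn1.
  - exact: seg_next.
  - exact: a7.
  - exact: (tab2 _ J3).
have [one sg'] := seg_flush sg bs nc.
have [s2 [t2 [tt2 ex2 J2]]] := D1.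
have [a1 a2 a3 a4 a7] := J2.
have FF : 0 < F by [].
have [||||||m [m1 m2 D2]] := @dspec_flush s2 F (sumsq b k.+1) S (imem s1 10 0) b k FF.
- by rewrite a2.
- exact: a7.
- by rewrite a1.
- by rewrite a1.
- by rewrite a1.
- by rewrite a1.
exists (14 + ((90 * m + 120) + 6))%N.
apply: (@dspec_seq _ _ _ _ _ _ (fun s' => s' = s2)); first by exists s2, t2.
move=> _ ->.
have D3 := dspec_frame D2.
have D4 : dspec (If cb Skip flush) s2 (90 * m + 120) (fun s' =>
  ([/\ imem s' 10 0 = (imem s1 10 0 + m)%N, rmem s' 7 0 = 0, imem s' 12 0 = k.+1 &
      [/\ forall i, imem s' 6 i = (if (imem s1 10 0 <= i < imem s1 10 0 + m)%N then b else imem s2 6 i),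
      forall i, imem s' 7 i = (if (imem s1 10 0 <= i < imem s1 10 0 + m)%N then k.+1 else imem s2 7 i) &
      forall i, rmem s' 6 i = (if (imem s1 10 0 <= i < imem s1 10 0 + m)%N then S%:R / m%:R else rmem s2 6 i)]])
  /\ frame flush s2 s').
  apply: (@dspec_if _ _ _ _ _ (90 * m + 90)); last by rewrite /=; clear; lia.
  by rewrite (condE _ J2) (negbTE nc).
apply: (dspec_seq D4) => s3 [[F10 F7 F12 [F6 F7' FR]] fr].
apply: dspec_iset => //.
have F11 : imem s3 11 0 = k by rewrite (fr.1 11%N isT) a1.
set s4 := State _ _.
have Fr a : a != 11%N -> imem s4 a = imem s3 a by move=> ?; rewrite /= upd_ne.
have st4 : static_ok s4.
  have [[b0 b0' b1 b2 br] bc bF bS] := st2 _ J2.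
  have e5 : imem s3 5 = imem s2 5 by rewrite (fr.1 5%N isT).
  have e4 : imem s3 4 = imem s2 4 by rewrite (fr.1 4%N isT).
  split.
  - by split; rewrite ?Fr // ?(fr.1 0%N isT) // ?(fr.1 1%N isT) // ?(fr.1 2%N isT) // /= (fr.2 0%N isT).
  - by move: bc; rewrite /cols_ok !Fr // e5 e4.
  - by rewrite /= (fr.2 5%N isT).
  - by rewrite Fr // (fr.1 9%N isT).
have tab4 : table_ok k.+1 s4.
  have [T1 T2 T3 T4] := tab.
  set NS := imem s1 10 0 in F10 F6 F7' FR T1 T2 T3 T4.
  pose ir i := (NS <= i < NS + m)%N.
  have e10 : imem s4 10 0 = (NS + m)%N by rewrite (Fr 10%N).
  have e5 : imem s4 5 = imem s1 5 by rewrite (Fr 5%N) // (fr.1 5%N isT) a1.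
  have e6 i : imem s4 6 i = (if ir i then b else imem s1 6 i) by rewrite (Fr 6%N) // F6 a1.
  have e7 i : imem s4 7 i = (if ir i then k.+1 else imem s1 7 i) by rewrite (Fr 7%N) // F7' a1.
  have er i : rmem s4 6 i = (if ir i then S%:R / m%:R else rmem s1 6 i) by rewrite /= FR a4.
  have ev i : slotv A s4 i = (if ir i then segv A b k.+1 else slotv A s1 i).
    by rewrite /slotv e6 e7; case: ifP.
  pose rn := sumsq b k.+1.
  have rnE : sqn (segv A b k.+1) = rn by exact: sqn_segv.
  have rn0 : 0 < rn.
    rewrite /rn /sumsq big_nat_recr //= ltr_wpDl //.
      by apply: sumr_ge0 => j _; exact: sqr_ge0.
    by rewrite exprn_even_gt0 //= valr_neq0.
  have S0 : 0 < S%:R :> R by rewrite ltr0n; clear -S2 bs; lia.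
  have m0 : (0 < m)%N.
    rewrite lt0n; apply/eqP => m0; move: m1; rewrite m0 mul0r leNgt.
    by rewrite mulr_gt0.
  have mR : 0 < m%:R :> R by rewrite ltr0n.
  have irN i : (i < NS)%N -> ir i = false by move=> h; rewrite /ir leqNgt h.
  have [dok4 [cU cE] _ _] := st4.
  split.
  - move=> i; rewrite e10 => iN; rewrite /slot_good e5 ev er e6 e7.
    case: ifPn => iri; last first.
      by apply: T1; move: iri; rewrite /ir; clear -iN; lia.
    split.
    + by rewrite (leqW bk).
    + have := one_row_size one cU cE; rewrite size_map size_iota.
      by rewrite e5.
    + by rewrite divr_ge0 // ler0n.
    + by rewrite rnE mulrAC ler_pdivrMr // mulrC [leRHS]mulrC.
  - move=> i; rewrite e10 => Ni; rewrite e6 e7 er.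
    have -> : ir i = false by rewrite /ir; clear -Ni; lia.
    by apply: T2; clear -Ni; lia.
  - rewrite e10 (@big_cat_nat _ _ _ NS) ?leq_addr //=.
    rewrite (@eq_big_nat _ _ _ 0%N NS _ (fun i => rmem s1 6 i *: (slotv A s1 i *m (slotv A s1 i)^T))); last first.
      by move=> i /andP[_ iN]; rewrite er ev irN.
    rewrite T3 (@eq_big_nat _ _ _ NS (NS + m)%N _ (fun=> (S%:R / m%:R) *: (segv A b k.+1 *m (segv A b k.+1)^T))); last first.
      by move=> i iri; rewrite er ev /ir iri.
    have [_ _ sep] := sg.
    rewrite sumr_const_nat addKn (@gramS _ _ _ A b k.+1) ?(leqW bk) //; last first.
      by move=> j j' jb /andP[bj j'k]; apply: sep => //; rewrite bj (leq_trans j'k).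
    rewrite scalerDr; congr (_ + _).
    by rewrite -(@scaler_nat R _ m) scalerA mulrCA mulfV ?mulr1 // gt_eqF.
  - rewrite e10 natrD mulrDl.
    have -> : sumsq 0 k.+1 = sumsq 0 b + rn.
      by rewrite /sumsq (@big_cat_nat _ _ _ b) ?(leqW bk).
    have h1 : m%:R * (2 * F) <= rn * S%:R + 2 * F.
      have := m2 m.-1; rewrite ltn_predL m0 => /(_ isT) h.
      have mE : m%:R = m.-1%:R + 1 :> R by rewrite natr1 prednK.
      rewrite mE; move: h; rewrite -/rn; move: (m.-1%:R : R) (F) (rn) (S%:R : R) => y f r q; lra.
    have h2 : b%:R + 1 <= k.+1%:R :> R by rewrite natr1 ler_nat ltnS.
    have h3 := ler_wpM2l (ltW FF) h2.
    move: T4 h1 h3; move: (NS%:R : R) (m%:R : R) (k.+1%:R : R) (b%:R : R) (sumsq 0 b) (F) (rn) (S%:R : R) => x1 x2 x3 x4 x5 f r q; lra.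
split.
  exists k.+1, k.+1; split=> //.
  - by rewrite (Fr 12%N) // F12 /s4 /upd /= F11 addn1.
  - by rewrite /= F7 /sumsq big_geq.
have := table_le bs tab4; rewrite Fr // F10 => NS1.
rewrite /pot (Fr 10%N) // F10 E11; have -> : imem s4 11 0 = k.+1 by rewrite /s4 /upd /= F11 addn1.
by clear -bs NS1; lia.
Qed.

End Slots.

(** * Accuracy parameters and the complete prelude *)

Definition idbl e := IAdd e e.

(** The accuracy parameters: [2 ^ L * (lambda gamma eps delta) >= 64 d],
    [K = 6 L], [Q = 16 K ^ 2]. *)
Definition pre_par : cmd :=
  rset0 35 (rnum 1) ;;
  iset0 26 (INum 0) ;;
  While (BLtr (RMul (rv 35) (RMul (RMul (RGet 2 (INum 0)) (RGet 2 (INum 1)))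
                                  (RMul (RGet 2 (INum 2)) (RGet 2 (INum 3)))))
              (RMul (rnum 64) (RNat (IGet 0 (INum 1)))))
    (rset0 35 (RAdd (rv 35) (rv 35)) ;; iset0 26 (IAdd (iv 26) (INum 1))) ;;
  iset0 14 (IAdd (idbl (idbl (iv 26))) (idbl (iv 26))) ;;
  iset0 15 (INum 0) ;;
  For 28 (INum 0) (iv 14) (iset0 15 (IAdd (iv 15) (idbl (idbl (idbl (idbl (iv 14))))))).

Definition prelude : cmd :=
  pre_par ;; pre_frob ;; pre_cols ;; pre_size ;; pre_slots.

Section Prelude.
Variables (R : realType) (n d : nat) (A : 'M[R]_(n, d.+1)).
Implicit Types (s : state R).

(** The first clause serves the accuracy. The second, minimality, bounds [L] by a logarithm in
    [L_le_log]. *)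
Definition level_ok (P : R) (L : nat) : Prop :=
  64 * d.+1%:R <= (2 ^ L)%:R * P /\
  forall k, (k < L)%N -> (2 ^ k)%:R * P < 64 * d.+1%:R.

Lemma dspec_pre_par s (P : R) : imem s 0 1 = d.+1 -> 0 < P ->
  rmem s 2 0 * rmem s 2 1 * (rmem s 2 2 * rmem s 2 3) = P ->
  exists L, level_ok P L /\
    dspec pre_par s (700 * L + 100) (fun s' =>
      imem s' 14 0 = (6 * L)%N /\ imem s' 15 0 = (16 * (6 * L) ^ 2)%N).
Proof.
move=> E01 P0 EP.
pose g k := (2 ^ k)%:R * P < 64 * d.+1%:R.
have [L [gL gk]] : exists e, ~~ g e /\ forall k, (k < e)%N -> g k.
  apply: first_nat; have [m Hm] := exists_pow2 (64 * d.+1%:R) P0.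
  by exists m; rewrite /g -leNgt [_ * P]mulrC.
exists L; split; first by split=> //; rewrite leNgt.
set K := (6 * L)%N.
pose J s1 := imem s1 0 = imem s 0 /\ rmem s1 2 = rmem s 2.
apply: (@dspec_weaken _ _ _ (5 + (5 + ((L * (17 + 21 + 1) + 21 + 1) + (20 + (5 + (K * 70 + 20)))))) _ _ _ _ _
  (fun s' h => h)); last by rewrite /K; clear; lia.
apply: (dspec_seq (Q1 := fun s1 => J s1 /\ rmem s1 35 0 = 1)); first by apply: dspec_rset => //=; split.
move=> s1 [[J0 J2] J35].
pose Inv k s2 := [/\ J s2, rmem s2 35 0 = (2 ^ k)%:R & imem s2 26 0 = k].
apply: (dspec_seq (Q1 := Inv 0%N)); first by apply: dspec_iset => //=; split=> //; split.
move=> s2 {s1 J0 J2 J35} I2.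
apply: (dspec_seq (Q1 := Inv L)).
  apply: (dspec_while_n (tau := 17)) I2; last first.
    by move=> s3 [[J0 J2] E _]; rewrite /= J2 E EP J0 E01.
  move=> k s3 kL [[J0 J2] E E']; split; first by rewrite /= J2 E EP J0 E01; exact: gk.
  apply: (@dspec_weaken _ _ _ (7 + 10) _ _ _ _ _ (fun s' h => h)) => //.
  apply: (dspec_seq (Q1 := fun s4 => [/\ J s4, rmem s4 35 0 = (2 ^ k.+1)%:R & imem s4 26 0 = k])).
    by apply: dspec_rset => //=; split=> //; rewrite /upd /= E expnS natrM; ring.
  by move=> s4 [J4 F F']; apply: dspec_iset => //=; split=> //; rewrite /upd /= F' addn1.
move=> s3 [J3 _ E26].
apply: (dspec_seq (Q1 := fun s4 => imem s4 14 0 = K)).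
  by apply: dspec_iset => //=; rewrite /upd /= E26 /K; clear; lia.
move=> s4 E14.
apply: (dspec_seq (Q1 := fun s5 => imem s5 14 0 = K /\ imem s5 15 0 = 0%N)).
  by apply: dspec_iset.
move=> s5 [F14 F15].
(* Integer expressions have no product, so [16 K^2] is accumulated by adding [16 K] in each of [K]
   rounds. *)
pose I k s6 := imem s6 14 0 = K /\ imem s6 15 0 = (16 * (k * K))%N.
apply: (@dspec_weaken _ _ _ (K * 70 + 20) _ (fun s' => I K s' /\ imem s' 28 0 = K)) => //; last first.
  by move=> s' [[-> ->] _].
apply: (@dspec_for _ _ _ _ _ 0%N K 54) => //.
- by move=> k s6 _ [E _] _.
- move=> k s6 /andP[_ kK] [E E'] _.
  apply: dspec_iset => //=; split=> //=.
  by rewrite /seti /upd /= E E'; clear; lia.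
- by rewrite subn0 /=; clear; lia.
Qed.

Variables (l gam eps de : R) (v : 'cV[R]_d.+1).
Let s0 := input A l gam eps de v [::].
Notation N := (size (undup (colseq A))).

Lemma cols_count s : cols_ok (colseq A) s -> imem s 5 0 = N.
Proof.
move=> [U E]; rewrite -[LHS](size_mkseq (imem s 4)).
apply: perm_size; apply: uniq_perm => //; first exact: undup_uniq.
by move=> j; rewrite E mem_undup.
Qed.

Lemma dspec_prelude (P : R) : (0 < nnz A)%N -> 0 < frob A ->
  P = l * gam * (eps * de) -> 0 < P ->
  exists L ell, [/\ level_ok P L, (2 ^ ell <= 4 * nnz A)%N &
    dspec prelude s0 (700 * L + 850 * nnz A + 300) (fun s' =>
      [/\ base A l N ell (6 * L) (16 * (6 * L) ^ 2) s', rmem s' 2 1 = gam,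
          rmem s' 1 = rmem s0 1 & rmem s' 4 = fun=> 0])].
Proof.
move=> nz F0 PE P0.
have [//||L [lev DL]] := @dspec_pre_par s0 P _ P0; first by rewrite PE.
have z0 a i : (2 < a)%N -> imem s0 a i = 0%N.
  by move=> a2; rewrite /s0 /input /= /load [nth [::] _ a]nth_default ?nth_nil.
have r0 a i : (2 < a)%N -> rmem s0 a i = 0.
  move=> a2; rewrite /s0 /input /= /load.
  case: a a2 => [|[|[|[|a]]]] // _; first by rewrite nth_nil.
  by rewrite /= nth_nil nth_nil.
have dok0 : data_ok A s0 by split.
pose c1 := pre_par ;; pre_frob ;; pre_cols.
have D1 : dspec c1 s0 (700 * L + 100 + (30 * nnz A + 20 + (50 * nnz A + 20))) (fun s' =>
    [/\ data_ok A s', cols_ok (colseq A) s', rmem s' 5 0 = frob A &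
        imem s' 14 0 = (6 * L)%N /\ imem s' 15 0 = (16 * (6 * L) ^ 2)%N]).
  apply: (dspec_seq (Q1 := fun s1 => [/\ data_ok A s1, imem s1 3 = (fun=> 0%N), imem s1 5 0 = 0%N,
      rmem s1 5 0 = 0 & imem s1 14 0 = (6 * L)%N /\ imem s1 15 0 = (16 * (6 * L) ^ 2)%N])).
    apply: (dspec_weaken (dspec_frame DL) (leqnn _)) => s1 [E f]; split=> //.
    - by rewrite /data_ok !(f.1 0%N) // !f.1 // f.2.
    - by rewrite f.1 //; apply/funext => i; rewrite z0.
    - by rewrite f.1 // z0.
    - by rewrite f.2 // r0.
  move=> s1 [dok1 E3 E5 G5 EK].
  apply: (dspec_seq (Q1 := fun s2 => [/\ data_ok A s2, imem s2 3 = (fun=> 0%N), imem s2 5 0 = 0%N,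
      rmem s2 5 0 = frob A & imem s2 14 0 = (6 * L)%N /\ imem s2 15 0 = (16 * (6 * L) ^ 2)%N])).
    apply: (dspec_weaken (dspec_frame (dspec_pre_frob dok1 G5)) (leqnn _)) => s2 [E f]; split=> //.
    - by rewrite /data_ok !(f.1 0%N) // !f.1 // f.2.
    - by rewrite f.1.
    - by rewrite f.1.
    - by rewrite !f.1.
  move=> s2 [dok2 {}E3 {}E5 {}G5 {}EK].
  apply: (dspec_weaken (dspec_frame (dspec_pre_cols dok2 E3 E5)) (leqnn _)) => s3 [E f]; split=> //.
  - by rewrite /data_ok !(f.1 0%N) // !f.1 // f.2.
  - by rewrite f.2.
  - by rewrite !f.1.
have [s1 [t1 [tt1 ex1 [dok1 cok1 G5 [EK EQ]]]]] := D1.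
have f1 := exec_frame (ex1 [::]).
have E8 : imem s1 8 0 = 0%N by rewrite f1.1 // z0.
have [s2 [t2 [tt2 ex2 [ell [F8 F9 l2 l4]]]]] := dspec_pre_size dok1 nz E8.
have f2 := exec_frame (ex2 [::]).
have dok2 : data_ok A s2 by rewrite /data_ok !(f2.1 0%N) // !f2.1 // f2.2.
have cok2 : cols_ok (colseq A) s2 by rewrite /cols_ok !f2.1.
have st2 : static_ok A (2 ^ ell) s2 by split=> //; rewrite f2.2.
have [||||s3 [t3 [tt3 ex3 [[dok3 cok3 H5 H9] sg sm]]]] := dspec_pre_slots l2 F0 st2.
- by move=> i; rewrite !f2.1 // !f1.1 // f2.2 // f1.2 // !z0 // r0.
- by rewrite f2.2 // f1.2 // r0.
- by rewrite f2.1 // f1.1 // z0.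
- by rewrite f2.1 // f1.1 // z0.
have f3 := exec_frame (ex3 [::]).
exists L, ell; split=> //.
exists s3, (t1 + (t2 + t3))%N; split.
- apply: leq_trans (leq_add tt1 (leq_add tt2 tt3)) _; clear -l4.
  by move: (2 ^ ell)%N l4 => S; lia.
- move=> w; have := ex1 w; rewrite /c1 => H; move: H.
  inversion 1 as [| | | |? ? ? ? sa ? ? ? ta tb Ha Hb| | |]; subst.
  inversion Hb as [| | | |? ? ? ? sb ? ? ? tc td Hc Hd| | |]; subst.
  rewrite -!addnA; apply: ExecSeq Ha _; apply: ExecSeq Hc _; apply: ExecSeq Hd _.
  exact: ExecSeq (ex2 _) (ex3 _).
have R2 : rmem s3 2 = rmem s0 2 by rewrite f3.2 // f2.2 // f1.2.
split.
- split.
  + split=> //; last by rewrite R2.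
    split.
    * by rewrite H9 f3.1 // F8.
    * by move=> i; rewrite H9 => /sg[].
    * by move=> i; rewrite H9 => /sg[].
    * by move=> i; rewrite H9 => /sg[].
    * by rewrite H9 sm.
  + exact: cols_count.
  + by rewrite f3.1.
  + by rewrite f3.1 // f2.1.
  + by rewrite f3.1 // f2.1.
- by rewrite R2.
- by rewrite f3.2 // f2.2 // f1.2.
- by rewrite f3.2 // f2.2 // f1.2 //; apply/funext => i; rewrite r0.
Qed.

End Prelude.

(** * Accuracy *)

Section Sign.
Variables (R : realType) (K : nat) (mu : R).
Hypothesis mu0 : 0 < mu.
Implicit Types (x c : R).
Let c0 := mu * (2 ^ K)%:R.

Definition damp c x := c ^+ 2 / (x ^+ 2 + c ^+ 2).
Definition shift_at j := mu * (2 ^ (K - j))%:R.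

Fixpoint rungs j x : R :=
  if j is j'.+1 then bser K (3 / 4 * damp (shift_at j') x) * rungs j' x else 1.

Definition sgnf x := x * c0^-1 * (bser K (1 * damp mu x) * rungs K x).

Lemma shift_at_gt0 j : 0 < shift_at j.
Proof. by rewrite mulr_gt0 // ltr0n expn_gt0. Qed.

Lemma damp01 c x : 0 < c -> 0 <= damp c x <= 1.
Proof.
move=> c1; have c2 : 0 < c ^+ 2 by rewrite exprn_gt0.
have x2 : 0 <= x ^+ 2 by rewrite sqr_ge0.
rewrite /damp divr_ge0 ?addr_ge0 ?(ltW c2) //=.
by rewrite ler_pdivrMr ?mul1r; lra.
Qed.

Lemma rungs_ge1 j x : 1 <= rungs j x.
Proof.
elim: j => //= j IH; rewrite -[leLHS]mulr1; apply: ler_pM => //.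
by apply: bser_ge1; have /andP[g0 _] := damp01 x (shift_at_gt0 j); rewrite mulr_ge0 //; lra.
Qed.

Let q : R := (3 / 4) ^+ K.+1.

Lemma q01 : 0 <= q <= 1.
Proof. by rewrite exprn_ge0 ?exprn_ile1 //; lra. Qed.

(** With exact inverse square roots this would not depend on [j]: a rung lowers the shift in the
    first factor and compensates in the second. Truncation multiplies it by [(1 - u) bser(u)^2]. *)
Let T j x := (x ^+ 2 + shift_at j ^+ 2) * rungs j x ^+ 2.

(** Halving the shift gives [u <= 3/4], so by [bser_bounds] each rung multiplies [T] by a factor
    between [1 - q] and 1. *)
Lemma T_le j x : (j <= K)%N -> (1 - q) ^+ j * T 0 x <= T j x <= T 0 x.
Proof.
elim: j => [|j IH] jK; first by rewrite expr0 mul1r lexx.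
have /andP[lo hi] := IH (ltnW jK).
have c1 := shift_at_gt0 j; have c2 : 0 < shift_at j ^+ 2 by rewrite exprn_gt0.
have x2 : 0 <= x ^+ 2 by rewrite sqr_ge0.
set u := 3 / 4 * damp (shift_at j) x.
have /andP[g0 g1] := damp01 x c1.
have u0 : 0 <= u by rewrite mulr_ge0 //; lra.
have u34 : u <= 3 / 4 by rewrite /u; lra.
have u1 : u <= 1 by lra.
have cS : shift_at j = 2 * shift_at j.+1.
  by rewrite /shift_at subnS -[in LHS](prednK (n := K - j)) ?subn_gt0 // expnS natrM; ring.
have TE : T j.+1 x = (1 - u) * bser K u ^+ 2 * T j x.
  rewrite /T /= -/u; move: (bser K u) => b; rewrite /u /damp cS; field.
  by rewrite -cS; apply: lt0r_neq0; lra.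
have /andP[b1 b2] := bser_bounds K (introT andP (conj u0 u1)).
have uq : u ^+ K.+1 <= q by rewrite /q lerXn2r // nnegrE; lra.
have T0 : 0 <= T j x by rewrite mulr_ge0 ?sqr_ge0 // addr_ge0 // sqr_ge0.
rewrite TE; apply/andP; split; last by apply: le_trans hi; rewrite ler_piMl.
rewrite exprS -mulrA; have /andP[q0 q1] := q01.
apply: ler_pM => //; first by rewrite subr_ge0.
  by rewrite mulr_ge0 ?exprn_ge0 ?subr_ge0 // mulr_ge0 ?sqr_ge0 // addr_ge0 ?sqr_ge0.
by apply: le_trans b1; rewrite lerB.
Qed.

Lemma bernoulli (y : R) k : 0 <= y <= 1 -> 1 - k%:R * y <= (1 - y) ^+ k.
Proof.
case/andP=> y0 y1; elim: k => [|k IH]; first by rewrite mul0r subr0 expr0.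
have ky : 0 <= k%:R * y by rewrite mulr_ge0.
rewrite exprS -natr1; apply: le_trans (ler_wpM2l _ IH); last by rewrite subr_ge0.
have : 0 <= k%:R * y * y by rewrite mulr_ge0.
lra.
Qed.

Variable eta : R.
Hypothesis eta_c0 : (c0 ^+ 2)^-1 <= eta.
Hypothesis eta_q : K.+1%:R * q <= eta.

Lemma c0_gt0 : 0 < c0. Proof. by rewrite mulr_gt0 // ltr0n expn_gt0. Qed.

(** With [u = mu^2 / (x^2 + mu^2)] one has [x^2 = (1 - u) (x^2 + mu^2)], so the last rung has the
    same shape as the others and [sgnf x ^ 2] is [T 0 x / c0^2 = 1 + x^2 / c0^2] times the
    truncation factors, all at most 1. Where [|x| >= mu], [u] is at most 1/2, so that the last
    factor too is at least [1 - q]; Bernoulli's inequality then collects the [K + 1] losses. *)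
Lemma sgnf_sqr x : `|x| <= 1 ->
  sgnf x ^+ 2 <= 1 + eta /\ (mu <= `|x| -> 1 - eta <= sgnf x ^+ 2).
Proof.
move=> x1; have cp := c0_gt0.
have x2 : 0 <= x ^+ 2 by rewrite sqr_ge0.
have x21 : x ^+ 2 <= 1 by rewrite -real_normK ?num_real // expr_le1.
have m2 : 0 < mu ^+ 2 by rewrite exprn_gt0.
set u := 1 * damp mu x.
have /andP[u0 u1] : 0 <= u <= 1 by rewrite /u mul1r damp01.
have /andP[b1 b2] := bser_bounds K (introT andP (conj u0 u1)).
have /andP[lo hi] := T_le x (leqnn K).
have T0 : T 0 x = x ^+ 2 + c0 ^+ 2 by rewrite /T /= /shift_at subn0 expr1n mulr1.
have TK : 0 <= T K x by rewrite mulr_ge0 ?sqr_ge0 // addr_ge0 // sqr_ge0.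
have sE : sgnf x ^+ 2 = (1 - u) * bser K u ^+ 2 * T K x / c0 ^+ 2.
  rewrite /sgnf -/u /T /shift_at subnn expn0 mulr1; move: (bser K u) => b; rewrite /u /damp mul1r; field.
  by rewrite gt_eqF //= lt0r_neq0 //; lra.
have c2 : 0 < c0 ^+ 2 by rewrite exprn_gt0.
have cc : T 0 x / c0 ^+ 2 = x ^+ 2 / c0 ^+ 2 + 1.
  by rewrite T0; field; rewrite gt_eqF.
have ci : 0 <= (c0 ^+ 2)^-1 by rewrite invr_ge0 ltW.
have xc : 0 <= x ^+ 2 / c0 ^+ 2 <= eta.
  rewrite mulr_ge0 //=; apply: le_trans eta_c0.
  by rewrite ler_piMl.
case/andP: xc => xc1 xc2.
split.
  apply: (@le_trans _ _ (T 0 x / c0 ^+ 2)); last by rewrite cc addrC lerD2l.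
  rewrite sE ler_wpM2r //; apply: le_trans hi.
  by rewrite ler_piMl.
move=> mx; have mx2 : mu ^+ 2 <= x ^+ 2.
  by rewrite -[x ^+ 2]real_normK ?num_real // lerXn2r ?nnegrE // ltW.
have uq : u ^+ K.+1 <= q.
  have u34 : u <= 3 / 4 by rewrite /u mul1r /damp ler_pdivrMr; lra.
  by rewrite /q lerXn2r // nnegrE; lra.
have /andP[q0 q1] := q01.
have T00 : 0 <= T 0 x by rewrite T0 addr_ge0 // ltW.
apply: (@le_trans _ _ ((1 - q) ^+ K.+1 * (T 0 x / c0 ^+ 2))).
  have := bernoulli K.+1 q01.
  have p0 : 0 <= (1 - q) ^+ K.+1 by rewrite exprn_ge0 // subr_ge0.
  move: (_ ^+ K.+1) p0 => p p0 pb.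
  have pxc : 0 <= p * (x ^+ 2 / c0 ^+ 2) by rewrite mulr_ge0.
  rewrite cc mulrDr mulr1; move: eta_q pb pxc.
  by move: (K.+1%:R * q) (p * (x ^+ 2 / c0 ^+ 2)) => y z; lra.
have -> : sgnf x ^+ 2 = (1 - u) * bser K u ^+ 2 * (T K x / c0 ^+ 2) by rewrite sE -[LHS]mulrA.
rewrite exprS -[leLHS]mulrA.
have i0 : 0 <= (c0 ^+ 2)^-1 by rewrite invr_ge0 ltW.
have p0 : 0 <= (1 - q) ^+ K by rewrite exprn_ge0 // subr_ge0.
apply: ler_pM.
- by rewrite subr_ge0.
- exact: mulr_ge0 p0 (mulr_ge0 T00 i0).
- by apply: le_trans b1; rewrite lerB.
- by rewrite [leLHS]mulrA; apply: ler_wpM2r.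
Qed.

Lemma sgnf_sg x : 0 <= x * sgnf x.
Proof.
have cp := c0_gt0.
have b0 : 0 <= bser K (1 * damp mu x).
  by apply: le_trans ler01 (bser_ge1 _ _); rewrite mul1r; have /andP[] := damp01 x mu0.
have r0 : 0 <= rungs K x := le_trans ler01 (rungs_ge1 _ _).
have -> : x * sgnf x = x ^+ 2 * c0^-1 * (bser K (1 * damp mu x) * rungs K x).
  by rewrite /sgnf expr2 !mulrA.
apply: mulr_ge0; last exact: mulr_ge0.
by apply: mulr_ge0; [exact: sqr_ge0|rewrite invr_ge0 ltW].
Qed.

Definition projf x := 2^-1 * (1 + sgnf x).

(** The sign comes from [sgnf_sg], and a square within [eta] of 1 puts the absolute value within
    [eta] of 1. Inside the gap only the upper bound on the square is available, which is all that
    the third condition on a PCP asks for. *)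
Lemma projf_bounds x : `|x| <= 1 ->
  [/\ mu <= x -> `|projf x - 1| <= eta / 2, x <= - mu -> `|projf x| <= eta / 2 &
      `|projf x - 1| <= 1 + eta / 2].
Proof.
move=> x1; have [hi lo] := sgnf_sqr x1; have sg := sgnf_sg x; rewrite /projf.
have e0 : 0 <= eta.
  by apply: le_trans eta_c0; rewrite invr_ge0 exprn_ge0 // ltW // c0_gt0.
split=> [mx|mx|].
- have x0 : 0 < x by apply: lt_le_trans mx.
  have s0 : 0 <= sgnf x by rewrite -(pmulr_rge0 _ x0).
  have := lo (le_trans mx (ler_norm x)); rewrite expr2 in hi * => lo'.
  by rewrite ler_norml; move: (sgnf x) s0 hi lo' => s *; apply/andP; split; nra.
- have x0 : x < 0 by apply: le_lt_trans mx _; rewrite oppr_lt0.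
  have s0 : sgnf x <= 0 by rewrite -(nmulr_rge0 _ x0).
  have mx' : mu <= `|x| by rewrite ltr0_norm // lerNr.
  have := lo mx'; rewrite expr2 in hi * => lo'.
  by rewrite ler_norml; move: (sgnf x) s0 hi lo' => s *; apply/andP; split; nra.
- rewrite expr2 in hi; rewrite ler_norml; move: (sgnf x) hi => s *.
  by apply/andP; split; nra.
Qed.

End Sign.

Section Norm.
Variables (R : realType) (d : nat).
Implicit Types (x y : 'cV[R]_d).

Lemma l2normE x : l2norm x = Num.sqrt (sqn x).
Proof. by congr Num.sqrt; apply: eq_bigr => i _; rewrite expr2. Qed.

Lemma l2norm_sqr x : l2norm x ^+ 2 = sqn x.
Proof. by rewrite l2normE sqr_sqrtr // sqn_ge0. Qed.

Lemma l2norm_ge0 x : 0 <= l2norm x.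
Proof. exact: sqrtr_ge0. Qed.

Lemma l2norm_le x (b : R) : 0 <= b -> (l2norm x <= b) = (sqn x <= b ^+ 2).
Proof.
by move=> b0; rewrite -l2norm_sqr ler_pXn2r ?nnegrE ?l2norm_ge0.
Qed.

Lemma dot_le x y : dot x y <= l2norm x * l2norm y.
Proof.
have [x0|x0] := eqVneq (sqn x) 0.
  have /sqn_eq0 -> : sqn x <= 0 by rewrite x0.
  by rewrite dot0l mulr_ge0 ?l2norm_ge0.
have sx : 0 < sqn x by rewrite lt_neqAle eq_sym x0 sqn_ge0.
have [d0|d0] := ltP (dot x y) 0.
  by apply: le_trans (ltW d0) _; rewrite mulr_ge0 ?l2norm_ge0.
rewrite -(@ler_pXn2r _ 2) ?nnegrE ?mulr_ge0 ?l2norm_ge0 //.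
rewrite exprMn !l2norm_sqr.
have := sqn_ge0 (sqn x *: y - dot x y *: x).
rewrite sqnD sqnN !sqnZ dotZl dotNr dotZr (dotC y x) => h.
rewrite -(ler_pM2l sx); move: h; lra.
Qed.

Lemma l2normD x y : l2norm (x + y) <= l2norm x + l2norm y.
Proof.
rewrite l2norm_le ?addr_ge0 ?l2norm_ge0 //.
have := dot_le x y; rewrite sqnD sqrrD -!l2norm_sqr mulr2n; lra.
Qed.

End Norm.

(** * From the scalar bounds to the conditions on a PCP *)

Section Accuracy.
Variables (R : realType) (n d : nat) (A : 'M[R]_(n, d.+1)).
Variables (lam : 'I_d.+1 -> R) (nu : 'I_d.+1 -> 'cV[R]_d.+1).
Hypothesis eig : eigen_decomposition A lam nu.
Hypothesis lam_le1 : lam ord0 <= 1.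
Variables (l gam : R).
Hypothesis l01 : 0 < l < 1.
Hypothesis gam01 : 0 < gam <= 2 / 3.
Implicit Types (x y v w : 'cV[R]_d.+1).
Let mu := gam * l.

Lemma co_wout K v i :
  co nu i (exact_out A lam nu l gam K v) = projf K mu (lam i - l) * co nu i v.
Proof.
have BjE j : co nu i (after_rungs lam nu l gam K v j) = rungs K mu j (lam i - l) * co nu i v.
  elim: j => [|j IH] /=; first by rewrite mul1r.
  by rewrite /rungop (co_ofco eig) IH mulrA.
rewrite /exact_out coZ coD coZ coB (coM eig) coZ /after_all /rungop (co_ofco eig) BjE.
rewrite -/(damp mu (lam i - l)) -/mu /projf /sgnf /ghat -/(damp mu (lam i - l)); ring.
Qed.

Lemma co_eigproj t x i : co nu i (eigproj lam nu t *m x) = (t <= lam i)%R%:R * co nu i x.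
Proof.
have -> : eigproj lam nu t *m x = ofco nu (fun i => (t <= lam i)%R%:R * co nu i x).
  rewrite /eigproj mulmx_suml /ofco big_mkcond; apply: eq_bigr => j _.
  by case: ifP => _; rewrite ?mul1r ?mul0r ?scale0r // mul_rank1.
by rewrite (co_ofco eig).
Qed.

Lemma l2norm_co_le (b : R) x y : 0 <= b ->
  (forall i, `|co nu i x| <= b * `|co nu i y|) -> l2norm x <= b * l2norm y.
Proof.
move=> b0 H; rewrite l2norm_le ?mulr_ge0 ?l2norm_ge0 // exprMn l2norm_sqr.
rewrite !(sqn_co eig) mulr_sumr; apply: ler_sum => i _.
rewrite -real_normK ?num_real // -[co nu i y ^+ 2]real_normK ?num_real // -exprMn.
by rewrite lerXn2r ?nnegrE ?mulr_ge0.
Qed.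

(** The tolerance is split evenly: [eps / 2] for the distance between [w] and the exact output,
    [eta / 2 <= eps / 2] for the approximate sign. The algorithm sees [v'], the restriction of [v]
    to the nonzero columns. *)
Lemma approx_of_close (K : nat) (eps eta : R) v v' w :
  0 < eps -> eta <= eps ->
  (mu * (2 ^ K)%:R) ^- 2 <= eta -> K.+1%:R * (3 / 4) ^+ K.+1 <= eta ->
  A *m v' = A *m v -> sqn v' <= sqn v ->
  sqn (w - exact_out A lam nu l gam K v') <= (eps / 2) ^+ 2 * sqn v ->
  approx_pcp lam nu l gam eps v w.
Proof.
move=> e0 ee h1 h2 AE v'v close.
have /andP[l0 l1] := l01; have /andP[g0 g1] := gam01.
have mu0 : 0 < mu by rewrite mulr_gt0.
have eta0 : 0 <= eta by apply: le_trans h1; rewrite invr_ge0 exprn_ge0 // mulr_ge0 // ltW.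
have mul : mu <= 2 / 3 * l by rewrite ler_pM2r.
pose w0 := exact_out A lam nu l gam K v'; pose D := w - w0.
have nD : l2norm D <= eps / 2 * l2norm v.
  rewrite l2norm_le; last by rewrite mulr_ge0 ?l2norm_ge0 // divr_ge0 // ltW.
  by rewrite exprMn l2norm_sqr.
have nv' : l2norm v' <= l2norm v by rewrite l2norm_le ?l2norm_ge0 // l2norm_sqr.
have nv0 := l2norm_ge0 v.
(* Masking moves [v] within the kernel of [A] only. Both thresholds are positive, because [gam < 1],
   so the projections do not see the difference. *)
have coE i : lam i != 0 -> co nu i v' = co nu i v.
  move=> li; apply: (mulfI li); rewrite -!(coM eig).
  by rewrite -!mulmxA AE.
have xb i : `|lam i - l| <= 1.
  have /andP[a0 a1] := lam01 eig lam_le1 i; rewrite ler_norml; apply/andP; split; lra.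
pose f i := projf K mu (lam i - l).
have fb i := projf_bounds mu0 h1 h2 (xb i).
have w0E i : co nu i w0 = f i * co nu i v' by rewrite /w0 co_wout.
have e2 : eta / 2 * l2norm v <= eps / 2 * l2norm v by rewrite ler_wpM2r // ler_pM2r.
have wE : w = D + w0 by rewrite /D subrK.
apply/and3P; split.
- have -> : eigproj lam nu ((1 + gam) * l) *m (w - v) =
      eigproj lam nu ((1 + gam) * l) *m D + eigproj lam nu ((1 + gam) * l) *m (w0 - v).
    by rewrite -mulmxDr addrA -wE.
  apply: le_trans (l2normD _ _) _.
  have a1 : l2norm (eigproj lam nu ((1 + gam) * l) *m D) <= 1 * l2norm D.
    apply: l2norm_co_le => // i; rewrite co_eigproj mul1r.
    by case: (_ <= lam i); rewrite ?mulr1n ?mul1r ?mulr0n ?mul0r ?normr0.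
  have a2 : l2norm (eigproj lam nu ((1 + gam) * l) *m (w0 - v)) <= eta / 2 * l2norm v.
    apply: l2norm_co_le => [|i]; first by rewrite divr_ge0.
    rewrite co_eigproj; have [li|_] := leP ((1 + gam) * l) (lam i); last by rewrite mulr0n mul0r normr0 mulr_ge0 // divr_ge0.
    have [p1 _ _] := fb i.
    rewrite mulr1n mul1r coB w0E coE; last first.
      by rewrite gt_eqF //; apply: lt_le_trans li; rewrite mulr_gt0 // addr_gt0.
    rewrite -{2}[co nu i v]mul1r -mulrBl normrM ler_wpM2r //; apply: p1.
    by rewrite /mu; lra.
  lra.
- rewrite wE mulmxDr; apply: le_trans (l2normD _ _) _.
  have a1 : l2norm ((1%:M - eigproj lam nu ((1 - gam) * l)) *m D) <= 1 * l2norm D.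
    apply: l2norm_co_le => // i; rewrite mulmxBl mul1mx coB co_eigproj mul1r.
    by case: (_ <= lam i); rewrite ?mulr1n ?mulr0n ?mul1r ?mul0r ?subrr ?normr0 ?subr0.
  have a2 : l2norm ((1%:M - eigproj lam nu ((1 - gam) * l)) *m w0) <= eta / 2 * l2norm v'.
    apply: l2norm_co_le => [|i]; first by rewrite divr_ge0.
    rewrite mulmxBl mul1mx coB co_eigproj.
    have [_|li] := leP ((1 - gam) * l) (lam i); first by rewrite mulr1n mul1r subrr normr0 mulr_ge0 // divr_ge0.
    rewrite mulr0n mul0r subr0 w0E normrM ler_wpM2r //.
    have [_ p2 _] := fb i; apply: p2.
    by rewrite /mu; lra.
  have a3 : eta / 2 * l2norm v' <= eta / 2 * l2norm v by rewrite ler_wpM2l // divr_ge0.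
  lra.
- set P := _ - _.
  have -> : P *m (w - v) = P *m D + P *m (w0 - v) by rewrite -mulmxDr addrA -wE.
  apply: le_trans (l2normD _ _) _.
  have PE x i : co nu i (P *m x) = (((1 + gam) * l <= lam i)%R%:R - ((1 - gam) * l <= lam i)%R%:R) * co nu i x.
    by rewrite /P mulmxBl coB !co_eigproj -mulrBl.
  have a1 : l2norm (P *m D) <= 1 * l2norm D.
    apply: l2norm_co_le => // i; rewrite PE mul1r normrM ler_piMl //.
    by do 2 case: (_ <= lam i); rewrite ?mulr1n ?mulr0n ?subrr ?subr0 ?sub0r ?normr0 ?normrN ?normr1.
  have a2 : l2norm (P *m (w0 - v)) <= (1 + eta / 2) * l2norm (P *m v).
    apply: l2norm_co_le => [|i]; first by rewrite addr_ge0 // divr_ge0.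
    rewrite !PE; have [li|li] := leP ((1 - gam) * l) (lam i); last first.
      have -> : ((1 + gam) * l <= lam i) = false.
        apply/negbTE; rewrite -ltNge; apply: lt_le_trans li _; rewrite ler_pM2r //; lra.
      by rewrite subrr !mul0r normr0 mulr0.
    rewrite coB w0E coE; last first.
      rewrite gt_eqF //; apply: lt_le_trans li; rewrite mulr_gt0 //; lra.
    have [_ _ p3] := fb i.
    rewrite -{2}[co nu i v]mul1r -mulrBl mulrCA normrM.
    by rewrite ler_wpM2r.
  have a3 : l2norm (P *m v) <= 1 * l2norm v.
    apply: l2norm_co_le => // i; rewrite PE mul1r normrM ler_piMl //.
    by do 2 case: (_ <= lam i); rewrite ?mulr1n ?mulr0n ?subrr ?subr0 ?sub0r ?normr0 ?normrN ?normr1.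
  have a4 : eta / 2 * l2norm (P *m v) <= eta / 2 * l2norm v.
    by rewrite ler_wpM2l ?divr_ge0 //; rewrite mul1r in a3.
  rewrite mulrDl mul1r in a2; lra.
Qed.

End Accuracy.

(** * Running time *)

Section Params.
Variables (R : realType) (n d : nat) (A : 'M[R]_(n, d.+1)).
Variables (l gam eps de : R).
Hypothesis l01 : 0 < l < 1.
Hypothesis gam01 : 0 < gam <= 2 / 3.
Hypothesis eps01 : 0 < eps < 1.
Hypothesis de01 : 0 < de < 1.
Variable L : nat.
Hypothesis lev : level_ok d (l * gam * (eps * de)) L.
Let mu := gam * l.
Let z := nnz A.
Let F := frob A.

Lemma mu_bounds : 0 < mu < 1.
Proof.
have /andP[l0 l1] := l01; have /andP[g0 g1] := gam01.
rewrite mulr_gt0 //=; have : mu <= 2 / 3 * l by rewrite ler_pM2r.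
lra.
Qed.

Lemma level_facts : [/\ (6 < L)%N, 64 * d.+1%:R <= (2 ^ L)%:R * mu,
  1 <= (2 ^ L)%:R * eps & 1 <= (2 ^ L)%:R * de].
Proof.
have /andP[m0 m1] := mu_bounds; have /andP[e0 e1] := eps01; have /andP[d0 d1] := de01.
have [hL hk] := lev.
have PE : l * gam * (eps * de) = mu * (eps * de) by rewrite /mu; ring.
rewrite PE in hL hk.
have dd : 1 <= d.+1%:R :> R by rewrite ler1n.
have ed : 0 < eps * de < 1 by rewrite mulr_gt0 // mulr_ilt1 // ltW.
case/andP: ed => ed0 ed1.
have X0 : 0 < (2 ^ L)%:R :> R by rewrite ltr0n expn_gt0.
have q1 : mu * (eps * de) <= mu by rewrite ler_piMr // ltW.
have q2 : mu * (eps * de) <= eps by rewrite mulrCA ler_piMr ?(ltW e0) // mulr_ile1 // ltW.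
have q3 : mu * (eps * de) <= de by rewrite mulrA ler_piMl ?(ltW d0) // mulr_ile1 // ltW.
have le a : mu * (eps * de) <= a -> 64 * d.+1%:R <= (2 ^ L)%:R * a.
  by move=> h; apply: le_trans hL _; rewrite ler_wpM2l // ltW.
split; [|exact: le|by have := le _ q2; lra|by have := le _ q3; lra].
rewrite ltnNge; apply/negP => L6.
have X6 : (2 ^ L)%:R <= (64 : R) by rewrite (ler_nat R _ 64) (@leq_pexp2l 2 L 6).
have : (2 ^ L)%:R * (mu * (eps * de)) < 64.
  apply: (@le_lt_trans _ _ ((2 ^ L)%:R * mu)); first by rewrite ler_wpM2l // ltW.
  apply: (@lt_le_trans _ _ ((2 ^ L)%:R * 1)); last by rewrite mulr1.
  by rewrite ltr_pM2l.
lra.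
Qed.

Hypothesis z0 : (0 < z)%N.
Hypothesis F0 : 0 < F.
Hypothesis Fd : F <= d.+1%:R.

(** In [set_rho] a doubling happens only while [c 2^m < sqrt (d F / nnz)], and [c >= mu]. The factor
    2 accounts for the doubling that ends the search, and the successor in [rhoM] for the case of no
    doubling. *)
Definition prec_ratio : R := 2 * Num.sqrt (d.+1%:R * F / z%:R) / mu.
Definition rhoM : nat := (Num.truncn prec_ratio).+1.

Lemma prec_ratio_ge0 : 0 <= prec_ratio.
Proof.
by have /andP[m0 m1] := mu_bounds; rewrite divr_ge0 ?(ltW m0) // mulr_ge0 // sqrtr_ge0.
Qed.

Lemma rhoM_le : rhoM%:R <= 1 + prec_ratio.
Proof.
rewrite /rhoM -natr1 addrC lerD2l.
by have /andP[] := truncn_itv prec_ratio_ge0.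
Qed.

Lemma zR : 1 <= z%:R :> R. Proof. by rewrite ler1n. Qed.

Lemma prec_ratio_le : prec_ratio <= 2 * d.+1%:R / mu.
Proof.
have /andP[m0 m1] := mu_bounds.
rewrite /prec_ratio ler_pM2r ?invr_gt0 // ler_pM2l //.
rewrite -[leRHS]ger0_norm ?ler0n // -sqrtr_sqr ler_wsqrtr // expr2 -mulrA ler_wpM2l //.
by rewrite ler_pdivrMr ?ltr0n //; have := zR; have : 0 <= d.+1%:R :> R by []; move=> *; apply: le_trans Fd _; rewrite ler_peMr.
Qed.

Lemma rhoM_pow : (rhoM <= 2 ^ L)%N.
Proof.
have /andP[m0 m1] := mu_bounds; have [L7 h _ _] := level_facts.
rewrite -(ler_nat R); apply: le_trans rhoM_le _.
have dd : 1 <= d.+1%:R :> R by rewrite ler1n.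
have r2 : prec_ratio <= (2 ^ L)%:R / 32.
  by apply: le_trans prec_ratio_le _; rewrite ler_pdivrMr //; lra.
have m2 : (2 ^ L)%:R * mu <= (2 ^ L)%:R by rewrite ler_piMr // ltW.
lra.
Qed.

Lemma capR_rhoM c : mu <= c -> capR A rhoM c.
Proof.
move=> mc m h; have /andP[m0 m1] := mu_bounds.
have c0 : 0 < c := lt_le_trans m0 mc.
have z1 : 0 < z%:R :> R by rewrite ltr0n.
have p0 : 0 < (2 ^ m)%:R :> R by rewrite ltr0n expn_gt0.
have h' : mu * (2 ^ m)%:R < Num.sqrt (d.+1%:R * F / z%:R).
  apply: (@le_lt_trans _ _ (c * (2 ^ m)%:R)); first by rewrite ler_wpM2r // ltW.
  rewrite -[ltLHS]ger0_norm ?mulr_ge0 ?(ltW c0) // -sqrtr_sqr.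
  rewrite ltr_sqrt; last by rewrite divr_gt0 // mulr_gt0 // ltr0n.
  by rewrite ltr_pdivlMr // mulrC.
rewrite /rhoM -ltnS; have /andP[_ h2] := truncn_itv prec_ratio_ge0.
rewrite -(ltr_nat R).
apply: (@le_lt_trans _ _ prec_ratio); last first.
  by apply: lt_le_trans h2 _; rewrite ler_nat leqnSn.
by rewrite /prec_ratio ler_pdivlMr // expnS natrM -[leLHS]mulrA ler_pM2l // [leLHS]mulrC ltW.
Qed.

Variables (N ell : nat).
Hypothesis Nz : (N <= z)%N.
Hypothesis Nd : (N <= d.+1)%N.
Hypothesis ellz : (2 ^ ell <= 4 * z)%N.

Definition WM : nat := (400 * 400 * (L * z))%N.

Lemma capW_WM c : mu <= c -> capW A N ell WM c.
Proof.
move=> mc rho T r0 hz hT; have /andP[m0 m1] := mu_bounds.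
have [L7 hL _ _] := level_facts.
set c' := rho%:R * c in hz hT.
have cc : mu <= c'.
  by apply: (le_trans (mc)); rewrite ler_peMl ?ler1n // (le_trans (ltW m0) mc).
have c0 : 0 < c' := lt_le_trans m0 cc.
have c2 : 0 < c' ^+ 2 by rewrite exprn_gt0.
have z1 : 0 < z%:R :> R by rewrite ltr0n.
have dd : 1 <= d.+1%:R :> R by rewrite ler1n.
pose y := F / c' ^+ 2.
have y0 : 0 <= y by rewrite divr_ge0 // ltW.
have TR : T%:R <= 25 + 24 * y.
  case: T hT => [|T] hT; first by rewrite addr_ge0 // mulr_ge0.
  have := hT T (ltnSn T); rewrite -ltr_pdivlMr // -natr1 => h.
  have : 24 * (F + c' ^+ 2) / c' ^+ 2 = 24 + 24 * y by rewrite /y; field; rewrite gt_eqF.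
  by move: h; rewrite -/F; lra.
have yz : d.+1%:R * y <= z%:R by rewrite /y mulrA ler_pdivrMr.
(* The choice of [rho] gives [d y <= nnz], and [N] is at most [d] and at most [nnz]; so the steps of
   an epoch cost no more than a pass over [A]. *)
have TN : (T * N <= 49 * z)%N.
  rewrite -(ler_nat R) !natrM.
  have N1 : N%:R <= d.+1%:R :> R by rewrite ler_nat.
  have N2 : N%:R <= z%:R :> R by rewrite ler_nat.
  have N0 : 0 <= N%:R :> R by [].
  have a1 := ler_wpM2r N0 TR.
  have a2 : N%:R * y <= z%:R by apply: le_trans yz; rewrite ler_wpM2r.
  lra.
have yz1 : y <= z%:R by apply: le_trans yz; rewrite ler_peMl.
have Tz : (T <= 49 * z)%N.
  by rewrite -(ler_nat R) natrM; have := zR; lra.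
have TL : (T <= 26 * 2 ^ (2 * L))%N.
  rewrite -(ler_nat R) natrM.
  have p1 : 1 <= (2 ^ L)%:R :> R by rewrite ler1n expn_gt0.
  have -> : (2 ^ (2 * L))%:R = (2 ^ L)%:R ^+ 2 :> R by rewrite mulnC expnM natrX.
  have yX : y <= (2 ^ L)%:R ^+ 2 / 24.
    rewrite /y ler_pdivrMr // mulrAC -exprMn.
    have b1 : 64 * d.+1%:R <= (2 ^ L)%:R * c' by apply: le_trans hL _; rewrite ler_wpM2l.
    have b2 : (64 * d.+1%:R) ^+ 2 <= ((2 ^ L)%:R * c') ^+ 2.
      by rewrite lerXn2r ?nnegrE // (le_trans _ b1) // mulr_ge0.
    have b3 : d.+1%:R <= d.+1%:R ^+ 2 :> R by rewrite expr2 ler_peMl // (le_trans ler01).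
    move: b2; rewrite exprMn; move: Fd; lra.
  have p2 : 1 <= (2 ^ L)%:R ^+ 2 :> R by rewrite exprn_ege1.
  lra.
(* The [ell] bits per draw are of order [log nnz], and [nnz] is not bounded in terms of the
   parameters behind [L]. Either [ell <= 4 L] and a factor [L] is paid, or the table is so large
   that [T = O(2^(2 L))] and [ell = O(2^(ell - 2 L))] multiply to [O(2^ell) = O(nnz)]. *)
have Tl : (T * ell <= 208 * (L * z))%N.
  have [le4|gt4] := leqP ell (4 * L).
    apply: leq_trans (leq_mul Tz le4) _; clear; nia.
  pose b := (ell - 2 * L)%N.
  have bE : ell = (2 * L + b)%N by rewrite /b; clear -gt4; lia.
  have eb : (ell <= 2 * 2 ^ b)%N.
    have : (b < 2 ^ b)%N by rewrite ltn_expl.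
    by rewrite /b; clear -gt4; move: (2 ^ _)%N => X; lia.
  apply: leq_trans (leq_mul TL eb) _.
  have := ellz; rewrite {1}bE expnD; move: (2 ^ (2 * L))%N (2 ^ b)%N => X Y h.
  by clear -h L7; nia.
have zL : (z <= L * z)%N by rewrite leq_pmull //; clear -L7; lia.
have -> : (T * (420 * (N + ell + 1)) = 420 * (T * N + T * ell + T))%N.
  by rewrite mulnCA !mulnDr muln1.
rewrite /WM -/z; move: TN Tz Tl zL z0 Nz.
by move: (T * N)%N (T * ell)%N (L * z)%N (z) => a b e y1; clear; lia.
Qed.

End Params.

(** * The choice of [K] and [Q] *)

Section Halves.
Variable R : realType.

Lemma pow2_half (a b c : nat) : (a + c <= b)%N -> 2 ^+ a * 2^-1 ^+ b <= 2^-1 ^+ c :> R.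
Proof.
move=> h; apply: (@le_trans _ _ (2 ^+ a * 2^-1 ^+ (a + c))).
  rewrite ler_wpM2l ?exprn_ge0 //; apply: ler_wiXn2l => //; lra.
by rewrite exprD mulrA -exprMn divff ?expr1n ?mul1r.
Qed.

Lemma half_pow_le (L : nat) (x : R) : 1 <= (2 ^ L)%:R * x -> 2^-1 ^+ L <= x.
Proof.
move=> h; rewrite exprVn -natrX -[leLHS]mul1r ler_pdivrMr ?ltr0n ?expn_gt0 //.
by rewrite mulrC.
Qed.

Variables (L rhoM : nat).
Hypothesis L7 : (6 < L)%N.
Hypothesis rhoL : (rhoM <= 2 ^ L)%N.
Let K := (6 * L)%N.
Let Q := (16 * (6 * L) ^ 2)%N.

Lemma QE : Q = (576 * (L * L))%N.
Proof. by rewrite /Q; clear; lia. Qed.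

Lemma rho4_le (j c : nat) : (j + 4 * L + c <= Q)%N ->
  2 ^+ j * rhoM%:R ^+ 4 * 2^-1 ^+ Q <= 2^-1 ^+ c :> R.
Proof.
move=> h; apply: le_trans (pow2_half h).
rewrite ler_wpM2r ?exprn_ge0 // exprD ler_wpM2l ?exprn_ge0 // mulnC exprM -(natrX R 2 L).
by rewrite lerXn2r ?nnegrE // ler_nat.
Qed.

Lemma small_par : 64 * rhoM%:R ^+ 4 * 2^-1 ^+ Q <= 1 :> R.
Proof.
have := @rho4_le 6 0; rewrite expr0; have -> : 2 ^+ 6 = 64 :> R by rewrite -natrX.
by apply; rewrite QE; clear -L7; nia.
Qed.

Lemma tau1_le_pow c : (7 + 4 * L + c <= Q)%N -> tau1 R Q rhoM <= 2^-1 ^+ c.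
Proof.
move=> h; apply: le_trans (rho4_le h); rewrite /tau1.
have -> : 2 ^+ 7 = 128 :> R by rewrite -natrX.
have r0 : 0 <= (rhoM%:R : R) ^+ 4 * 2^-1 ^+ Q by rewrite mulr_ge0 ?exprn_ge0.
have -> : 8 * rhoM%:R ^+ 2 / 3 * (25 * rhoM%:R ^+ 2 * 2^-1 ^+ Q) =
  200 / 3 * (rhoM%:R ^+ 4 * 2^-1 ^+ Q) :> R by field.
rewrite -[leRHS]mulrA; move: (_ * _) r0 => y y0; lra.
Qed.

Lemma tau1_sixth : tau1 R Q rhoM <= 1 / 6.
Proof.
apply: (@le_trans _ _ (2^-1 ^+ 3)); last by rewrite !exprS expr0; lra.
by apply: tau1_le_pow; rewrite QE; clear -L7; nia.
Qed.

(** From [K + 1 <= 2^K] the exponent is [3 K + 2 + 2 K]. *)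
Lemma growth_le : growth R K <= 2 ^+ (6 * K).
Proof.
rewrite /growth; have -> : (8 : R) = 2 ^+ 3 by rewrite -natrX.
have -> : (4 : R) = 2 ^+ 2 by rewrite -natrX.
have KK : K.+1%:R <= 2 ^+ K :> R by rewrite -natrX ler_nat ltn_expl.
apply: (@le_trans _ _ ((2 ^+ 3) ^+ K * (2 ^+ 2 * (2 ^+ K) ^+ 2))).
  by rewrite ler_wpM2l ?exprn_ge0 // ler_wpM2l ?exprn_ge0 // lerXn2r ?nnegrE // exprn_ge0.
rewrite -!exprM -!exprD; apply: ler_weXn2l; first by rewrite ler1n.
by rewrite /K; clear -L7; lia.
Qed.

(** The [K + 1] rungs amplify by at most [2^(6 K (K + 1))]. The [16 K^2] halvings outweigh this
    together with the [4 L] bits lost to [rhoM^4] and the [3 L + O(1)] bits demanded by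
    [de (eps / 2)^2], the level at which Markov's inequality is applied. *)
Lemma fail_le (eps de x y : R) : 1 <= (2 ^ L)%:R * eps -> 1 <= (2 ^ L)%:R * de ->
  0 <= x <= y -> growth R K ^+ K.+1 * (2 * tau1 R Q rhoM * x) <= de * ((eps / 2) ^+ 2 * y).
Proof.
move=> /half_pow_le he /half_pow_le hd /andP[x0 xy].
pose j := (6 * K * K.+1)%N.
have G1 : growth R K ^+ K.+1 <= 2 ^+ j.
  by rewrite /j exprM lerXn2r ?nnegrE ?exprn_ge0 ?growth_ge0 // growth_le.
have t0 : 0 <= tau1 R Q rhoM by exact: tau1_ge0.
have t1 : tau1 R Q rhoM <= 2^-1 ^+ (j + (3 * L + 3)).
  by apply: tau1_le_pow; rewrite QE /j /K; clear -L7; nia.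
have h0 : 0 < 2^-1 ^+ L :> R by rewrite exprn_gt0.
have e2 : (2^-1 ^+ L / 2) ^+ 2 <= (eps / 2) ^+ 2.
  have e0 := le_trans (ltW h0) he.
  by rewrite lerXn2r ?nnegrE ?divr_ge0 ?(ltW h0) // ler_pM2r.
apply: (@le_trans _ _ (2 ^+ j * (2 * 2^-1 ^+ (j + (3 * L + 3)) * y))).
  apply: ler_pM => //; first by rewrite exprn_ge0 // growth_ge0.
    by rewrite !mulr_ge0.
  by apply: ler_pM => //; [rewrite mulr_ge0|rewrite ler_wpM2l].
have y0 := le_trans x0 xy.
have -> : 2 ^+ j * (2 * 2^-1 ^+ (j + (3 * L + 3)) * y) = 2^-1 ^+ L * ((2^-1 ^+ L / 2) ^+ 2 * y).
  rewrite exprD mulnC exprD exprM.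
  have : 2 ^+ j * 2^-1 ^+ j = 1 :> R by rewrite -exprMn divff ?expr1n.
  rewrite [2^-1 ^+ 3]exprS [2^-1 ^+ 2]expr2.
  move: (2 ^+ j) (2^-1 ^+ j) (2^-1 ^+ L) => a b c ab.
  transitivity ((a * b) * (2 * (c ^+ 3 * (2^-1 * (2^-1 * 2^-1))) * y)); first by ring.
  by rewrite ab; field.
have hL0 := ltW h0; apply: ler_pM => //; last by rewrite ler_wpM2r.
by rewrite mulr_ge0 // exprn_ge0 // divr_ge0.
Qed.

(** [K = 6 L] because [(3/4)^6 <= 1/4]: of the resulting [2^-L 2^-L] one factor absorbs [K + 1] and
    the other is at most [eps]. *)
Lemma series_eta (eps : R) : 1 <= (2 ^ L)%:R * eps -> K.+1%:R * (3 / 4) ^+ K.+1 <= eps.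
Proof.
move=> /half_pow_le he; apply: le_trans he.
have K2 : K.+1%:R <= 2 ^+ L :> R.
  rewrite -natrX ler_nat /K; move: L7; clear.
  elim: L => // k IH; rewrite ltnS leq_eqVlt => /predU1P[<-//|k6].
  by have := IH k6; rewrite expnS; move: (2 ^ k)%N => X; clear -k6; lia.
have q4 : (3 / 4) ^+ 6 <= (2^-1 ^+ 2 : R) by rewrite !exprS !expr0; lra.
have q1 : (3 / 4) ^+ K.+1 <= 2^-1 ^+ L * 2^-1 ^+ L :> R.
  rewrite exprS /K exprM; apply: (@le_trans _ _ (1 * ((2^-1 ^+ 2) ^+ L))).
    apply: ler_pM; rewrite ?exprn_ge0 //; try lra.
    by rewrite lerXn2r ?nnegrE ?exprn_ge0 //; lra.
  by rewrite mul1r -exprM mulnC exprM expr2.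
apply: (@le_trans _ _ (2 ^+ L * (2^-1 ^+ L * 2^-1 ^+ L))).
  by apply: ler_pM => //; rewrite exprn_ge0 //; lra.
by rewrite mulrA -exprMn divff ?expr1n ?mul1r.
Qed.

Lemma c0_eta (mu eps : R) : 0 < mu -> 1 <= (2 ^ L)%:R * mu -> 1 <= (2 ^ L)%:R * eps ->
  1 <= mu * (2 ^ K)%:R /\ (mu * (2 ^ K)%:R) ^- 2 <= eps.
Proof.
move=> m0 hm he.
have p1 : 1 <= (2 ^ L)%:R :> R by rewrite ler1n expn_gt0.
have KE : (2 ^ K)%:R = (2 ^ L)%:R ^+ 6 :> R by rewrite -natrX -expnM mulnC.
have X6 : (2 ^ L)%:R <= (2 ^ L)%:R ^+ 5 :> R by rewrite -[leLHS]expr1; apply: ler_weXn2l.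
have cE : (2 ^ L)%:R <= mu * (2 ^ K)%:R.
  rewrite KE exprS mulrA [mu * _]mulrC; apply: le_trans X6 _.
  by rewrite ler_peMl // exprn_ge0.
have c1 : 1 <= mu * (2 ^ K)%:R by apply: le_trans cE.
split=> //; apply: le_trans (half_pow_le he).
rewrite exprVn -natrX lef_pV2 ?posrE ?exprn_gt0 ?ltr0n ?expn_gt0 //.
  by apply: le_trans cE _; rewrite expr2 ler_peMl // (le_trans ler01).
by apply: lt_le_trans c1.
Qed.

End Halves.

Section Time.
Variable R : realType.

(** The loops nest as follows: about [K] rungs, [K] terms of a series, [4 rho Q] heavy-ball steps,
    about [Q] epochs of cost at most [W]. *)
Lemma total_le (L z K Q rho W : nat) : (0 < L)%N -> (0 < z)%N -> (0 < rho)%N ->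
  K = (6 * L)%N -> (2 < Q)%N -> (L * z <= W)%N ->
  (700 * L + 850 * z + 300 + (K + 2) * (rung_time K Q rho W + 60) <=
   2400 * (K * K * (Q * Q * (rho * W))))%N.
Proof.
move=> L0 z0 r0 KE Q2 LzW.
have LW : (L <= W)%N by apply: leq_trans LzW; rewrite leq_pmulr.
have zW : (z <= W)%N by apply: leq_trans LzW; rewrite leq_pmull.
have K5 : (5 < K)%N by rewrite KE; clear -L0; lia.
set B := (Q * Q * (rho * W))%N.
have W0 : (0 < W)%N := leq_trans L0 LW.
have Q0 : (0 < Q)%N by clear -Q2; lia.
have QQ0 : (0 < Q * Q)%N by rewrite muln_gt0 Q0.
have rWB : (rho * W <= B)%N by rewrite /B leq_pmull.
have WB : (W <= B)%N by apply: leq_trans rWB; rewrite leq_pmull.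
have rB : (rho <= B)%N by apply: leq_trans rWB; rewrite leq_pmulr.
have sB : (solve_time Q rho W <= 10 * B)%N.
  rewrite /solve_time; apply: (@leq_trans ((5 * rho * Q) * ((2 * Q) * W))).
    apply: leq_mul; first by clear -r0 Q0; nia.
    by rewrite leq_mul2r; apply/orP; right; clear -Q2; lia.
  by rewrite /B; apply: eq_leq; ring.
have rt : (rung_time K Q rho W <= 122 * (K * B))%N.
  rewrite /rung_time.
  have BK : (B <= K * B)%N by rewrite leq_pmull // (leq_trans _ K5).
  have : (K * (solve_time Q rho W + 2 * W) <= K * (12 * B))%N.
    by rewrite leq_mul2l; apply/orP; right; clear -sB WB; lia.
  have -> : (K * (12 * B) = 12 * (K * B))%N by ring.
  by move: (K * (_ + _))%N (K * B)%N BK => x y; clear -rB WB; lia.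
have BK0 : (0 < K * B)%N by rewrite muln_gt0 (leq_trans _ WB) // andbT; clear -K5; lia.
have m1 : ((K + 2) * (rung_time K Q rho W + 60) <= 2 * K * (182 * (K * B)))%N.
  by apply: leq_mul; [clear -K5; lia|clear -rt BK0; lia].
have -> : (K * K * B = K * (K * B))%N by rewrite mulnA.
have E : (2 * K * (182 * (K * B)) = 364 * (K * (K * B)))%N by ring.
have WKB : (W <= K * (K * B))%N.
  apply: leq_trans WB _; rewrite mulnA leq_pmull // muln_gt0; clear -K5; lia.
move: m1; rewrite E; move: ((K + 2) * _)%N (K * (K * B))%N WKB => x y.
by clear -LW zW W0; lia.
Qed.

Definition time_cst : R := 2400 * 36 * (576 ^+ 2 * (400 * 400)).

Lemma time_cst_ge0 : 0 <= time_cst.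
Proof.
apply: mulr_ge0; first by apply: mulr_ge0; exact: ler0n.
apply: mulr_ge0; first by apply: exprn_ge0; exact: ler0n.
by apply: mulr_ge0; exact: ler0n.
Qed.

Lemma total_real (L z rho : nat) :
  (2400 * ((6 * L) * (6 * L) * ((16 * (6 * L) ^ 2) * (16 * (6 * L) ^ 2) *
    (rho * (400 * 400 * (L * z))))))%:R = time_cst * L%:R ^+ 7 * (rho%:R * z%:R) :> R.
Proof. by rewrite /time_cst !(natrM, natrX); ring. Qed.

(** Minimality of [L] gives [2^L <= 128 d / (l gam eps de)]. With [Y] the argument of the logarithm,
    [128 = 2^7 <= Y^7] and the five remaining factors are at most [Y] each, hence the 12. *)
Lemma L_le_log (L d : nat) (l gam eps de nv : R) :
  0 < l < 1 -> 0 < gam -> 0 < eps -> 0 < de -> 0 <= nv -> (0 < L)%N ->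
  level_ok d (l * gam * (eps * de)) L ->
  L%:R <= 12 / ln 2 * ln (2 + l^-1 + gam^-1 + eps^-1 + de^-1 + d.+1%:R + nv).
Proof.
move=> /andP[l0 _] g0 e0 d0 v0 L0 [_ hk].
set Y := 2 + _ + _ + _ + _ + _ + _.
have a1 : 0 < l^-1 by rewrite invr_gt0.
have a2 : 0 < gam^-1 by rewrite invr_gt0.
have a3 : 0 < eps^-1 by rewrite invr_gt0.
have a4 : 0 < de^-1 by rewrite invr_gt0.
have a5 : 0 < d.+1%:R :> R by rewrite ltr0n.
have Y2 : 2 <= Y by rewrite /Y; lra.
have Y0 : 0 < Y by lra.
have ln2 : 0 < ln 2 :> R by rewrite ln_gt0 // ltr1n.
have P0 : 0 < l * gam * (eps * de) by rewrite !mulr_gt0.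
have hL : (2 ^ L)%:R <= Y ^+ 12.
  have := hk L.-1; rewrite ltn_predL => /(_ L0) h.
  have h' : (2 ^ L)%:R <= 128 * d.+1%:R / (l * gam * (eps * de)).
    rewrite ler_pdivlMr // -(prednK L0) expnS natrM -mulrA; lra.
  apply: le_trans h' _; rewrite !invfM.
  have -> : (128 : R) = 2 ^+ 7 by rewrite -natrX.
  have -> : Y ^+ 12 = Y ^+ 7 * Y * (Y * Y * (Y * Y)) by ring.
  have i0 : 0 <= Y by rewrite ltW.
  have p7 : 2 ^+ 7 <= Y ^+ 7 by rewrite lerXn2r ?nnegrE.
  by do ![apply: ler_pM; rewrite ?mulr_ge0 ?exprn_ge0 ?(ltW a1) ?(ltW a2) ?(ltW a3) ?(ltW a4) //];
    rewrite /Y; lra.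
rewrite mulrAC ler_pdivlMr // mulrC.
have -> : ln 2 * L%:R = ln ((2 ^ L)%:R : R).
  by rewrite natrX lnXn // mulr_natr.
have -> : 12 * ln Y = ln (Y ^+ 12) by rewrite lnXn // mulr_natl.
by rewrite ler_ln ?posrE ?ltr0n ?expn_gt0 ?exprn_gt0.
Qed.

End Time.

(** * The bound in terms of the stable rank *)

Section Final.
Variables (R : realType) (n d : nat) (A : 'M[R]_(n, d.+1)).

Lemma sqrt_mul_div (a z : R) : 0 <= a -> 0 < z -> z * Num.sqrt (a / z) = Num.sqrt (z * a).
Proof.
move=> a0 z0; have -> : z * a = z ^+ 2 * (a / z) by field; rewrite gt_eqF.
by rewrite [in RHS]sqrtrM ?sqr_ge0 // sqrtr_sqr gtr0_norm.
Qed.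

(** [nnz sqrt (d F / nnz) = sqrt (nnz d F)] turns the preconditioner ratio into the second term of
    the bound. Passing from [F] to the stable rank [F / l1] uses [l1 <= 1] under the root, and
    [l1 >= 1/2] supplies the [l1] in the numerator of [kappa]; the two factors 2 make the constant
    4. *)
Lemma rhoM_nnz_le (l gam l1 : R) : 0 < l < 1 -> 0 < gam <= 2 / 3 ->
  2^-1 <= l1 <= 1 -> (0 < nnz A)%N -> 0 <= frob A ->
  (rhoM A l gam)%:R * (nnz A)%:R <=
  4 * ((nnz A)%:R + Num.sqrt ((nnz A)%:R * d.+1%:R * stable_rank A l1) * (l1 / l / gam)).
Proof.
move=> l01 g01 /andP[h1 h2] z0 F0.
have /andP[l0 _] := l01; have /andP[g0 _] := g01.
have zp : 0 < (nnz A)%:R :> R by rewrite ltr0n.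
have r1 : (rhoM A l gam)%:R <= 1 + prec_ratio A l gam.
  by rewrite /rhoM -natr1 addrC lerD2l; have /andP[] := truncn_itv (@prec_ratio_ge0 R n d A l gam l01 g01).
apply: le_trans (ler_wpM2r (ltW zp) r1) _.
have lp : 0 < l1 by apply: lt_le_trans h1; rewrite invr_gt0.
set S := Num.sqrt ((nnz A)%:R * d.+1%:R * stable_rank A l1).
have m0 : 0 < (gam * l)^-1 by rewrite invr_gt0 mulr_gt0.
have -> : l1 / l / gam = l1 * (gam * l)^-1 by field; rewrite !gt_eqF.
pose S0 := Num.sqrt ((nnz A)%:R * (d.+1%:R * frob A)).
have a0 : 0 <= d.+1%:R * frob A by rewrite mulr_ge0.
have rz : prec_ratio A l gam * (nnz A)%:R = 2 * S0 * (gam * l)^-1.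
  by rewrite /prec_ratio /S0 -(sqrt_mul_div a0 zp); ring.
have SS : S0 <= S.
  rewrite /S0 /S ler_sqrt; last first.
    by apply: mulr_ge0; [exact: mulr_ge0|apply: divr_ge0 => //; exact: ltW].
  rewrite -mulrA ler_wpM2l // ler_wpM2l // /stable_rank -/(frob A).
  by rewrite ler_pdivlMr // ler_piMr.
have S00 : 0 <= S0 by exact: sqrtr_ge0.
have SL : S0 * 2^-1 <= S * l1 by apply: ler_pM.
rewrite mulrDl mul1r rz mulrDr; apply: lerD; first by rewrite ler_peMl // ?(ltW zp) // ler1n.
have := ler_wpM2r (ltW m0) SL.
rewrite !mulrA; move: (gam * l)^-1 => w; lra.
Qed.

Let maskv (v : 'cV[R]_d.+1) := mvec d.+1 (colseq A) (nth 0 [seq v i 0 | i <- enum 'I_d.+1]).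

Lemma nth_enum_col (v : 'cV[R]_d.+1) (j : 'I_d.+1) :
  nth 0 [seq v i 0 | i <- enum 'I_d.+1] j = v j 0.
Proof. by rewrite (nth_map j) ?size_enum_ord // nth_ord_enum. Qed.

Lemma mul_maskv v : A *m maskv v = A *m v.
Proof.
apply/colP => i; rewrite mul_mvec mxE; apply: eq_bigr => j _.
by rewrite nth_enum_col.
Qed.

Lemma sqn_maskv v : sqn (maskv v) <= sqn v.
Proof.
apply: ler_sum => j _; rewrite !mxE nth_enum_col -!expr2.
by case: ifP => // _; rewrite expr0n sqr_ge0.
Qed.

End Final.

Theorem theorem1 (R : realType) :
  exists (p : cmd) (cst : R -> R -> R -> seq R) (C : R) (k : nat),
  forall (n d : nat) (A : 'M[R]_(n, d.+1))
         (lam : 'I_d.+1 -> R) (nu : 'I_d.+1 -> 'cV[R]_d.+1)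
         (lambda gamma eps delta : R),
    (d.+1 <= n)%N ->
    eigen_decomposition A lam nu ->
    2^-1 <= lam ord0 <= 1 ->
    0 < lambda < lam ord0 ->
    0 < gamma <= 2 / 3 ->
    0 < eps < 1 ->
    0 < delta < 1 ->
    let kappa := lam ord0 / lambda in
    pcp_algorithm p (cst lambda gamma eps) A lam nu lambda gamma eps delta
      (fun v => C * log_factor lambda gamma eps delta v ^+ k *
         ((nnz A)%:R +
          Num.sqrt ((nnz A)%:R * d.+1%:R * stable_rank A (lam ord0)) *
            (kappa / gamma))).
Proof.
(* The exponent 7 counts powers of [L]: two from [K^2], four from [Q^2] and one from the cost of an
   epoch. The factor [12 / ln 2] converts [L] into the logarithm, and 4 comes from [rhoM_nnz_le]. *)
exists (prelude ;; main), (fun _ _ _ => [::]), (time_cst R * (12 / ln 2) ^+ 7 * 4), 7.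
move=> n d A lam nu l gam eps de _ eig l1 l0 g01 e01 d01 kappa v.
have /andP[lh l_le] := l1.
have l01 : 0 < l < 1 by case/andP: l0 => -> h; apply: lt_le_trans h l_le.
have Fh := frob_half eig l_le lh; have Fd := frob_le eig l_le.
have F0 : 0 < frob A by apply: lt_le_trans Fh; rewrite invr_gt0.
have z0 : (0 < nnz A)%N.
  rewrite lt0n; apply/eqP => z0; move: F0.
  by rewrite -frob_entries z0 big_geq // ltxx.
have /andP[lp _] := l01; have /andP[gp _] := g01; have /andP[ep _] := e01; have /andP[dp _] := d01.
have P0 : 0 < l * gam * (eps * de) by rewrite !mulr_gt0.
have [L [ell [lev ellz DP]]] := @dspec_prelude R n d A l gam eps de v _ z0 F0 erefl P0.
have [L7 hL he hd] := level_facts l01 g01 e01 d01 lev.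
have /andP[m0 m1] := mu_bounds l01 g01.
set rho := rhoM A l gam; set W := WM A L; set N := size _ in DP.
set K := (6 * L)%N in DP; set Q := (16 * (6 * L) ^ 2)%N in DP.
have rL : (rho <= 2 ^ L)%N := rhoM_pow l01 g01 e01 d01 lev z0 Fd.
have Nz : (N <= nnz A)%N by rewrite (leq_trans (size_undup _)) // size_map.
have Nd : (N <= d.+1)%N.
  rewrite -(size_iota 0 d.+1); apply: uniq_leq_size; first exact: undup_uniq.
  move=> j; rewrite mem_undup mem_iota /= add0n => /colseqP[k kz <-]; exact: coln_lt.
have hm : 1 <= (2 ^ L)%:R * (gam * l).
  apply: le_trans hL; have dd : 1 <= d.+1%:R :> R by rewrite ler1n.
  lra.
have [c1 ceta] := c0_eta m0 hm he.
have cap c : gam * l <= c -> capR A rho c /\ capW A N ell W c.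
  by move=> mc; split; [exact: capR_rhoM|exact: (capW_WM l01 g01 e01 d01 lev)].
have NW : (400 * nnz A + 400 * N + 420 <= W)%N.
  have zL : (nnz A <= L * nnz A)%N by rewrite leq_pmull //; clear -L7; lia.
  rewrite /W /WM; move: (L * nnz A)%N (nnz A) zL Nz z0 => a b; clear; lia.
pose s0 := input A l gam eps de v [::].
pose v' := mvec d.+1 (colseq A) (nth 0 [seq v i 0 | i <- enum 'I_d.+1]).
pose tau := (700 * L + 850 * nnz A + 300 + (K + 2) * (rung_time K Q rho W + 60))%N.
pose f s' := sqn (colvec d.+1 (colseq A) s' 4 - exact_out A lam nu l gam K v').
have S1 : spec (prelude ;; main) s0 tau (fun s' => forall j, j \notin colseq A -> rmem s' 4 j = 0) f
    (de * ((eps / 2) ^+ 2 * sqn v)).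
  apply: (spec_dseq DP) => s1 [Bs Eg E1 E4].
  have SM := spec_main eig l_le lh l01 gp (small_par R L7 rL) (tau1_sixth R L7 rL) z0 isT cap NW c1
    Bs Eg (leqnn _).
  have Ev : colvec d.+1 (colseq A) s1 1 = v' by rewrite /colvec E1.
  rewrite Ev in SM; apply: (spec_weaken SM (leqnn _)) => //.
    by move=> s' H j jc; rewrite H // E4.
  by apply: (fail_le L7 rL he hd); rewrite sqn_ge0 sqn_maskv.
have S2 := spec_markov (f := f) (fun s' _ => sqn_ge0 _) (mulr_ge0 (sqr_ge0 (eps / 2)) (sqn_ge0 v)) (ltW dp) S1.
pose bad s' := ~~ approx_pcp lam nu l gam eps v (output d.+1 s').
have S3 : spec (prelude ;; main) s0 tau (fun=> True) (fun s' => (bad s')%:R) de.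
  apply: (spec_weaken S2 (leqnn _)) => // s' off; rewrite /bad.
  rewrite ler_nat; case: ltP => [_|close]; first by case: (~~ _).
  suff -> : approx_pcp lam nu l gam eps v (output d.+1 s') by [].
  apply: (approx_of_close eig l_le l01 g01 ep (lexx _) ceta (series_eta L7 he) (mul_maskv A v) (sqn_maskv A v)).
  have -> : output d.+1 s' = colvec d.+1 (colseq A) s' 4; last exact: close.
  by apply/colP => j; rewrite !mxE; case: ifPn => // /off.
have [NN [out [H1 H2]]] := spec_prob S3.
exists NN, out; split; last first.
  apply: le_trans H2 _; rewrite /prob ler_wpM2r ?invr_ge0 // ler_nat.
  by apply/subset_leq_card/fintype.subsetP => w; rewrite !inE /bad negbK.
move=> w; have [rest [t [ex tt]]] := H1 w; exists rest, t; split=> //.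
rewrite addn0; apply: (@le_trans _ _ tau%:R); first by rewrite ler_nat.
have TL : (tau <= 2400 * (K * K * (Q * Q * (rho * W))))%N.
  apply: total_le => //; first by clear -L7; lia.
    by rewrite /Q; clear -L7; nia.
  by rewrite /W /WM leq_pmull.
apply: (@le_trans _ _ (2400 * (K * K * (Q * Q * (rho * W))))%:R); first by rewrite ler_nat.
rewrite /K /Q /W /WM total_real.
set lf := log_factor _ _ _ _ _.
have L0 : (0 < L)%N by clear -L7; lia.
have Llf : L%:R <= 12 / ln 2 * lf := L_le_log l01 gp ep dp (l2norm_ge0 v) L0 lev.
have G := rhoM_nnz_le l01 g01 l1 z0 (ltW F0).
have t0 := time_cst_ge0 R.
move: (time_cst R) t0 => tc t0.
have -> : tc * (12 / ln 2) ^+ 7 * 4 * lf ^+ 7 = tc * (12 / ln 2 * lf) ^+ 7 * 4.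
  by rewrite exprMn; ring.
rewrite -[leRHS]mulrA; apply: ler_pM => //.
  by rewrite mulr_ge0 // exprn_ge0.
by rewrite ler_wpM2l // lerXn2r ?nnegrE // (le_trans _ Llf).
Qed.
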